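(* Let $X$ be a reflexive Banach space with $1$-symmetric basis, let $d_0>1$ and let $\Omega$ be a bounded open subset of $\mathbb{R}^{d_0}$. Then the space $JF_X^{*}(\Omega)$ is not isomorphic to a quotient of $JF_X^{*}$. In particular, $JF_X(\Omega)$ is not isomorphic to a subspace of $JF_X$.
   Context: Let $X$ be a (infinite-dimensional, real) reflexive Banach space with norm $\|\cdot\|_X$ and a $1$-symmetric basis $(e_n)_{n}$, i.e. $\|\sum_n \epsilon_n a_n e_{\pi(n)}\|_X=\|\sum_n a_n e_n\|_X$ for all finitely supported real $(a_n)$, all signs $\epsilon_n\in\{-1,1\}$ and all permutations $\pi$ of $\mathbb{N}$. For a (nonempty) bounded open set $\Omega\subset\mathbb{R}^{d}$, $\mathcal{P}(\Omega)$ denotes the set of all open parallelepipeds $T=\prod_{i=1}^{d}(\alpha_i,\beta_i)$, $\alpha_i<\beta_i$, with $T\subset\Omega$. With $\mu$ Lebesgue measure, $JF_X(\Omega)$ is the completion of $L^1(\Omega)$ under the norm $\|f\|_{JF_X(\Omega)}=\sup\{\|\sum_{j=1}^m(\int_{T_j}f\,d\mu)e_j\|_X : m\in\mathbb{N},\ T_1,\dots,T_m\in\mathcal{P}(\Omega)\text{ pairwise disjoint}\}$, and $JF_X^*(\Omega)$ is its dual. $JF_X=JF_X((0,1))$ (the case $\Omega=(0,1)\subset\mathbb{R}$) and $JF_X^*$ is its dual. *)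

(* Defs.v *)
From HB Require Import structures.
From mathcomp Require Import all_boot all_order all_algebra.
From mathcomp Require Import ring_quotient.
From mathcomp Require Import all_classical all_reals all_analysis.

Set Implicit Arguments.
Unset Strict Implicit.
Unset Printing Implicit Defensive.

Import Order.TTheory GRing.Theory Num.Theory.
Import numFieldNormedType.Exports.

Local Open Scope classical_set_scope.
Local Open Scope ring_scope.

Section dual.
Context {R : realType} (V : normedModType R).

Definition continuous_functional : {pred V -> R^o} :=
  fun f => `[< linear f /\ continuous f >].

Lemma continuous_functional_submod : submod_closed continuous_functional.
Proof.
split.
  apply/asboolP; split; first by move=> a x y /=; rewrite scaler0 addr0.
  by move=> x; exact: cvg_cst.
move=> a f g /asboolP[lf cf] /asboolP[lg cg]; apply/asboolP; split.
  move=> b x y; rewrite !fctE lf lg.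
  by rewrite !scalerDr !scalerA [a * b]mulrC addrACA.
move=> x; apply: cvgD; last exact: cg.
by apply: (continuous_comp (cf x)); exact: scaler_continuous.
Qed.

HB.instance Definition _ := GRing.isSubmodClosed.Build R (V -> R^o)
  continuous_functional continuous_functional_submod.

(* The dual space, as the continuous linear forms inside V -> R. *)
Definition dual := {f : V -> R^o | f \in continuous_functional}.

HB.instance Definition _ := [isSub of dual for sval].
HB.instance Definition _ := [Choice of dual by <:].
HB.instance Definition _ := [SubChoice_isSubLmodule of dual by <:].

Definition dual_fun (f : dual) : V -> R := val f.
Coercion dual_fun : dual >-> Funclass.

Definition dual_norm (f : dual) : R := sup [set `|f x| | x in [set x | `|x| <= 1]].

Lemma dual_linear (f : dual) : linear (f : V -> R^o).
Proof. by have /asboolP[] := valP f. Qed.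

Lemma dual_continuous (f : dual) : continuous f.
Proof. by have /asboolP[] := valP f. Qed.

HB.instance Definition _ (f : dual) :=
  GRing.isLinear.Build R V R^o *:%R (dual_fun f) (dual_linear f).

Lemma dual_bound (f : dual) : has_ubound [set `|f x| | x in [set x | `|x| <= 1]].
Proof.
have /linear_bounded_continuous/linear_boundedP := @dual_continuous f.
move=> /pinfty_ex_gt0[M M0 fM]; exists M => _ [x /= x1 <-].
by rewrite (le_trans (fM x))// ler_piMr// ltW.
Qed.

Lemma dual_norm_ub (f : dual) x : `|x| <= 1 -> `|f x| <= dual_norm f.
Proof. by move=> x1; apply: ub_le_sup; [exact: dual_bound|exists x]. Qed.

Lemma dual_norm_le (f : dual) M :
  (forall x, `|x| <= 1 -> `|f x| <= M) -> dual_norm f <= M.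
Proof.
move=> fM; apply: ge_sup; first by exists `|f 0|, 0 => //=; rewrite normr0.
by move=> _ [x x1 <-]; exact: fM.
Qed.

Lemma dual_normD (f g : dual) : dual_norm (f + g) <= dual_norm f + dual_norm g.
Proof.
apply: dual_norm_le => x x1; rewrite (le_trans (ler_normD _ _))//.
by rewrite lerD// dual_norm_ub.
Qed.

Lemma dual_normZ a (f : dual) : dual_norm (a *: f) = `|a| * dual_norm f.
Proof.
have le b (g : dual) : dual_norm (b *: g) <= `|b| * dual_norm g.
  apply: dual_norm_le => x x1; rewrite [X in `|X|]/(b * g x) normrM.
  by rewrite ler_wpM2l// dual_norm_ub.
apply/eqP; rewrite eq_le le/=.
have [->|a0] := eqVneq a 0.
  rewrite normr0 mul0r; apply: le_trans (dual_norm_ub _ (x := 0) _) => //.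
  by rewrite normr0.
rewrite mulrC -ler_pdivlMr ?normr_gt0// mulrC -normfV.
by rewrite -{1}[f](scalerK a0); exact: le.
Qed.

Lemma dual_norm0_eq0 (f : dual) : dual_norm f = 0 -> f = 0.
Proof.
move=> f0; apply/val_inj/funext => x /=.
have [->|x0] := eqVneq x 0; first by rewrite [LHS](linear0 f).
have : `|f (`|x|^-1 *: x)| <= 0 by rewrite -f0 dual_norm_ub// normfZV.
rewrite normr_le0 linearZ/= mulf_eq0 invr_eq0 normr_eq0 (negbTE x0)/=.
by move=> /eqP.
Qed.

HB.instance Definition _ := Lmodule_isNormed.Build R dual
  dual_normD dual_normZ dual_norm0_eq0.

End dual.

(* The canonical map from V to its bidual is onto. *)
Definition reflexive_space {R : realType} (V : normedModType R) :=
  forall phi : dual (dual V), exists x : V, forall f : dual V, phi f = f x.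

Section subspace_quotient.
Context {R : realType} (V : normedModType R).

Section subspace.
Variable N : submodClosed V.

Definition normed_subspace := {x : V | x \in N}.

HB.instance Definition _ := [isSub of normed_subspace for sval].
HB.instance Definition _ := [Choice of normed_subspace by <:].
HB.instance Definition _ := [SubChoice_isSubLmodule of normed_subspace by <:].

Definition subspace_norm (x : normed_subspace) : R := `|val x|.

Lemma subspace_normD x y :
  subspace_norm (x + y) <= subspace_norm x + subspace_norm y.
Proof. exact: ler_normD. Qed.

Lemma subspace_normZ a x : subspace_norm (a *: x) = `|a| * subspace_norm x.
Proof. exact: normrZ. Qed.

Lemma subspace_norm0_eq0 x : subspace_norm x = 0 -> x = 0.
Proof. by move=> /normr0_eq0 x0; exact: val_inj. Qed.

HB.instance Definition _ := Lmodule_isNormed.Build R normed_subspace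
  subspace_normD subspace_normZ subspace_norm0_eq0.

End subspace.

Record closed_subspace := ClosedSubspace {
  closed_subspace_sort :> submodClosed V ;
  closed_subspaceP : closed [set x | x \in closed_subspace_sort] }.

Section quotient.
Local Open Scope quotient_scope.
Variable N : closed_subspace.

Definition quotient_kernel : {pred V} := fun x => x \in (N : submodClosed V).

Lemma quotient_kernel_submod : submod_closed quotient_kernel.
Proof. exact: (submodClosedP N). Qed.

HB.instance Definition _ := GRing.isSubmodClosed.Build R V
  quotient_kernel quotient_kernel_submod.

Definition normed_quotient := Quotient.quot quotient_kernel.

HB.instance Definition _ := GRing.Zmodule.on normed_quotient.
HB.instance Definition _ :=
  EqQuotient.on normed_quotient.

Let pi (x : V) : normed_quotient := \pi_(Quotient.quot quotient_kernel) x.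

Lemma quotient_piP x y : (pi x = pi y) <-> (x - y \in N).
Proof. by split=> [/eqP|xy]; [|apply/eqP]; rewrite -Quotient.idealrBE. Qed.

Lemma quotient_piD x y : pi (x + y) = pi x + pi y.
Proof. by rewrite /pi [LHS]raddfD. Qed.

Lemma quotient_pi_surj q : exists x, pi x = q.
Proof. by exists (repr q); rewrite /pi reprK. Qed.

Definition quotient_scale (a : R) (q : normed_quotient) : normed_quotient :=
  pi (a *: repr (q : (Quotient.quot quotient_kernel))).

Lemma quotient_piZ a x : pi (a *: x) = quotient_scale a (pi x).
Proof.
apply/quotient_piP; rewrite -scalerBr rpredZ//.
by apply/quotient_piP; rewrite /pi reprK.
Qed.

Lemma quotient_scalerA a b q :
  quotient_scale a (quotient_scale b q) = quotient_scale (a * b) q.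
Proof.
by have [x <-] := quotient_pi_surj q; rewrite -!quotient_piZ scalerA.
Qed.

Lemma quotient_scale1r : left_id 1 quotient_scale.
Proof.
by move=> q; have [x <-] := quotient_pi_surj q; rewrite -quotient_piZ scale1r.
Qed.

Lemma quotient_scalerDr : right_distributive quotient_scale +%R.
Proof.
move=> a p q; have [x <-] := quotient_pi_surj p.
have [y <-] := quotient_pi_surj q.
by rewrite -quotient_piD -!quotient_piZ -quotient_piD scalerDr.
Qed.

Lemma quotient_scalerDl q : {morph quotient_scale^~ q : a b / a + b}.
Proof.
move=> a b; have [x <-] := quotient_pi_surj q.
by rewrite -!quotient_piZ -quotient_piD scalerDl.
Qed.

HB.instance Definition _ := GRing.Zmodule_isLmodule.Build R normed_quotient
  quotient_scalerA quotient_scale1r quotient_scalerDr quotient_scalerDl.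

Lemma quotient_scaleE a x : a *: pi x = pi (a *: x).
Proof. by rewrite quotient_piZ. Qed.

Definition quotient_norm (q : normed_quotient) : R :=
  inf [set `|x| | x in [set x | pi x = q]].

Lemma quotient_norm_lb q : has_lbound [set `|x| | x in [set x | pi x = q]].
Proof. by exists 0 => _ [x _ <-]. Qed.

Lemma quotient_norm_neq0 q : [set `|x| | x in [set x | pi x = q]] !=set0.
Proof. by have [x xq] := quotient_pi_surj q; exists `|x|, x. Qed.

Lemma quotient_norm_le x : quotient_norm (pi x) <= `|x|.
Proof. by apply: ge_inf; [exact: quotient_norm_lb|exists x]. Qed.

Lemma quotient_norm_adherent q (eps : R) : 0 < eps ->
  exists2 x, pi x = q & `|x| < quotient_norm q + eps.
Proof.
move=> e0; have hinf : has_inf [set `|x| | x in [set x | pi x = q]].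
  by split; [exact: quotient_norm_neq0|exact: quotient_norm_lb].
by have [_ [x xq <-] xe] := inf_adherent e0 hinf; exists x.
Qed.

Lemma quotient_normD p q :
  quotient_norm (p + q) <= quotient_norm p + quotient_norm q.
Proof.
apply/ler_addgt0Pr => e e0; have e20 : 0 < e / 2 by rewrite divr_gt0.
have [x <- xp] := quotient_norm_adherent p e20.
have [y <- yq] := quotient_norm_adherent q e20.
rewrite -quotient_piD (le_trans (quotient_norm_le _))//.
rewrite (le_trans (ler_normD _ _))// [e]splitr addrACA.
by rewrite lerD// ltW.
Qed.

Lemma quotient_normZ a q : quotient_norm (a *: q) = `|a| * quotient_norm q.
Proof.
have le b (p : normed_quotient) : quotient_norm (b *: p) <= `|b| * quotient_norm p.
  have [->|b0] := eqVneq b 0.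
    have [x <-] := quotient_pi_surj p;
    rewrite quotient_scaleE scale0r (le_trans (quotient_norm_le _))//.
    by rewrite !normr0 mul0r.
  apply/ler_addgt0Pr => e e0; have b_gt0 : 0 < `|b| by rewrite normr_gt0.
  have eb0 : 0 < e / `|b| by rewrite divr_gt0.
  have [x <- xp] := quotient_norm_adherent p eb0.
  rewrite quotient_scaleE.
  rewrite (le_trans (quotient_norm_le _))// normrZ.
  rewrite -[e](divfK (lt0r_neq0 b_gt0)) [_ / _ * _]mulrC -mulrDr.
  by rewrite ler_wpM2l// ltW.
apply/eqP; rewrite eq_le le/=.
have [->|a0] := eqVneq a 0.
  rewrite normr0 mul0r; apply: lb_le_inf; first exact: quotient_norm_neq0.
  by move=> _ [x _ <-].
rewrite mulrC -ler_pdivlMr ?normr_gt0// mulrC -normfV.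
by rewrite -{1}[q](scalerK a0); exact: le.
Qed.

Lemma quotient_norm0_eq0 q : quotient_norm q = 0 -> q = 0.
Proof.
have [x <-] := quotient_pi_surj q => x0.
have : pi x = pi 0 -> pi x = 0 by move=> ->; rewrite /pi [LHS]raddf0.
apply; apply/quotient_piP; rewrite subr0.
apply: (closed_subspaceP (c := N)) => B /nbhs_ballP[e /= e0 eB].
have [y xy ye] := quotient_norm_adherent (pi x) e0.
exists (x - y); split; first by apply/quotient_piP.
apply: eB; rewrite -ball_normE /= opprB addrC subrK.
by rewrite x0 add0r in ye.
Qed.

HB.instance Definition _ := Lmodule_isNormed.Build R normed_quotient
  quotient_normD quotient_normZ quotient_norm0_eq0.

End quotient.
End subspace_quotient.

Definition isomorphic {R : realType} (V W : normedModType R) :=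
  exists (f : {linear V -> W}) (g : {linear W -> V}),
    [/\ continuous f, continuous g, cancel f g & cancel g f].

Definition isomorphic_to_subspace {R : realType} (W V : normedModType R) :=
  exists N : submodClosed V, isomorphic W (normed_subspace N).

Definition isomorphic_to_quotient {R : realType} (W V : normedModType R) :=
  exists N : closed_subspace V, isomorphic W (normed_quotient N).

Section rV_measurable.
Context {R : realType}.

Definition rV_coord n (i : 'I_n) (x : 'rV[R]_n) : R := x ord0 i.

(* The product sigma-algebra, generated by the coordinates. *)
Section instance.
Variable n : nat.

Let rV_set0 : g_sigma_preimage (@rV_coord n) set0.
Proof. exact: sigma_algebra0. Qed.

Let rV_setC A : g_sigma_preimage (@rV_coord n) A ->
  g_sigma_preimage (@rV_coord n) (~` A).
Proof. exact: sigma_algebraC. Qed.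

Let rV_bigcup (F : (set 'rV[R]_n)^nat) :
  (forall i, g_sigma_preimage (@rV_coord n) (F i)) ->
  g_sigma_preimage (@rV_coord n) (\bigcup_i F i).
Proof. exact: sigma_algebra_bigcup. Qed.

HB.instance Definition _ := @isMeasurable.Build default_measure_display
  'rV[R]_n (g_sigma_preimage (@rV_coord n)) rV_set0 rV_setC rV_bigcup.

End instance.

Lemma measurable_rV_coord n (i : 'I_n) : measurable_fun setT (rV_coord i).
Proof.
move=> _ Y mY; rewrite setTI; apply: sub_sigma_algebra => /=.
rewrite -bigcup_seq/=; exists i => /=; first by rewrite mem_index_enum.
by exists Y => //; rewrite setTI.
Qed.

Lemma measurable_fun_rV d (T : measurableType d) n (f : T -> 'rV[R]_n) :
  (forall i, measurable_fun setT (rV_coord i \o f)) -> measurable_fun setT f.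
Proof.
move=> mf; move=> _ A mA; rewrite setTI; move: A mA.
suff : g_sigma_preimage (@rV_coord n) `<=` [set A | measurable (f @^-1` A)] by [].
apply: smallest_sub.
  split => /=; first by rewrite preimage_set0.
    by move=> A mA; rewrite setTD preimage_setC; exact: measurableC.
  by move=> F mF; rewrite preimage_bigcup; exact: bigcup_measurable.
rewrite -bigcup_seq => A [i _ [B mB <-]] /=; rewrite setTI.
by rewrite -[X in measurable X]setTI; exact: mf.
Qed.

Definition rV_cons n (xv : R * 'rV[R]_n) : 'rV[R]_n.+1 :=
  row_mx (\row_(_ < 1) xv.1) xv.2.

Definition rV_uncons n (x : 'rV[R]_n.+1) : R * 'rV[R]_n :=
  (x ord0 ord0, \row_i x ord0 (lift ord0 i)).

Lemma rV_cons0 n (xv : R * 'rV[R]_n) : rV_cons xv ord0 ord0 = xv.1.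
Proof.
rewrite /rV_cons (_ : ord0 = lshift n (@ord0 0)); last exact/val_inj.
by rewrite (row_mxEl (n1 := 1)) mxE.
Qed.

Lemma rV_consS n (xv : R * 'rV[R]_n) i :
  rV_cons xv ord0 (lift ord0 i) = xv.2 ord0 i.
Proof.
rewrite /rV_cons (_ : lift ord0 i = rshift 1 i); last exact/val_inj.
by rewrite (row_mxEr (n1 := 1)).
Qed.

Lemma rV_consK n : cancel (@rV_cons n) (@rV_uncons n).
Proof.
move=> [x v]; rewrite /rV_uncons rV_cons0; congr pair.
by apply/rowP => i; rewrite mxE rV_consS.
Qed.

Lemma measurable_rV_cons n : measurable_fun setT (@rV_cons n).
Proof.
apply: measurable_fun_rV => i; case: (unliftP ord0 i) => [j|] ->.
  rewrite (_ : _ \o _ = rV_coord j \o snd); last first.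
    by apply/funext => xv /=; rewrite /rV_coord rV_consS.
  apply: measurableT_comp => //; exact: measurable_rV_coord.
rewrite (_ : _ \o _ = fst); first exact: measurable_fst.
by apply/funext => xv /=; rewrite /rV_coord rV_cons0.
Qed.

Lemma measurable_rV_uncons n : measurable_fun setT (@rV_uncons n).
Proof.
apply: measurable_fun_pair; first exact: measurable_rV_coord.
apply: measurable_fun_rV => i.
rewrite (_ : _ \o _ = rV_coord (lift ord0 i)); first exact: measurable_rV_coord.
by apply/funext => x; rewrite /rV_coord /= mxE.
Qed.

End rV_measurable.

Section lebesgue_rV.
Context {R : realType}.
Local Open Scope ereal_scope.

Section step.
Variables (n : nat) (mu : {sigma_finite_measure set 'rV[R]_n -> \bar R}).

(* The product of Lebesgue measure on R with mu, carried by R^(n+1). *)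
Definition lebesgue_rV_step : set 'rV[R]_n.+1 -> \bar R :=
  pushforward (lebesgue_measure \x mu) (@rV_cons R n).

Let mcons : measurable_fun setT (@rV_cons R n) := @measurable_rV_cons R n.

Let step0 : lebesgue_rV_step set0 = 0.
Proof. by rewrite /lebesgue_rV_step /pushforward preimage_set0 measure0. Qed.

Let step_ge0 A : 0 <= lebesgue_rV_step A.
Proof. exact: measure_ge0. Qed.

Let step_sigma_additive : semi_sigma_additive lebesgue_rV_step.
Proof.
move=> F mF tF mUF; rewrite /lebesgue_rV_step /pushforward preimage_bigcup.
apply: measure_semi_sigma_additive.
- by move=> k; rewrite -[X in measurable X]setTI; exact: mcons.
- apply/trivIsetP => /= i j _ _ ij; rewrite -preimage_setI.
  by move/trivIsetP : tF => /(_ _ _ _ _ ij) ->//; rewrite preimage_set0.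
- by rewrite -preimage_bigcup -[X in measurable X]setTI; exact: mcons.
Qed.

HB.instance Definition _ := isMeasure.Build _ _ _ lebesgue_rV_step
  step0 step_ge0 step_sigma_additive.

Let step_sigma_finite : sigma_finite setT lebesgue_rV_step.
Proof.
have /sigma_finiteP[F [FT ndF Foo]] := sigma_finiteT (@lebesgue_measure R).
have /sigma_finiteP[G [GT ndG Goo]] := sigma_finiteT mu.
exists (fun k => @rV_uncons R n @^-1` (F k `*` G k)).
  rewrite -preimage_bigcup (_ : \bigcup_k _ = setT) ?preimage_setT//.
  rewrite -subTset => -[x v] _.
  have [i _ Fix] : (\bigcup_i F i) x by rewrite -FT.
  have [j _ Gjv] : (\bigcup_j G j) v by rewrite -GT.
  exists (maxn i j) => //; split.
    by move: x Fix; exact/subsetPset/ndF/leq_maxl.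
  by move: v Gjv; exact/subsetPset/ndG/leq_maxr.
move=> k; have [mFk Fkoo] := Foo k; have [mGk Gkoo] := Goo k.
have mFG : measurable (F k `*` G k) by exact: measurableX.
split; first by rewrite -[X in measurable X]setTI; exact: measurable_rV_uncons.
rewrite /lebesgue_rV_step /pushforward -comp_preimage.
rewrite (_ : _ \o _ = id); last by apply/funext; exact: rV_consK.
by rewrite preimage_id product_measure1E// lte_mul_pinfty// ge0_fin_numE.
Qed.

HB.instance Definition _ := Measure_isSigmaFinite.Build _ _ _ lebesgue_rV_step
  step_sigma_finite.

End step.

Fixpoint lebesgue_rV n : {sigma_finite_measure set 'rV[R]_n -> \bar R} :=
  if n is n'.+1 then lebesgue_rV_step (lebesgue_rV n')
  else (\d_ (0 : 'rV[R]_0))%R.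

End lebesgue_rV.

Section parallelepiped.
Context {R : realType}.

Definition box n (a b : 'rV[R]_n) : set 'rV[R]_n :=
  [set x | forall i, a ord0 i < x ord0 i < b ord0 i].

Lemma lebesgue_rV_box n (a b : 'rV[R]_n) :
  (forall i, a ord0 i < b ord0 i) ->
  lebesgue_rV n (box a b) = (\prod_i (b ord0 i - a ord0 i))%:E.
Proof.
elim: n a b => [|n IHn] a b ab.
  rewrite big_ord0 /= diracE mem_set//; by case.
set a' := \row_i a ord0 (lift ord0 i); set b' := \row_i b ord0 (lift ord0 i).
have mbox k (c d : 'rV[R]_k) : measurable (box c d).
  rewrite (_ : box c d = \big[setI/setT]_(i < k)
      (rV_coord i @^-1` `]c ord0 i, d ord0 i[%classic)).
    apply: bigsetI_measurable => i _; rewrite -[X in measurable X]setTI.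
    exact: measurable_rV_coord.
  apply/seteqP; split => x /=.
    move=> cxd; elim/big_ind: _ => //= i _.
    by rewrite in_itv/= /rV_coord cxd.
  by move=> + i; rewrite (bigD1 i)//= => -[+ _]; rewrite in_itv.
rewrite /= /lebesgue_rV_step /pushforward.
rewrite (_ : _ @^-1` _ = `]a ord0 ord0, b ord0 ord0[ `*` box a' b').
  rewrite product_measure1E//; last exact: mbox.
  rewrite IHn; last by move=> i; rewrite !mxE.
  transitivity ((b ord0 ord0 - a ord0 ord0)%:E *
      (\prod_i (b' ord0 i - a' ord0 i))%:E)%E.
    congr (_ * _)%E.
    apply: (etrans (lebesgue_measure_itv `]a ord0 ord0, b ord0 ord0[)).
    by rewrite /= lte_fin ab.
  rewrite -EFinM big_ord_recl.
  by congr (_ * _)%:E; apply: eq_bigr => i _; rewrite !mxE.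
apply/seteqP; split => [xv /= xvab|xv /= [xv1 xv2] i].
  split; first by rewrite in_itv/= -(rV_cons0 xv) xvab.
  by move=> i; rewrite !mxE -rV_consS xvab.
case: (unliftP ord0 i) => [j|] ->; last first.
  by rewrite rV_cons0; move: xv1; rewrite in_itv.
by rewrite rV_consS; have := xv2 j; rewrite !mxE.
Qed.

End parallelepiped.

Definition schauder_basis {R : realType} (X : normedModType R) (e : nat -> X) :=
  forall x : X, exists! a : nat -> R,
    series (fun n => a n *: e n) @ \oo --> x.

Definition symmetric_basis {R : realType} (X : normedModType R) (e : nat -> X) :=
  schauder_basis e /\
  forall (N : nat) (a : nat -> R) (s : nat -> bool) (p : nat -> nat),
    bijective p ->
    `|\sum_(n < N) ((-1) ^+ s n * a n) *: e (p n)| =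
    `|\sum_(n < N) a n *: e n|.

Section JF.
Context {R : realType} {X : normedModType R} (e : nat -> X).
Context {d : nat} (Omega : set 'rV[R]_d).

Local Notation mu := (@lebesgue_rV R d).

Definition parallelepipeds : set (set 'rV[R]_d) :=
  [set T | T `<=` Omega /\
    exists a b : 'rV[R]_d, (forall i, a ord0 i < b ord0 i) /\ T = box a b].

(* Representatives of the classes in L^1(Omega). *)
Definition L1 : set ('rV[R]_d -> R) :=
  [set f | mu.-integrable Omega (EFin \o f)].

Definition JF_norm (f : 'rV[R]_d -> R) : R :=
  sup [set r | exists (m : nat) (T : 'I_m -> set 'rV[R]_d),
    [/\ forall j, parallelepipeds (T j), trivIset setT T &
        r = `|\sum_(j < m) (\int[mu]_(x in T j) f x) *: e j|]].

(* J, with the map iota, is the completion of L^1(Omega) under JF_norm.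
   JF_norm is the norm only on classes modulo equality a.e. on Omega: iota is
   given on representatives, and the second clause makes it factor through
   those classes. Its values outside L1 are irrelevant. *)
Definition is_JF (J : completeNormedModType R) (iota : ('rV[R]_d -> R) -> J) :=
  [/\ forall (a : R) f g, L1 f -> L1 g ->
        iota (fun x => a * f x + g x) = a *: iota f + iota g,
      forall f, L1 f -> `|iota f| = JF_norm f &
      dense (iota @` L1)].

End JF.

Definition unit_interval {R : realType} : set 'rV[R]_1 :=
  [set x | 0 < x ord0 ord0 < 1].

(* Main.v *)
(** In dimension one the finite combinations of the functionals
    delta_s : f |-> int_0^s f are norm dense in the dual of JF_X: a function of
    norm one whose primitive vanishes on a fine partition has, once its few large
    gaps are erased, a uniformly small primitive, and uniformly null bounded
    sequences are weakly null (Ptak's combinatorial lemma plays the role of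
    dominated convergence on the compact set of norming functionals).

    In dimension at least two fix coordinates x_0, x_1, levels d_0 < d_1 < ... of
    x_1, and for each t the jump functional psi_(t,k) on the dual: the limit along
    an ultrafilter of the values at spikes that shrink to
    {x_0 = t, d_k < x_1 < d_(k+1)}. The functionals M_m integrating over
    {x_0 < t, x_1 < d_m} satisfy psi_(t,k)(M_m) = 1 if k < m and 0 otherwise,
    whereas for a given functional M only countably many t have psi_(t,k)(M) <> 0,
    since |e_1 + ... + e_N| = o(N).

    Let Q map the dual of JF_X onto that of JF_X(Omega), and choose t with
    psi_(t,k)(Q delta_q) = 0 for all k and rational q. Write M_m = Q L_m and
    approximate L_m by sum_i c_i delta_(s_i). The coefficients of L_m define an
    element of X*, and, since the rational q are killed and disjoint intervals
    (q_i, s_i) are available, the numbers psi_(t,k)(Q delta_s) define an element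
    of X; both stay bounded. Their pairings are close to the matrix 1_(k < m),
    whose two iterated limits differ: X would not be reflexive. An embedding of
    JF_X(Omega) into JF_X gives such a Q by transposition. *)

Require Import Defs.
From HB Require Import structures.
From mathcomp Require Import all_boot all_order all_algebra.
From mathcomp Require Import all_classical all_reals all_analysis.
From mathcomp Require Import measurable_realfun lra.
Import Order.TTheory GRing.Theory Num.Theory.
Import numFieldNormedType.Exports.
Local Open Scope classical_set_scope.
Local Open Scope ring_scope.

Set Implicit Arguments.
Unset Strict Implicit.
Unset Printing Implicit Defensive.

(** The choice of [t] is the obstacle. Each functional has only countably many nonzero jumps, but
    the points s form a continuum, so no [t] can be expected to kill every Q delta_s; this can be
    asked of countably many s only. The rationals suffice: psi(Q delta_s) is then also the value at
    Q(delta_s - delta_q) for a rational q just below s, and differences over disjoint intervals are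
    controlled by the norm of X. The second coordinate supplies infinitely many jumps along the
    single hyperplane x_0 = t.

    Reflexivity excludes the two extremes c_0 and l_1: |e_1 + ... + e_N| is unbounded, which limits
    the number of large gaps, and it is o(N), which makes families of short intervals negligible and
    the jumps countable.

    Compactness of the norming functionals is realised by ultralimits of their data, the endpoints
    of the intervals and the functional on X. Listing the intervals by decreasing length makes the
    tails uniformly small, so that only finitely many coordinates have to pass to the limit. *)

Lemma dual_le {R : realType} {V : normedModType R} (f : dual V) x :
  `|f x| <= `|f| * `|x|.
Proof.
have [->|x0] := eqVneq x 0; first by rewrite linear0 !normr0 mulr0.
have x_gt0 : 0 < `|x| by rewrite normr_gt0.
rewrite -ler_pdivrMr// mulrC.
have := dual_norm_ub f (x := `|x|^-1 *: x).
rewrite normfZV// => /(_ (lexx _)).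
by rewrite linearZ/= normrM normfV normr_id.
Qed.

Lemma dualZ {R : realType} {V : normedModType R} (f : dual V) a x : f (a *: x) = a * f x.
Proof. exact: linearZ. Qed.

Lemma dual_of {R : realType} {V : normedModType R} (l : V -> R) (C : R) :
  (forall a x y, l (a *: x + y) = a * l x + l y) ->
  (forall x, `|l x| <= C * `|x|) -> 0 <= C ->
  exists f : dual V, (forall x, f x = l x) /\ `|f| <= C.
Proof.
move=> lin lC C0.
have ll : linear (l : V -> R^o) by move=> a x y; exact: lin.
pose L : {linear V -> R^o} := HB.pack (l : V -> R^o)
  (GRing.isLinear.Build R V R^o *:%R l ll).
have cl : continuous (L : V -> R^o).
  apply/linear_bounded_continuous/linear_boundedP; exists C; split; first exact: num_real.
  by move=> M CM x; rewrite (le_trans (lC x))// ler_wpM2r// ltW.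
have lmem : (l : V -> R^o) \in @continuous_functional R V by apply/asboolP; split.
exists (Sub (l : V -> R^o) lmem : dual V); split=> //.
apply: dual_norm_le => x x1; rewrite (le_trans (lC x))//.
by rewrite ler_piMr.
Qed.

(** * Hahn-Banach and ultralimits *)

Section HahnBanach.
Context {R : realType} {V : normedModType R}.
Variables (N : set V) (l : V -> R) (C : R).
Hypothesis N0 : N 0.
Hypothesis NZD : forall a x y, N x -> N y -> N (a *: x + y).
Hypothesis lin : forall a x y, N x -> N y -> l (a *: x + y) = a * l x + l y.
Hypothesis lC : forall x, N x -> `|l x| <= C * `|x|.
Hypothesis C0 : 0 <= C.

Let graph0 : set (V * R) := [set q | N q.1 /\ q.2 = l q.1].

(** Containing [graph0] is asked only of nonempty sets, because the union over an empty chain must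
    be admissible too. *)
Let dominated (G : set (V * R)) :=
  [/\ (forall q, G q -> graph0 `<=` G),
      (forall a p q, G p -> G q -> G (a *: p.1 + q.1, a * p.2 + q.2)) &
      (forall q, G q -> q.2 <= C * `|q.1|)].

Let maximal_dominated :
  exists G, dominated G /\ forall H, G `<` H -> ~ dominated H.
Proof.
apply: Zorn_bigcup => F FP Ftot; split.
- by move=> q [X FX Xq] g0 g0g; exists X => //; have [/(_ _ Xq) + _ _] := FP _ FX; exact.
- move=> a p q [X FX Xp] [Y FY Yq].
  have [XY|YX] := Ftot _ _ FX FY.
    by exists Y => //; have [_ + _] := FP _ FY; apply => //; exact: XY.
  by exists X => //; have [_ + _] := FP _ FX; apply => //; exact: YX.
- by move=> q [X FX Xq]; have [_ _] := FP _ FX; exact.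
Qed.

Lemma hahn_banach : exists f : dual V, (forall x, N x -> f x = l x) /\ `|f| <= C.
Proof.
have [G [[G0 Glin Gdom] Gmax]] := maximal_dominated.
have d0 : dominated graph0.
  split; first by move=> q _ z.
    by move=> a p q [Np pE] [Nq qE]; split => /=; [exact: NZD|rewrite pE qE lin].
  by move=> [q1 q2] [/= Nq ->]; rewrite (le_trans (ler_norm _))// lC.
have l0 : l 0 = 0.
  by have := lC N0; rewrite normr0 mulr0 normr_le0 => /eqP.
have g00 : graph0 (0, 0) by split => //=.
have sG : graph0 `<=` G.
  have [[q Gq]|/set0P/negP/negPn/eqP Ge] := pselect (G !=set0); first exact: (G0 q).
  exfalso; apply: (Gmax graph0) => //; split; first by rewrite Ge.
  by rewrite Ge => /(_ _ g00).
have G00 : G (0, 0) by exact: sG.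
have Gfun x a b : G (x, a) -> G (x, b) -> a = b.
  have le c d : G (x, c) -> G (x, d) -> c <= d.
    move=> Gc Gd; have := Gdom _ (Glin (-1) _ _ Gd Gc) => /=.
    by rewrite scaleN1r addNr normr0 mulr0 mulN1r addrC subr_le0.
  by move=> Ga Gb; apply/eqP; rewrite eq_le !le.
have Gtot v : exists a, G (v, a).
  apply: contrapT => nv.
  (* A value [c] at [v] is admissible when a - C |x - v| <= c <= C |y + v| - b for all points (x,
     a), (y, b) of the graph; the supremum of the left sides works. *)
  pose S := [set q.2 - C * `|q.1 - v| | q in G].
  have Sub y b : G (y, b) -> ubound S (C * `|y + v| - b).
    move=> Gy _ [[x a] /= Gx <-].
    have := Gdom _ (Glin 1 _ _ Gx Gy); rewrite /= scale1r mul1r => ab.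
    have : C * `|x + y| <= C * `|x - v| + C * `|y + v|.
      rewrite -mulrDr ler_wpM2l//.
      by apply: le_trans (ler_normD _ _); rewrite addrACA addNr addr0.
    lra.
  have S0 : S !=set0 by exists (0 - C * `|0 - v|), (0, 0).
  have hS : has_sup S by split => //; exists (C * `|0 + v| - 0); exact: (Sub 0 0 G00).
  pose c := sup S.
  have c1 x a : G (x, a) -> a - C * `|x - v| <= c.
    by move=> Gx; apply: sup_upper_bound => //; exists (x, a).
  have c2 y b : G (y, b) -> c <= C * `|y + v| - b.
    by move=> Gy; apply: ge_sup => //; exact: Sub.
  pose H := [set q : V * R | exists x a s, G (x, a) /\ q = (x + s *: v, a + s * c)].
  apply: (Gmax H).
    split.
      by move=> [x a] Gx; exists x, a, 0; rewrite scale0r mul0r !addr0.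
    move=> HG; apply: nv; exists c; apply: HG.
    by exists 0, 0, 1; rewrite scale1r mul1r !add0r.
  have GZ t x a : G (x, a) -> G (t *: x, t * a).
    by move=> Gx; have := Glin t _ _ Gx G00; rewrite /= !addr0.
  split.
  - move=> _ [x [a [s [Gx _]]]] [y b] gy; exists y, b, 0.
    by rewrite scale0r mul0r !addr0; split => //; exact: (G0 _ Gx).
  - move=> t _ _ [x [a [s [Gx ->]]]] [y [b [r [Gy ->]]]] /=.
    exists (t *: x + y), (t * a + b), (t * s + r); split; first exact: (Glin t _ _ Gx Gy).
    congr pair; first by rewrite scalerDr scalerA addrACA -scalerDl.
    by rewrite mulrDr mulrDl mulrA addrACA.
  - move=> _ [x [a [s [Gx ->]]]] /=.
    have [s0|s0|->] := ltgtP s 0; last by rewrite mul0r scale0r !addr0; exact: (Gdom _ Gx).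
      have ns0 : 0 < - s by rewrite oppr_gt0.
      have sE : s != 0 by rewrite lt_eqF.
      have := c1 _ _ (GZ (- s)^-1 _ _ Gx).
      rewrite -(ler_pM2l ns0) mulrBr mulrA mulfV ?oppr_eq0// mul1r mulrCA.
      rewrite -[X in C * (X * _)](gtr0_norm ns0) -normrZ scalerBr scalerA.
      rewrite mulfV ?oppr_eq0// scale1r scaleNr opprK mulNr.
      lra.
    have sE : s != 0 by rewrite gt_eqF.
    have := c2 _ _ (GZ s^-1 _ _ Gx).
    rewrite -(ler_pM2l s0) mulrBr [s * (s^-1 * a)]mulrA mulfV// mul1r mulrCA.
    rewrite -[X in C * (X * _)](gtr0_norm s0) -normrZ scalerDr scalerA mulfV// scale1r.
    lra.
pose g v := sval (cid (Gtot v)).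
have gP v : G (v, g v) by rewrite /g; case: cid.
have gl a x y : g (a *: x + y) = a * g x + g y.
  by apply: Gfun (gP _) _; exact: (Glin a _ _ (gP x) (gP y)).
have g_le v : g v <= C * `|v| by exact: (Gdom _ (gP v)).
have gN v : g (- v) = - g v.
  have := gl (-1) v 0; rewrite scaleN1r addr0 => ->.
  by rewrite mulN1r (Gfun _ _ _ (gP 0) G00) addr0.
have [f [fg fC]] : exists f : dual V, (forall x, f x = g x) /\ `|f| <= C.
  apply: dual_of => // x; rewrite ler_norml g_le andbT lerNl -gN.
  by rewrite (le_trans (g_le _))// normrN.
exists f; split=> // x Nx; rewrite fg; apply: Gfun (gP x) _.
by apply: sG.
Qed.

End HahnBanach.

Lemma norming_functional {R : realType} {V : normedModType R} (x : V) :
  exists f : dual V, `|f| <= 1 /\ f x = `|x|.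
Proof.
have [->|x0] := eqVneq x 0.
  by exists 0; rewrite normr0 ler01 linear0 normr0.
pose N := [set y : V | exists a : R, y = a *: x].
have co y : N y -> {a : R | y = a *: x} by move=> Ny; exact: cid.
pose l (y : V) : R := if pselect (N y) is left Ny then sval (co y Ny) * `|x| else 0.
have lE a : l (a *: x) = a * `|x|.
  rewrite /l; case: pselect => [Ny|[]]; last by exists a.
  case: (co _ _) => b /= /eqP; rewrite -subr_eq0 -scalerBl scaler_eq0 (negbTE x0) orbF.
  by rewrite subr_eq0 => /eqP ->.
have [||||//|f [fl f1]] := @hahn_banach R V N l 1.
- by exists 0; rewrite scale0r.
- by move=> a _ _ [b ->] [c ->]; exists (a * b + c); rewrite scalerDl scalerA.
- move=> a _ _ [b ->] [c ->]; rewrite !lE scalerA -scalerDl lE.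
  by rewrite mulrDl mulrA.
- by move=> _ [b ->]; rewrite lE mul1r normrM normr_id normrZ.
exists f; split=> //; rewrite fl; last by exists 1; rewrite scale1r.
by have := lE 1; rewrite scale1r mul1r.
Qed.

Section ultralimit.
Context {R : realType}.

Fact ultrafilter_nat_ex : exists F : set_system nat, UltraFilter F /\ \oo `<=` F.
Proof. exact: ultraFilterLemma. Qed.

(** Along a free ultrafilter every bounded real sequence converges, and the limit is linear in the
    sequence. This stands in for weak and weak-* compactness without extracting subsequences. *)
Definition nat_ultra : set_system nat := sval (cid ultrafilter_nat_ex).

#[local] Instance nat_ultra_ultra : UltraFilter nat_ultra.
Proof. by rewrite /nat_ultra; case: cid => F []. Qed.

Lemma nat_ultra_oo : \oo `<=` nat_ultra.
Proof. by rewrite /nat_ultra; case: cid => F []. Qed.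

Lemma near_ultra (P : nat -> Prop) : (\forall n \near \oo, P n) -> \forall n \near nat_ultra, P n.
Proof. exact: nat_ultra_oo. Qed.

Definition ulim (u : nat -> R) : R := lim (u @ nat_ultra).

Lemma ulim_cvg (u : nat -> R) (C : R) : (forall n, `|u n| <= C) ->
  u @ nat_ultra --> ulim u.
Proof.
move=> uC; have := @segment_compact R (- C) C; rewrite compact_ultra => /(_ (u @ nat_ultra)).
case.
- split; first by typeclasses eauto.
  move=> G GG sG; rewrite eqEsubset; split => // A GA.
  have [//|nA] := @in_ultra_setVsetC _ _ (u @^-1` A) nat_ultra_ultra.
  have /filter_ex[y [] //] : G (A `&` ~` A) by apply: filterI => //; apply: sG.
- apply: (@filterE _ nat_ultra) => n /=.
  by rewrite in_itv/= -ler_norml.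
by move=> x [_ ux]; rewrite /ulim; apply: cvgP ux.
Qed.

Lemma ulimE (u : nat -> R) (a : R) : u @ nat_ultra --> a -> ulim u = a.
Proof. by move=> ua; apply: cvg_lim. Qed.

Lemma ulim_lin (a : R) (u v : nat -> R) (C D : R) :
  (forall n, `|u n| <= C) -> (forall n, `|v n| <= D) ->
  ulim (fun n => a * u n + v n) = a * ulim u + ulim v.
Proof.
move=> /ulim_cvg cu /ulim_cvg cv; apply: ulimE.
by apply: cvgD cv; apply: cvgMr.
Qed.

Lemma ulim_ge (u : nat -> R) (C a : R) : (forall n, `|u n| <= C) ->
  (\forall n \near nat_ultra, a <= u n) -> a <= ulim u.
Proof. by move=> /ulim_cvg cu au; apply: limr_ge au; apply: cvgP cu. Qed.

Lemma ulim_le (u : nat -> R) (C a : R) : (forall n, `|u n| <= C) ->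
  (\forall n \near nat_ultra, u n <= a) -> ulim u <= a.
Proof. by move=> /ulim_cvg cu au; apply: limr_le au; apply: cvgP cu. Qed.

Lemma ulim_norm (u : nat -> R) (C : R) : (forall n, `|u n| <= C) -> `|ulim u| <= C.
Proof.
move=> uC; rewrite ler_norml (ulim_ge uC) ?(ulim_le uC)//.
  by apply: filterE => n; have := uC n; rewrite ler_norml => /andP[].
by apply: filterE => n; have := uC n; rewrite ler_norml => /andP[].
Qed.

End ultralimit.
#[global] Existing Instance nat_ultra_ultra.

(** The ultralimits of the f (u n) define a bounded functional of [f], hence an element of the
    bidual; reflexivity turns it into a weak ultralimit of [u] in X. *)
Lemma reflexive_ulim {R : realType} {X : normedModType R} (u : nat -> X) (C : R) :
  reflexive_space X -> (forall n, `|u n| <= C) ->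
  exists x, forall f : dual X, f x = ulim (fun n => f (u n)).
Proof.
move=> rX uC; have C0 : 0 <= C by rewrite (le_trans _ (uC 0%N)).
have fuC (f : dual X) n : `|f (u n)| <= `|f| * C.
  by rewrite (le_trans (dual_le _ _))// ler_wpM2l.
have [|||phi [phiE _]] := @dual_of R (dual X) (fun f : dual X => ulim (fun n => f (u n))) C.
- by move=> a f g; exact: (ulim_lin a (fuC f) (fuC g)).
- by move=> f; rewrite mulrC; apply: ulim_norm.
- by [].
by have [x xE] := rX phi; exists x => f; rewrite -xE phiE.
Qed.

Lemma extend_injection N (c : 'I_N -> nat) : injective c ->
  exists p : nat -> nat, bijective p /\ forall i : 'I_N, p i = c i.
Proof.
move=> cI; pose s := [seq c i | i <- enum 'I_N].
(* The list [t] starts with the values of [c] and continues with the other indices below [M];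
   reading it off permutes these indices, and the bijection is the identity from [M] on. *)
pose M := ((\max_i (c i)) + N).+1.
pose t := s ++ [seq j <- iota 0 M | j \notin s].
have cM i : (c i < M)%N by rewrite ltnS (leq_trans (leq_bigmax i))// leq_addr.
have us : uniq s by rewrite map_inj_uniq// enum_uniq.
have tM : perm_eq t (iota 0 M).
  apply: uniq_perm; last 2 first.
  - exact: iota_uniq.
  - move=> j; rewrite mem_cat mem_filter mem_iota /= add0n.
    case: (boolP (j \in s)) => //= /mapP[i _ ->]; by rewrite cM.
  - rewrite cat_uniq us filter_uniq ?iota_uniq// andbT.
    by apply/hasPn => j; rewrite mem_filter => /andP[].
have st : size t = M by rewrite (perm_size tM) size_iota.
have ut : uniq t by rewrite (perm_uniq tM) iota_uniq.
exists (fun i => if (i < M)%N then nth 0%N t i else i); split.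
  exists (fun j => if (j < M)%N then index j t else j) => i /=.
    have [iM|iM] := ltnP i M; last by rewrite ltnNge iM.
    have : nth 0%N t i \in t by rewrite mem_nth// st.
    rewrite (perm_mem tM) mem_iota add0n /= => ->.
    by rewrite index_uniq// st.
  have [iM|iM] := ltnP i M; last by rewrite ltnNge iM.
  have it : i \in t by rewrite (perm_mem tM) mem_iota.
  by rewrite -{1}st index_mem it nth_index.
move=> i; have -> : (i < M)%N by rewrite (leq_trans (ltn_ord i))// leqW// leq_addl.
rewrite nth_cat size_map size_enum_ord ltn_ord.
by rewrite (nth_map i) ?size_enum_ord// nth_ord_enum.
Qed.

(** * Symmetric bases *)

Section symmetric.
Context {R : realType} {X : normedModType R} {e : nat -> X}.
Hypothesis esym : symmetric_basis e.

(** Symmetry is assumed for bijections of the integers; an injection of a finite index set extends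
    to one. *)
Lemma symmetric_inj N (a b : 'I_N -> R) (c : 'I_N -> nat) : injective c ->
  (forall i, `|b i| = `|a i|) ->
  `|\sum_i b i *: e (c i)| = `|\sum_i a i *: e i|.
Proof.
move=> cI ba; have [p [pbij pc]] := extend_injection cI.
have [_ es] := esym.
pose ext (f : 'I_N -> R) n := oapp f 0 (insub n).
have extE f (i : 'I_N) : ext f i = f i by rewrite /ext valK.
pose s n := oapp (fun i : 'I_N => (b i < 0) (+) (a i < 0)) false (insub n).
rewrite [in RHS](eq_bigr (fun i : 'I_N => ext a i *: e i)); last by move=> i _; rewrite extE.
rewrite -(es N (ext a) s p pbij); congr `|_|; apply: eq_bigr => i _.
rewrite pc extE /s valK /=; congr (_ *: _).
by rewrite [LHS]numEsign ba (normrEsign (a i)) signr_addb mulrA.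
Qed.

(** The terms outside [P] are moved to fresh indices, once with each sign. Both sums have the norm
    of the right side, and their average is the left sum. *)
Lemma symmetric_sub N (P : pred 'I_N) (a b : 'I_N -> R) (c : 'I_N -> nat) :
  {in P &, injective c} -> (forall i, P i -> `|b i| = `|a i|) ->
  `|\sum_(i | P i) b i *: e (c i)| <= `|\sum_i a i *: e i|.
Proof.
move=> cI ba; pose M := (\max_i (c i)).+1.
pose c' i := if P i then c i else (M + i)%N.
have cM i : (c i < M)%N by rewrite ltnS leq_bigmax.
have c'I : injective c'.
  move=> i j; rewrite /c'; case: ifPn => Pi; case: ifPn => Pj.
  - exact: cI.
  - by move=> cE; have := cM i; rewrite cE ltnNge leq_addr.
  - by move=> cE; have := cM j; rewrite -cE ltnNge leq_addr.
  - by move/addnI/val_inj.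
pose b1 i := if P i then b i else a i; pose b2 i := if P i then b i else - a i.
have E1 : `|\sum_i b1 i *: e (c' i)| = `|\sum_i a i *: e i|.
  by apply: symmetric_inj => // i; rewrite /b1; case: ifPn => // /ba.
have E2 : `|\sum_i b2 i *: e (c' i)| = `|\sum_i a i *: e i|.
  by apply: symmetric_inj => // i; rewrite /b2; case: ifPn => [/ba //|]; rewrite normrN.
have -> : \sum_(i | P i) b i *: e (c i) =
    2^-1 *: (\sum_i b1 i *: e (c' i) + \sum_i b2 i *: e (c' i)).
  rewrite -big_split/= scaler_sumr big_mkcond; apply: eq_bigr => i _ /=.
  rewrite /b1 /b2 /c'; case: ifPn => Pi.
    by rewrite -[in RHS](scale1r (_ *: e _)) -scalerDl [_ *: (_ *: (_ *: _))]scalerA mulVf ?pnatr_eq0// scale1r.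
  by rewrite scaleNr subrr scaler0.
rewrite normrZ gtr0_norm ?invr_gt0//; apply: (@le_trans _ _ (2^-1 * (`|\sum_i a i *: e i| + `|\sum_i a i *: e i|))).
  by rewrite ler_wpM2l ?invr_ge0// (le_trans (ler_normD _ _))// E1 E2.
lra.
Qed.

(* A norming functional replaces each column of W by its largest coordinate. *)
Lemma substochastic_le m K (W : 'I_m -> 'I_K -> R) (b : 'I_K -> R) :
  (forall T i j, W T i != 0 -> W T j != 0 -> i = j) ->
  (forall i, \sum_T `|W T i| <= 1) ->
  `|\sum_T (\sum_i b i * W T i) *: e T| <= `|\sum_i b i *: e i|.
Proof.
move=> Winj W1; have [f [f1 <-]] := norming_functional (\sum_T (\sum_i b i * W T i) *: e T).
pose P i := [exists T, W T i != 0].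
have cP i : exists T : nat, P i -> exists2 T' : 'I_m, W T' i != 0 /\ T = T' &
    forall S, W S i != 0 -> `|f (e S)| <= `|f (e T')|.
  have [/existsP[T0 WT0]|] := boolP (P i); last by exists 0%N.
  have [T WT Tmax] := @arg_maxP _ _ _ T0 (fun T => W T i != 0) (fun T : 'I_m => `|f (e T)|) WT0.
  by exists T => _; exists T.
pose c i := sval (cid (cP i)).
have cE i : P i -> exists2 T' : 'I_m, W T' i != 0 /\ c i = T' &
    forall S, W S i != 0 -> `|f (e S)| <= `|f (e T')|.
  by move=> Pi; rewrite /c; case: cid => T /= /(_ Pi).
have cI : {in P &, injective c}.
  move=> i j /cE[T [WT ->] _] /cE[S [WS ->] _] /val_inj TS.
  by apply: (Winj T) => //; rewrite TS.
pose b' i := (-1) ^+ (f (e (c i)) < 0)%R * `|b i|.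
have b'E i : P i -> `|b' i| = `|b i| by move=> _; rewrite normrM normr_id normr_sign mul1r.
apply: le_trans (symmetric_sub cI b'E).
apply: (@le_trans _ _ (f (\sum_(i | P i) b' i *: e (c i)))); last first.
  rewrite (le_trans (ler_norm _))// (le_trans (dual_le _ _))//.
  by rewrite ler_piMl.
rewrite !linear_sum/=.
under eq_bigr do rewrite dualZ mulr_suml.
rewrite exchange_big/= [leLHS](bigID P)/= [X in _ + X]big1 ?addr0; last first.
  move=> i nPi; apply: big1 => T _.
  have -> : W T i = 0.
    by apply: contraNeq nPi => WTi; apply/existsP; exists T.
  by rewrite mulr0 mul0r.
apply: ler_sum => i Pi; rewrite dualZ.
have -> : b' i * f (e (c i)) = `|b i| * `|f (e (c i))|.
  by rewrite /b' mulrAC -normrEsign mulrC.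
rewrite (le_trans (ler_norm _))// (le_trans (ler_norm_sum _ _ _))//.
apply: (@le_trans _ _ (\sum_T `|b i| * (`|W T i| * `|f (e (c i))|))); last first.
  by rewrite -mulr_sumr -mulr_suml ler_wpM2l// ler_piMl.
apply: ler_sum => T _; rewrite -mulrA !normrM ler_wpM2l//.
have [->|WT] := eqVneq (W T i) 0; first by rewrite normr0 !mul0r.
rewrite ler_wpM2l//; have [S [_ ->] ->//] := cE _ Pi.
Qed.

(** This is [substochastic_le] for the diagonal matrix of the ratios b i / a i; where a i = 0 also b
    i = 0, and the quotient is 0. *)
Lemma symmetric_mono N (a b : 'I_N -> R) : (forall i, `|b i| <= `|a i|) ->
  `|\sum_i b i *: e i| <= `|\sum_i a i *: e i|.
Proof.
move=> ba; pose W (T i : 'I_N) := if T == i then b i / a i else 0.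
have aW i : a i * (b i / a i) = b i.
  have [a0|a0] := eqVneq (a i) 0; last by rewrite mulrC divfK.
  by have := ba i; rewrite a0 normr0 normr_le0 mul0r => /eqP ->.
apply: le_trans (@substochastic_le N N W a _ _).
- rewrite (_ : \sum_T (\sum_i a i * W T i) *: e T = \sum_i b i *: e i)//.
  apply: eq_bigr => T _; congr (_ *: _).
  rewrite (bigD1 T)//= big1 ?addr0 /W ?eqxx ?aW// => i /negPf iT.
  by rewrite eq_sym iT mulr0.
- move=> T i j; rewrite /W; case: (T =P i) => [<-|_]; last by rewrite eqxx.
  by case: (T =P j) => [<-//|_]; rewrite eqxx.
- move=> i; rewrite (bigD1 i)//= big1 ?addr0 => [|T /negPf Ti]; last by rewrite /W Ti normr0.
  rewrite /W eqxx normrM normfV.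
  have [->|a0] := eqVneq (a i) 0; first by rewrite normr0 invr0 mulr0.
  by rewrite ler_pdivrMr ?normr_gt0// mul1r.
Qed.

Lemma symmetric_norm_e i : `|e i| = `|e 0%N|.
Proof.
have := @symmetric_inj 1 (fun=> 1) (fun=> 1) (fun=> i).
rewrite !big_ord1 !scale1r /= => ->//.
by move=> j k; rewrite !ord1.
Qed.

Lemma symmetric_coord_le N (a : 'I_N -> R) (j : 'I_N) :
  `|a j| * `|e 0%N| <= `|\sum_i a i *: e i|.
Proof.
apply: le_trans (@symmetric_mono _ a (fun i => if i == j then a i else 0) _).
  rewrite (bigD1 j)//= eqxx big1 ?addr0 => [|i /negPf ->]; last by rewrite scale0r.
  by rewrite normrZ symmetric_norm_e.
by move=> i; case: eqP => // _; rewrite normr0.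
Qed.

Lemma symmetric_le_sum N (a : 'I_N -> R) :
  `|\sum_i a i *: e i| <= (\sum_i `|a i|) * `|e 0%N|.
Proof.
rewrite (le_trans (ler_norm_sum _ _ _))// mulr_suml ler_sum// => i _.
by rewrite normrZ symmetric_norm_e.
Qed.

(** Otherwise every basis vector would vanish, and 0 would have several expansions. *)
Lemma symmetric_e_neq0 : 0 < `|e 0%N|.
Proof.
rewrite normr_gt0; apply/eqP => e0.
have [+ _] := esym => /(_ 0)[a [_ auniq]].
have en n : e n = 0 by apply/eqP; rewrite -normr_eq0 symmetric_norm_e e0 normr0.
have cv (b : nat -> R) : series (fun n => b n *: e n) @ \oo --> (0 : X).
  rewrite (_ : series _ = fun=> 0); first exact: cvg_cst.
  by apply/funext => n; rewrite /series/= big1// => i _; rewrite en scaler0.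
have := auniq (fun=> 1) (cv _); rewrite (auniq (fun=> 0) (cv _)) => /(congr1 (fun f => f 0%N)) /eqP.
by rewrite eq_sym oner_eq0.
Qed.

Lemma coordinate_functionals : exists E : nat -> dual X,
  [/\ forall i j, E j (e i) = (i == j)%:R,
      forall x, (forall j, E j x = 0) -> x = 0,
      forall x, (fun j => E j x) @ \oo --> (0 : R) &
      forall N x, `|\sum_(i < N) E i x *: e i| <= `|x|].
Proof.
have [es _] := esym.
pose k x := sval (cid (es x)).
have kP x : series (fun n => k x n *: e n) @ \oo --> x by rewrite /k; case: cid => a [].
have kU x b : series (fun n => b n *: e n) @ \oo --> x -> k x = b.
  by rewrite /k; case: cid => a [? +] /=; apply.
have kpart x N : `|\sum_(i < N) k x i *: e i| <= `|x|.
  have cn : (fun n => `|series (fun n => k x n *: e n) n|) @ \oo --> `|x| by apply: cvg_norm; exact: kP.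
  rewrite -(cvg_lim _ cn)//; apply: limr_ge; first by apply: cvgP cn.
  near=> n; have Nn : (N <= n)%N by near: n; exact: nbhs_infty_ge.
  rewrite /series/= big_mkord (big_ord_widen n (fun i => k x i *: e i) Nn) big_mkcond/=.
  rewrite (eq_bigr (fun i : 'I_n => (if (i < N)%N then k x i else 0) *: e i)); last first.
    by move=> i _; case: ifP => //; rewrite scale0r.
  by apply: symmetric_mono => i; case: ifP => // _; rewrite normr0.
have kle x j : `|k x j| <= `|e 0%N|^-1 * `|x|.
  rewrite mulrC ler_pdivlMr ?symmetric_e_neq0//.
  exact: le_trans (@symmetric_coord_le j.+1 (fun i => k x i) ord_max) (kpart _ _).
have klin a x y j : k (a *: x + y) j = a * k x j + k y j.
  rewrite (kU (a *: x + y) (fun j => a * k x j + k y j))//.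
  rewrite (_ : series _ = (fun n => a *: series (fun n => k x n *: e n) n + series (fun n => k y n *: e n) n)).
    by apply: cvgD; [apply: cvgZr; exact: kP|exact: kP].
  apply/funext => n; rewrite /series/= scaler_sumr -big_split/=.
  by apply: eq_bigr => i _; rewrite scalerDl scalerA.
have Eex j : exists f : dual X, (forall x, f x = k x j) /\ `|f| <= `|e 0%N|^-1.
  apply: (@dual_of _ _ (fun x => k x j) (`|e 0%N|^-1)).
  - by move=> a x y; exact: klin.
  - by move=> x; exact: kle.
  - by rewrite invr_ge0.
pose E j := sval (cid (Eex j)).
have EE j x : E j x = k x j by rewrite /E; case: cid => f [].
exists E; split.
- move=> i j; rewrite EE (kU _ (fun j => (i == j)%:R))//.
  apply: cvg_near_cst; near=> n; rewrite /series/=.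
  have iN : (i < n)%N by near: n; exact: nbhs_infty_gt.
  rewrite big_mkord (bigD1 (Ordinal iN))//= eqxx scale1r big1 ?addr0// => l /negPf lE.
  by rewrite eq_sym -val_eqE/= in lE; rewrite lE scale0r.
- move=> x Ex; have kx : k x = fun=> 0 by apply/funext => j; rewrite -EE.
  have := kP x; rewrite kx.
  rewrite (_ : series _ = fun=> 0); last first.
    by apply/funext => n; rewrite /series/= big1// => i _; rewrite scale0r.
  by move=> /cvg_lim <-//; rewrite lim_cst.
- move=> x; have /cvgP/cvg_series_cvg_0 := kP x => kx0.
  apply/cvgrPdist_le => eps eps0.
  have ee0 : 0 < eps * `|e 0%N| by rewrite mulr_gt0// symmetric_e_neq0.
  have /cvgrPdist_le/(_ _ ee0) := kx0; apply: filterS => n.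
  rewrite !sub0r !normrN EE normrZ symmetric_norm_e ler_pM2r//.
  exact: symmetric_e_neq0.
- by move=> N x; under eq_bigr do rewrite EE; exact: kpart.
Unshelve. all: by end_near. Qed.

Hypothesis rX : reflexive_space X.

(** Otherwise unit vectors supported ever further out would satisfy eps <= f. Their weak ultralimit
    has all coordinates zero, so it is 0, against eps <= f. *)
Lemma reflexive_shrinking (f : dual X) (eps : R) : 0 < eps ->
  exists J, forall J' (c : nat -> R),
    `|f (\sum_(J <= j < J') c j *: e j)| <= eps * `|\sum_(J <= j < J') c j *: e j|.
Proof.
move=> eps0; have [E [Ee E0 _ _]] := coordinate_functionals.
apply: contrapT => /forallNP nJ.
have yex J : exists y : X, [/\ `|y| <= 1, eps <= f y & forall i, (i < J)%N -> E i y = 0].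
  have /existsNP[J' /existsNP[c /negP]] := nJ J; set y := \sum_(_ <= _ < _) _.
  rewrite -ltNge => fy.
  have y0 : 0 < `|y|.
    by rewrite normr_gt0; apply: contraTN fy => /eqP ->; rewrite linear0 !normr0 mulr0 ltxx.
  exists (((-1) ^+ (f y < 0)%R * `|y|^-1) *: y); split.
  - by rewrite normrZ normrM normr_sign mul1r normfV normr_id mulVf ?gt_eqF.
  - by rewrite dualZ mulrAC -normrEsign ler_pdivlMr// ltW.
  - move=> i iJ; rewrite dualZ [E i y]linear_sum big_nat big1 ?mulr0// => j /andP[Jj _].
    by rewrite [LHS](dualZ (E i)) Ee gtn_eqF ?mulr0// (leq_trans iJ).
pose y J := sval (cid (yex J)).
have yP J : [/\ `|y J| <= 1, eps <= f (y J) & forall i, (i < J)%N -> E i (y J) = 0].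
  by rewrite /y; case: cid.
have y1 J : `|y J| <= 1 by have [] := yP J.
have [x xE] := reflexive_ulim rX y1.
have x0 : x = 0.
  apply: E0 => j; rewrite xE; apply: ulimE; apply: cvg_near_cst; apply: near_ultra.
  by exists j.+1 => // n /= jn; have [_ _] := yP n; apply.
have : eps <= f x.
  rewrite xE; apply: (@ulim_ge _ _ (`|f|)).
    by move=> n; rewrite (le_trans (dual_le _ _))// ler_piMr.
  by apply: near_ultra; apply: nearW => n; have [] := yP n.
by rewrite x0 linear0 leNgt eps0.
Qed.

(** Excludes c_0: were these sums bounded, a weak ultralimit would have all coordinates equal to 1,
    whereas coordinates tend to 0. *)
Lemma reflexive_unbounded (M : R) : exists N, M < `|\sum_(i < N) e i|.
Proof.
have [E [Ee _ Ecvg _]] := coordinate_functionals.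
apply: contrapT => /forallNP nN.
have b n : `|\sum_(i < n) e i| <= M by rewrite leNgt; apply/negP/nN.
have [x xE] := reflexive_ulim rX b.
have E1 j : E j x = 1.
  rewrite xE; apply: ulimE; apply: cvg_near_cst; apply: near_ultra.
  exists j.+1 => // n /= jn; rewrite linear_sum (bigD1 (Ordinal jn))//= Ee eqxx big1 ?addr0// => i.
  by rewrite -val_eqE/= Ee => /negPf ->.
have := Ecvg x; rewrite (_ : (fun j => E j x) = fun=> 1); last exact/funext.
by move=> /cvg_lim => /(_ (@norm_hausdorff _ _)); rewrite lim_cst// => /eqP; rewrite oner_eq0.
Qed.

(** Excludes l_1: otherwise the norm dominates a multiple of the l_1 norm, so the sum of the
    coordinates is a bounded functional equal to 1 at every basis vector, against
    [reflexive_shrinking]. *)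
Lemma reflexive_average (eps : R) : 0 < eps ->
  exists2 N, (0 < N)%N & `|\sum_(i < N) e i| <= eps * N%:R.
Proof.
move=> eps0; have [E [Ee _ _ Epart]] := coordinate_functionals.
apply: contrapT => /forall2NP nN.
have lamb N : eps * N.+1%:R <= `|\sum_(i < N.+1) e i|.
  by have [//|/negP] := nN N.+1; rewrite -ltNge => /ltW.
have l1 N (a : 'I_N -> R) : eps * (\sum_i `|a i|) <= `|\sum_i a i *: e i|.
  case: N a => [|N] a; first by rewrite !big_ord0 mulr0.
  rewrite -(@symmetric_inj _ a (fun i => `|a i|) (@nat_of_ord _) (@ord_inj _)); last by move=> i; rewrite normr_id.
  (* The N + 1 cyclic shifts of the vector with coefficients |a i| have the same norm, and they add
     up to the sum of the |a i| times e_0 + ... + e_N. *)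
  have H : (\sum_i `|a i|) * `|\sum_(i < N.+1) e i| <= N.+1%:R * `|\sum_i `|a i| *: e i|.
    rewrite -[X in X * _]ger0_norm ?sumr_ge0// -normrZ.
    rewrite (_ : _ *: _ = \sum_(k < N.+1) \sum_i `|a i| *: e (i + k)%R); last first.
      rewrite exchange_big/= scaler_suml; apply: eq_bigr => i _.
      rewrite -scaler_sumr; congr (_ *: _).
      by rewrite (reindex_inj (addrI i)).
    rewrite (le_trans (ler_norm_sum _ _ _))//.
    rewrite (eq_bigr (fun=> `|\sum_i `|a i| *: e i|)); last first.
      move=> k _; apply: (@symmetric_inj _ _ _ (fun i => nat_of_ord (i + k)%R)) => //.
      by move=> i j /ord_inj/addIr.
    by rewrite sumr_const card_ord -[_ *+ N.+1]mulr_natl.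
  rewrite -(ler_pM2l (x := N.+1%:R))//; apply: le_trans H.
  by rewrite mulrA mulrC ler_wpM2l ?sumr_ge0// mulrC lamb.
have Ele N x : \sum_(i < N) `|E i x| <= eps^-1 * `|x|.
  by rewrite mulrC ler_pdivlMr// mulrC (le_trans (l1 _ _)).
have sN N x : `|\sum_(i < N) E i x| <= eps^-1 * `|x|.
  exact: le_trans (ler_norm_sum _ _ _) (Ele _ _).
have [|||s [sE _]] := @dual_of R X (fun x => ulim (fun N => \sum_(i < N) E i x)) eps^-1.
- move=> a x y; rewrite -(ulim_lin a (sN^~ x) (sN^~ y)); congr ulim.
  apply/funext => N; rewrite mulr_sumr -big_split/=; apply: eq_bigr => i _.
  by rewrite linearP.
- by move=> x; apply: ulim_norm.
- by rewrite invr_ge0 ltW.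
have s1 j : s (e j) = 1.
  rewrite sE; apply: ulimE; apply: cvg_near_cst; apply: near_ultra.
  exists j.+1 => // n /= jn; rewrite (bigD1 (Ordinal jn))//= Ee eqxx big1 ?addr0// => i.
  by rewrite -val_eqE/= Ee eq_sym => /negPf ->.
(* With this constant the block consisting of [e J] alone would give 1 <= 1 / 2. *)
have [|J] := @reflexive_shrinking s (2 * `|e 0%N|)^-1.
  by rewrite invr_gt0 mulr_gt0// symmetric_e_neq0.
move=> /(_ J.+1 (fun=> 1)); rewrite big_nat1 scale1r s1 normr1 symmetric_norm_e invfM.
rewrite divfK ?gt_eqF ?symmetric_e_neq0//.
lra.
Qed.
End symmetric.

(** * Boxes and the JF norm *)

Section boxes.
Context {R : realType}.

Lemma measurable_box n (a b : 'rV[R]_n) : measurable (box a b).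
Proof.
rewrite (_ : box a b = \big[setI/setT]_(i < n)
    (rV_coord i @^-1` `]a ord0 i, b ord0 i[%classic)).
  apply: bigsetI_measurable => i _; rewrite -[X in measurable X]setTI.
  exact: measurable_rV_coord.
apply/seteqP; split => x /=.
  move=> cxd; elim/big_ind: _ => //= i _.
  by rewrite in_itv/= /rV_coord cxd.
by move=> + i; rewrite (bigD1 i)//= => -[+ _]; rewrite in_itv.
Qed.

Lemma box_empty n (a b : 'rV[R]_n) i : b ord0 i <= a ord0 i -> box a b = set0.
Proof.
move=> ba; rewrite -subset0 => x /(_ i) /andP[ax xb].
by have := lt_trans ax xb; rewrite ltNge ba.
Qed.

Lemma box_dichotomy n (a b : 'rV[R]_n) :
  (forall i, a ord0 i < b ord0 i) \/ box a b = set0.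
Proof.
have [[i /box_empty]|] := pselect (exists i, b ord0 i <= a ord0 i); first by right.
by move=> /forallNP nab; left => i; rewrite ltNge; apply/negP/nab.
Qed.

Lemma boxI n (a b c d : 'rV[R]_n) : box a b `&` box c d =
  box (\row_i Num.max (a ord0 i) (c ord0 i)) (\row_i Num.min (b ord0 i) (d ord0 i)).
Proof.
apply/seteqP; split => x /=.
  move=> [abx cdx] i; rewrite !mxE gt_max lt_min.
  by have /andP[-> ->] := abx i; have /andP[-> ->] := cdx i.
move=> H; split => i; have := H i; rewrite !mxE gt_max lt_min;
  by move=> /andP[/andP[h1 h2] /andP[h3 h4]]; apply/andP; split.
Qed.

(** The positive parts make the product correct for empty boxes as well, so intersections need no
    case distinction. *)
Definition vol n (a b : 'rV[R]_n) : R := \prod_i Num.max 0 (b ord0 i - a ord0 i).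

Lemma lebesgue_rV_vol n (a b : 'rV[R]_n) : lebesgue_rV n (box a b) = (vol a b)%:E.
Proof.
have [ab|] := box_dichotomy a b.
  rewrite lebesgue_rV_box//; congr EFin; apply: eq_bigr => i _.
  by rewrite max_r// subr_ge0 ltW.
have [[i ba]|nab] := pselect (exists i, b ord0 i <= a ord0 i).
  move=> ->; rewrite measure0; congr EFin; rewrite /vol (bigD1 i)//=.
  by rewrite max_l ?mul0r// subr_le0.
move=> b0; suff : box a b (\row_i ((a ord0 i + b ord0 i) / 2)) by rewrite b0.
move=> i; rewrite mxE; have : a ord0 i < b ord0 i by rewrite ltNge; apply/negP => ?; apply: nab; exists i.
by move=> ?; rewrite !midf_lt.
Qed.

(** The sigma-algebra is generated by the coordinates, so an open set is exhibited as the countable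
    union of the rational boxes inside it. *)
Lemma open_measurable_rV n (A : set 'rV[R]_n) : open A -> measurable A.
Proof.
move=> oA.
pose B (k : nat) : set 'rV[R]_n :=
  if (unpickle k : option ('rV[rat]_n * 'rV[rat]_n)) is Some p then
    if pselect (box (map_mx ratr p.1) (map_mx ratr p.2) `<=` A)
    then box (map_mx ratr p.1) (map_mx ratr p.2) else set0
  else set0.
rewrite (_ : A = \bigcup_k B k).
  apply: bigcupT_measurable => k; rewrite /B; case: unpickle => // p.
  by case: (pselect _) => _ //=; exact: measurable_box.
apply/seteqP; split; last first.
  by move=> x [k _]; rewrite /B; case: unpickle => // p; case: pselect => // sA /sA.
move=> x Ax; have /nbhs_ballP[r /= r0 xrA] : nbhs x A by apply: open_nbhs_nbhs.
have ex i : exists p : rat * rat,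
    x ord0 i - r < ratr p.1 < x ord0 i /\ x ord0 i < ratr p.2 < x ord0 i + r.
  have [|q1] := @rat_in_itvoo R (x ord0 i - r) (x ord0 i); first by rewrite ltrBlDr ltrDl.
  rewrite in_itv/= => q1P.
  have [|q2] := @rat_in_itvoo R (x ord0 i) (x ord0 i + r); first by rewrite ltrDl.
  by rewrite in_itv/= => q2P; exists (q1, q2).
pose p i := sval (cid (ex i)).
have pP i : x ord0 i - r < ratr (p i).1 < x ord0 i /\ x ord0 i < ratr (p i).2 < x ord0 i + r.
  by rewrite /p; case: cid.
exists (pickle (\row_i (p i).1, \row_i (p i).2)) => //.
rewrite /B pickleK /=; case: pselect => [_ i|[]].
  by rewrite !mxE; have [/andP[_ ->] /andP[-> _]] := pP i.
move=> y xy; apply: xrA; split => // i j; rewrite ord1; have := xy j; rewrite !mxE.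
have [/andP[h1 _] /andP[_ h2]] := pP j => /andP[h3 h4].
rewrite -ball_normE /= ltr_norml; apply/andP; split; lra.
Qed.

End boxes.

Definition capvol {R : realType} {d : nat} (A D : set 'rV[R]_d) : R :=
  fine (lebesgue_rV d (A `&` D)).

Lemma capvol_ge0 {R : realType} {d : nat} (A D : set 'rV[R]_d) : 0 <= capvol A D.
Proof. by rewrite /capvol fine_ge0. Qed.

Section JF_seminorm.
Context {R : realType} {X : normedModType R} (e : nat -> X).
Hypothesis esym : symmetric_basis e.
Context {d : nat} (Omega : set 'rV[R]_d).
Hypothesis mOmega : measurable Omega.

Local Notation mu := (@lebesgue_rV R d).
Local Notation L1 := (L1 Omega).
Local Notation JFn := (JF_norm e Omega).

Lemma measurable_parallelepiped T : parallelepipeds Omega T -> measurable T.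
Proof. by move=> [_ [a [b [_ ->]]]]; exact: measurable_box. Qed.

Lemma L1_integrable f D : L1 f -> measurable D -> D `<=` Omega ->
  mu.-integrable D (EFin \o f).
Proof. by move=> Lf mD sD; apply: (integrableS mOmega). Qed.

Lemma L1_lin (a : R) f g : L1 f -> L1 g -> L1 (fun x => a * f x + g x).
Proof.
move=> Lf Lg; rewrite /Defs.L1/=.
rewrite (_ : _ \o _ = (fun x => a%:E * (EFin \o f) x)%E \+ (EFin \o g))//.
by apply: integrableD => //; exact: integrableZl.
Qed.

Lemma L1_0 : L1 (fun=> 0).
Proof. exact: integrable0. Qed.

Lemma L1_Z a f : L1 f -> L1 (fun x => a * f x).
Proof.
move=> Lf; have := L1_lin a Lf L1_0; congr (Defs.L1 _ _).
by apply/funext => x; rewrite addr0.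
Qed.

Lemma L1_sum I (s : seq I) (P : pred I) (f : I -> 'rV[R]_d -> R) :
  (forall i, P i -> L1 (f i)) -> L1 (fun x => \sum_(i <- s | P i) f i x).
Proof.
move=> Lf; elim: s => [|i s IH].
  by rewrite (_ : (fun x => _) = fun=> 0); [exact: L1_0|apply/funext => x; rewrite big_nil].
case: (boolP (P i)) => Pi.
  rewrite (_ : (fun x => _) = fun x => 1 * f i x + \sum_(i <- s | P i) f i x).
    by apply: L1_lin => //; exact: Lf.
  by apply/funext => x; rewrite big_cons mul1r Pi.
rewrite (_ : (fun x => _) = fun x => \sum_(i <- s | P i) f i x)//.
by apply/funext => x; rewrite big_cons (negPf Pi).
Qed.

Lemma L1_restrict f A : L1 f -> measurable A -> L1 (f \_ A).
Proof.
move=> Lf mA; rewrite /Defs.L1/= -restrict_EFin.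
apply/integrable_restrict => //; apply: (integrableS mOmega) => //.
exact: measurableI.
Qed.

Lemma L1_indic (a b : 'rV[R]_d) : L1 \1_(box a b).
Proof.
apply: (@integrableS _ _ _ mu setT) => //; apply/integrableP; split.
  by apply/measurable_EFinP; apply: measurable_indic; exact: measurable_box.
rewrite (eq_integral (fun x => (\1_(box a b) x)%:E)); last first.
  by move=> t _; rewrite gee0_abs// lee_fin.
rewrite integral_indic ?setIT; last exact: measurable_box.
by apply: le_lt_trans (ltry (vol a b)); rewrite -lebesgue_rV_vol; exact: lexx.
exact: measurableT.
Qed.

Lemma Rintegral_lin (a : R) f g D : L1 f -> L1 g -> measurable D -> D `<=` Omega ->
  \int[mu]_(x in D) (a * f x + g x) = a * \int[mu]_(x in D) f x + \int[mu]_(x in D) g x.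
Proof.
move=> Lf Lg mD sD; rewrite RintegralD//; last 2 first.
- by apply: L1_integrable => //; exact: L1_Z.
- exact: L1_integrable.
by rewrite RintegralZl//; exact: L1_integrable.
Qed.

Lemma Rintegral_sum I (s : seq I) (P : pred I) (f : I -> 'rV[R]_d -> R) D :
  (forall i, P i -> L1 (f i)) -> measurable D -> D `<=` Omega ->
  \int[mu]_(x in D) (\sum_(i <- s | P i) f i x) = \sum_(i <- s | P i) \int[mu]_(x in D) f i x.
Proof.
move=> Lf mD sD; elim: s => [|i s IH].
  by under eq_Rintegral do rewrite big_nil; rewrite big_nil Rintegral_cst// mul0r.
rewrite big_cons; case: ifPn => Pi; rewrite -IH.
  rewrite -RintegralD//; last 2 first.
  - by apply: L1_integrable => //; exact: Lf.
  - by apply: L1_integrable => //; exact: L1_sum.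
  by apply: eq_Rintegral => x _; rewrite big_cons Pi.
by apply: eq_Rintegral => x _; rewrite big_cons (negPf Pi).
Qed.

Lemma Rintegral_indic_box (a b : 'rV[R]_d) D : measurable D ->
  \int[mu]_(x in D) \1_(box a b) x = capvol (box a b) D.
Proof. by move=> mD; rewrite /Rintegral integral_indic//; exact: measurable_box. Qed.

(** Admitting the empty set makes the class stable under intersection with boxes; an empty member
    only adds a zero term to a sum. *)
Definition cell T := T = set0 \/ parallelepipeds Omega T.

Lemma cell_box (a b : 'rV[R]_d) : box a b `<=` Omega -> cell (box a b).
Proof.
move=> sab; have [ab|] := box_dichotomy a b; last by left.
by right; split => //; exists a, b.
Qed.

Lemma measurable_cell T : cell T -> measurable T.
Proof. by move=> [->//|]; exact: measurable_parallelepiped. Qed.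

Lemma cell_sub T : cell T -> T `<=` Omega.
Proof. by move=> [->|[]]. Qed.

Lemma cellI T (a b : 'rV[R]_d) : cell T -> cell (T `&` box a b).
Proof.
move=> [->|[sT [c [c' [cc' TE]]]]]; first by left; rewrite set0I.
rewrite TE boxI; apply: cell_box; rewrite -boxI -TE.
by move=> x [/sT].
Qed.

Lemma sum_Rintegral_le m (T : 'I_m -> set 'rV[R]_d) f :
  (forall j, cell (T j)) -> trivIset setT T -> L1 f -> (forall x, 0 <= f x) ->
  \sum_j \int[mu]_(x in T j) f x <= \int[mu]_(x in Omega) f x.
Proof.
move=> cT tT Lf f0; have mT j : measurable (T j) by exact: measurable_cell.
have mU : measurable (\big[setU/set0]_(i <- index_enum 'I_m) T i).
  by apply: bigsetU_measurable => j _.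
have sU : \big[setU/set0]_(i <- index_enum 'I_m) T i `<=` Omega.
  by rewrite -bigcup_seq => x [j _]; exact: cell_sub.
have /integrableP[mf _] := Lf.
have H : (\sum_j \int[mu]_(x in T j) (f x)%:E <= \int[mu]_(x in Omega) (f x)%:E)%E.
  rewrite -ge0_integral_bigsetU//=.
  - apply: ge0_subset_integral => //=.
    by move=> x _; rewrite lee_fin.
  - by rewrite index_enum_uniq.
  - by apply: sub_trivIset tT.
  - exact: measurable_funS mf.
  - by move=> x _; rewrite lee_fin.
rewrite -lee_fin -sumEFin; apply: le_trans (le_trans _ H) _; last first.
  by rewrite /Rintegral fineK//; exact: integrable_fin_num.
apply: lee_sum => j _; rewrite /Rintegral fineK//; apply: integrable_fin_num => //.
by apply: L1_integrable => //; exact: cell_sub.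
Qed.

Lemma L1_normr f : L1 f -> L1 (fun x => `|f x|).
Proof. exact: integrable_norm. Qed.

Let JFset f := [set r | exists (m : nat) (T : 'I_m -> set 'rV[R]_d),
    [/\ forall j, parallelepipeds Omega (T j), trivIset setT T &
        r = `|\sum_(j < m) (\int[mu]_(x in T j) f x) *: e j|]].

Lemma sum_norm_Rintegral_le m (T : 'I_m -> set 'rV[R]_d) f :
  (forall j, cell (T j)) -> trivIset setT T -> L1 f ->
  \sum_j `|\int[mu]_(x in T j) f x| <= \int[mu]_(x in Omega) `|f x|.
Proof.
move=> cT tT Lf; apply: le_trans (sum_Rintegral_le cT tT (L1_normr Lf) _) => //.
apply: ler_sum => j _; apply: le_normr_Rintegral; first exact: measurable_cell.
by apply: L1_integrable => //; [exact: measurable_cell|exact: cell_sub].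
Qed.

(** Without an upper bound [sup] would take its default value 0. *)
Let JFset_ubound f : L1 f ->
  ubound (JFset f) ((\int[mu]_(x in Omega) `|f x|) * `|e 0%N|).
Proof.
move=> Lf _ [m [T [pT tT ->]]]; rewrite (le_trans (symmetric_le_sum esym _))//.
by rewrite ler_wpM2r// sum_norm_Rintegral_le// => j; right.
Qed.

Let JFset0 f : JFset f 0.
Proof.
exists 0%N, (fun=> set0); split => [[]//|[]//|].
by rewrite big_ord0 normr0.
Qed.

Lemma JF_norm_le f C : (forall m (T : 'I_m -> set 'rV[R]_d),
    (forall j, parallelepipeds Omega (T j)) -> trivIset setT T ->
    `|\sum_(j < m) (\int[mu]_(x in T j) f x) *: e j| <= C) -> JFn f <= C.
Proof.
move=> H; apply: ge_sup; first by exists 0; exact: JFset0.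
by move=> _ [m [T [pT tT ->]]]; exact: H.
Qed.

Lemma JF_norm_ge0 f : L1 f -> 0 <= JFn f.
Proof.
move=> Lf; apply: ub_le_sup; last exact: JFset0.
by exists ((\int[mu]_(x in Omega) `|f x|) * `|e 0%N|); exact: JFset_ubound.
Qed.

(** The empty members are dropped and the others renumbered, which by symmetry leaves the norm
    unchanged. *)
Lemma JF_norm_ub f m (T : 'I_m -> set 'rV[R]_d) : L1 f ->
  (forall j, cell (T j)) -> trivIset setT T ->
  `|\sum_(j < m) (\int[mu]_(x in T j) f x) *: e j| <= JFn f.
Proof.
move=> Lf cT tT.
pose P := [pred j : 'I_m | `[< parallelepipeds Omega (T j) >]].
have nP j : ~~ P j -> T j = set0.
  by move=> /asboolPn nPj; have [] := cT j.
apply: ub_le_sup.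
  by exists ((\int[mu]_(x in Omega) `|f x|) * `|e 0%N|); exact: JFset_ubound.
exists #|P|, (fun k => T (enum_val k)); split.
- by move=> k; have /asboolP := enum_valP k.
- move=> k l _ _ kl; apply: enum_val_inj; exact: tT.
- rewrite (bigID P)/= [X in _ + X]big1 ?addr0; last first.
    by move=> j /nP ->; rewrite Rintegral_set0 scale0r.
  rewrite -(@symmetric_inj _ _ _ esym #|P| _ (fun k => \int[mu]_(x in T (enum_val k)) f x)
    (fun k => nat_of_ord (enum_val k)))//; last first.
    by move=> k l /ord_inj/enum_val_inj.
  by rewrite -(@big_enum_val _ _ _ _ P (fun j => (\int[mu]_(x in T j) f x) *: e j)).
Qed.

Lemma JF_norm_lin a f g : L1 f -> L1 g ->
  JFn (fun x => a * f x + g x) <= `|a| * JFn f + JFn g.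
Proof.
move=> Lf Lg; apply: JF_norm_le => m T pT tT.
have cT j : cell (T j) by right.
rewrite (_ : \sum_(j < m) _ = a *: (\sum_(j < m) (\int[mu]_(x in T j) f x) *: e j) +
    \sum_(j < m) (\int[mu]_(x in T j) g x) *: e j).
  by rewrite (le_trans (ler_normD _ _))// normrZ lerD// ?ler_wpM2l// JF_norm_ub.
rewrite scaler_sumr -big_split/=; apply: eq_bigr => j _.
rewrite Rintegral_lin//; first by rewrite scalerDl scalerA.
  exact: measurable_cell.
exact: cell_sub.
Qed.

Lemma JF_norm_Z a f : L1 f -> JFn (fun x => a * f x) <= `|a| * JFn f.
Proof.
move=> Lf; have := JF_norm_lin a Lf L1_0.
rewrite (_ : (fun x => _ + _) = fun x => a * f x); last by apply/funext => x; rewrite addr0.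
move=> /le_trans; apply; rewrite gerDl; apply: JF_norm_le => m T pT tT.
by rewrite big1 ?normr0// => j _; rewrite Rintegral_cst ?mul0r ?scale0r//; exact: measurable_parallelepiped.
Qed.

(** Cells chosen inside disjoint parallelepipeds are disjoint, so every sum for [g] is also one for
    [f]. This serves when [g] is [f] erased on some intervals. *)
Lemma JF_norm_dominated f g : L1 f ->
  (forall T, parallelepipeds Omega T -> exists T', [/\ cell T', T' `<=` T &
     \int[mu]_(x in T) g x = \int[mu]_(x in T') f x]) ->
  JFn g <= JFn f.
Proof.
move=> Lf H; apply: JF_norm_le => m T pT tT.
pose T' j := sval (cid (H _ (pT j))).
have T'P j : [/\ cell (T' j), T' j `<=` T j &
     \int[mu]_(x in T j) g x = \int[mu]_(x in T' j) f x] by rewrite /T'; case: cid.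
rewrite (eq_bigr (fun j => (\int[mu]_(x in T' j) f x) *: e j)); last first.
  by move=> j _; have [_ _ ->] := T'P j.
apply: JF_norm_ub => //; first by move=> j; have [] := T'P j.
move=> i j _ _ [x [T'i T'j]]; apply: tT => //; exists x.
by have [_ /(_ _ T'i) ? _] := T'P i; have [_ /(_ _ T'j) ? _] := T'P j.
Qed.

Lemma Rintegral_cell_le f T : L1 f -> cell T ->
  `|\int[mu]_(x in T) f x| * `|e 0%N| <= JFn f.
Proof.
move=> Lf cT; have := @JF_norm_ub f 1 (fun=> T) Lf (fun=> cT).
rewrite big_ord1 normrZ; apply.
by move=> i j; rewrite !ord1.
Qed.

Section completion.
Variables (J : completeNormedModType R) (iota : ('rV[R]_d -> R) -> J).
Hypothesis JP : is_JF e Omega iota.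

Lemma iota_lin a f g : L1 f -> L1 g ->
  iota (fun x => a * f x + g x) = a *: iota f + iota g.
Proof. by have [+ _ _] := JP; apply. Qed.

Lemma iota_norm f : L1 f -> `|iota f| = JFn f.
Proof. by have [_ + _] := JP; apply. Qed.

Lemma iota_dense x (eps : R) : 0 < eps -> exists2 f, L1 f & `|x - iota f| < eps.
Proof.
move=> eps0; have [_ _ dJ] := JP.
have [|y [/= xe [f Lf fy]]] := dJ (ball x eps) _ (ball_open x eps).
  by exists x; exact: ballxx.
by exists f => //; move: xe; rewrite -ball_normE /= -fy.
Qed.

Lemma iota_sum I (s : seq I) (P : pred I) (a : I -> R) (f : I -> 'rV[R]_d -> R) :
  (forall i, P i -> L1 (f i)) ->
  iota (fun x => \sum_(i <- s | P i) a i * f i x) = \sum_(i <- s | P i) a i *: iota (f i).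
Proof.
move=> Lf; elim: s => [|i s IH].
  rewrite big_nil (_ : (fun x => _) = fun x => (-1) * 0 + 0); last first.
    by apply/funext => x; rewrite big_nil mulr0 addr0.
  by rewrite (iota_lin _ L1_0 L1_0) scaleN1r addNr.
rewrite big_cons; case: ifPn => Pi; rewrite -IH.
  rewrite -iota_lin//; [|exact: Lf|by apply: L1_sum => j Pj; exact/L1_Z/Lf].
  by congr iota; apply/funext => x; rewrite big_cons Pi.
by congr iota; apply/funext => x; rewrite big_cons (negPf Pi).
Qed.

Lemma iota_eq f g : L1 f -> L1 g ->
  (forall T, parallelepipeds Omega T -> \int[mu]_(x in T) f x = \int[mu]_(x in T) g x) ->
  iota f = iota g.
Proof.
move=> Lf Lg fg; apply/eqP; rewrite -subr_eq0 addrC -scaleN1r -iota_lin// -normr_le0.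
rewrite iota_norm; last exact: L1_lin.
apply: JF_norm_le => m T pT _; rewrite big1 ?normr0// => j _.
rewrite Rintegral_lin//; [|exact: measurable_parallelepiped|by have [] := pT j].
by rewrite (fg (T j))// mulN1r addNr scale0r.
Qed.

Lemma dual_iota_le (L : dual J) f : L1 f -> `|L (iota f)| <= `|L| * JFn f.
Proof. by move=> Lf; rewrite -iota_norm//; exact: dual_le. Qed.

(** The value at x is given by the McShane formula sup_f (l f - C |x - iota f|), which needs no
    Cauchy sequences. It lies within C |x - iota f| of l f for every f, and by density this forces
    linearity and the bound. *)
Lemma dual_extension (l : ('rV[R]_d -> R) -> R) (C : R) :
  (forall a f g, L1 f -> L1 g -> l (fun x => a * f x + g x) = a * l f + l g) ->
  (forall f, L1 f -> `|l f| <= C * JFn f) -> 0 <= C ->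
  exists L : dual J, (forall f, L1 f -> L (iota f) = l f) /\ `|L| <= C.
Proof.
move=> lin lC C0.
have lB f g x : L1 f -> L1 g -> l f - C * `|x - iota f| <= l g + C * `|x - iota g|.
  move=> Lf Lg; have := lC _ (L1_lin (-1) Lg Lf).
  rewrite lin// -iota_norm; last exact: L1_lin.
  rewrite iota_lin// scaleN1r mulN1r => h1.
  have h2 : C * `|- iota g + iota f| <= C * `|x - iota f| + C * `|x - iota g|.
    rewrite -mulrDr ler_wpM2l//.
    rewrite (_ : - iota g + iota f = (x - iota g) - (x - iota f)); last first.
      by rewrite opprB [RHS]addrC addrA subrK addrC.
    by rewrite (le_trans (ler_normB _ _))// addrC.
  have := ler_norm (- l g + l f); lra.
pose S x := [set l f - C * `|x - iota f| | f in L1].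
pose L x := sup (S x).
have S0 x : S x !=set0 by exists (l (fun=> 0) - C * `|x - iota (fun=> 0)|), (fun=> 0) => //; exact: L1_0.
have Lup f x : L1 f -> l f - C * `|x - iota f| <= L x.
  move=> Lf; apply: ub_le_sup; last by exists f.
  by exists (l f + C * `|x - iota f|) => _ [g Lg <-]; exact: lB.
have Llow f x : L1 f -> L x <= l f + C * `|x - iota f|.
  by move=> Lf; apply: ge_sup => // _ [g Lg <-]; exact: lB.
have Ll f : L1 f -> L (iota f) = l f.
  move=> Lf; have := Lup f (iota f) Lf; have := Llow f (iota f) Lf.
  by rewrite subrr normr0 mulr0 addr0 subr0 => h1 h2; apply/eqP; rewrite eq_le h1.
have LC x : `|L x| <= C * `|x|.
  apply/ler_addgt0Pr => eps eps0.
  have e2 : 0 < eps / (2 * C + 1) by rewrite divr_gt0// ltr_pwDr// mulr_ge0.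
  have [f Lf xf] := iota_dense x e2.
  have h1 := Lup f x Lf; have h2 := Llow f x Lf.
  have h3 := lC f Lf; rewrite -iota_norm// in h3.
  have h4 : C * `|iota f| <= C * `|x| + C * `|x - iota f|.
    rewrite -mulrDr ler_wpM2l// -{1}(subKr x (iota f)).
    exact: ler_normB.
  have h5 : 2 * C * `|x - iota f| <= eps.
    rewrite (@le_trans _ _ (2 * C * (eps / (2 * C + 1))))//.
      by rewrite ler_wpM2l ?mulr_ge0// ltW.
    set q := eps / _ in e2 *.
    have qE : (2 * C + 1) * q = eps by rewrite /q mulrC divfK// gt_eqF// ltr_pwDr// mulr_ge0.
    have := ltW e2; lra.
  move: h3; rewrite !ler_norml => /andP[h31 h32]; apply/andP; split; lra.
have Llin a x y : L (a *: x + y) = a * L x + L y.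
  apply/eqP; rewrite -subr_eq0 -normr_le0; apply/ler_addgt0Pr => eps eps0; rewrite add0r.
  pose K := 2 * C * (`|a| + 1) + 1.
  have K0 : 0 < K by rewrite ltr_pwDr// !mulr_ge0// addr_ge0.
  have e2 : 0 < eps / K by rewrite divr_gt0.
  have [f Lf xf] := iota_dense x e2; have [g Lg yg] := iota_dense y e2.
  have near h z : L1 h -> `|L z - l h| <= C * `|z - iota h|.
    move=> Lh; have h1 := Lup h z Lh; have h2 := Llow h z Lh.
    rewrite ler_norml; apply/andP; split; lra.
  have h1 := near _ (a *: x + y) (L1_lin a Lf Lg).
  have h2 := near _ x Lf; have h3 := near _ y Lg.
  have h4 : C * `|a *: x + y - iota (fun z => a * f z + g z)| <=
      C * (`|a| * `|x - iota f| + `|y - iota g|).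
    rewrite ler_wpM2l// iota_lin// opprD addrACA -scalerBr.
    by rewrite (le_trans (ler_normD _ _))// normrZ.
  rewrite lin// in h1.
  have h5 : `|a * (L x - l f)| <= C * (`|a| * `|x - iota f|).
    by rewrite normrM mulrCA ler_wpM2l.
  have h6 : K * (eps / K) = eps by rewrite mulrC divfK// gt_eqF.
  have h7 : C * (`|a| * `|x - iota f| + `|y - iota g|) <= C * (`|a| + 1) * (eps / K).
    by rewrite -mulrA ler_wpM2l// mulrDl mul1r lerD ?ler_wpM2l// ltW.
  have h8 : L (a *: x + y) - (a * L x + L y) =
      (L (a *: x + y) - (a * l f + l g)) - a * (L x - l f) - (L y - l g) by lra.
  rewrite h8 (le_trans (ler_normB _ _))// (le_trans (lerD (ler_normB _ _) (lexx _)))//.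
  set q := eps / K in e2 xf yg h6 h7 *.
  have h9 : 2 * (C * (`|a| + 1) * q) + q = eps by rewrite -h6 /K; lra.
  have h10 : C * (`|a| * `|x - iota f|) + C * `|y - iota g| = C * (`|a| * `|x - iota f| + `|y - iota g|) by lra.
  lra.
have [M [ME MC]] := dual_of Llin LC C0.
by exists M; split => // f Lf; rewrite ME Ll.
Qed.

End completion.

End JF_seminorm.

Opaque lebesgue_rV.

(** An interval with neither endpoint in (t - w, t + w) covers that interval or misses it, so it
    meets both halves in equal length. *)
Lemma overlap_eq {R : realType} (t w a b : R) : 0 < w -> a < b ->
  ~~ (t - w < a < t + w) -> ~~ (t - w < b < t + w) ->
  Num.max 0 (Num.min t b - Num.max (t - w) a) =
  Num.max 0 (Num.min (t + w) b - Num.max t a).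
Proof.
move=> w0 ab; rewrite !negb_and -!leNgt.
have out : b <= t - w \/ t + w <= a -> Num.max 0 (Num.min t b - Num.max (t - w) a) =
  Num.max 0 (Num.min (t + w) b - Num.max t a).
  move=> [h|h].
    rewrite (max_l (y := Num.min t b - _)) ?(max_l (y := Num.min (t + w) b - _))//;
      rewrite subr_le0 le_max !ge_min; apply/orP; left; apply/orP; right; lra.
  rewrite (max_l (y := Num.min t b - _)) ?(max_l (y := Num.min (t + w) b - _))//;
    rewrite subr_le0 le_max !ge_min; apply/orP; right; apply/orP; left; lra.
move=> /orP[h1|h1] /orP[h2|h2]; [by apply: out; left| |by apply: out; right|by apply: out; right].
rewrite (min_l (x := t)); last lra.
rewrite (max_l (x := t - w)); last lra.
rewrite (min_l (x := t + w))//.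
rewrite (max_l (x := t)); last lra.
by congr (Num.max _ _); lra.
Qed.

(** * Spikes *)

Section spikes.
Context {R : realType} {n : nat} (u v : 'rV[R]_n).

Definition left_slab (t w : R) : set 'rV[R]_n.+1 :=
  box (rV_cons (t - w, u)) (rV_cons (t, v)).
Definition right_slab (t w : R) : set 'rV[R]_n.+1 :=
  box (rV_cons (t, u)) (rV_cons (t + w, v)).

(* In dimension one the primitive of spike t w is the tent of height 1 at t
   supported by (t - w, t + w). *)
Definition spike (t w : R) (x : 'rV[R]_n.+1) : R :=
  (w * vol u v)^-1 * (\1_(left_slab t w) x + (-1) * \1_(right_slab t w) x).

Lemma vol_cons (x y : R) (a b : 'rV[R]_n) :
  vol (rV_cons (x, a)) (rV_cons (y, b)) = Num.max 0 (y - x) * vol a b.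
Proof.
rewrite /vol big_ord_recl !rV_cons0; congr (_ * _).
by apply: eq_bigr => i _; rewrite !rV_consS.
Qed.

Local Notation mu := (@lebesgue_rV R n.+1).

(** The volume of the part of [box u v] that lies in the projection of [box a b] along the first
    coordinate. *)
Definition section_vol (a b : 'rV[R]_n.+1) : R :=
  vol (\row_i Num.max (u ord0 i) (a ord0 (lift ord0 i)))
      (\row_i Num.min (v ord0 i) (b ord0 (lift ord0 i))).

Lemma lebesgue_cap_box (x y : R) (a b : 'rV[R]_n.+1) :
  capvol (box (rV_cons (x, u)) (rV_cons (y, v))) (box a b) =
  Num.max 0 (Num.min y (b ord0 ord0) - Num.max x (a ord0 ord0)) * section_vol a b.
Proof.
rewrite /capvol boxI (_ : mu _ = (vol (\row_i Num.max ((rV_cons (x, u)) ord0 i) (a ord0 i))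
  (\row_i Num.min ((rV_cons (y, v)) ord0 i) (b ord0 i)))%:E); last exact: lebesgue_rV_vol.
have rE m (F : 'I_m -> R) j : (\row_i F i) ord0 j = F j by rewrite mxE.
rewrite [LHS]/= /section_vol /vol big_ord_recl !rE !rV_cons0; congr (_ * _).
by apply: eq_bigr => i _; rewrite !rE !rV_consS.
Qed.

Context {X : normedModType R} (e : nat -> X).
Hypothesis esym : symmetric_basis e.
Context (Omega : set 'rV[R]_n.+1).
Hypothesis mOmega : measurable Omega.

Lemma L1_spike t w : L1 Omega (spike t w).
Proof.
apply: L1_Z => //; rewrite (_ : (fun x => _) = (fun x => (-1) * \1_(right_slab t w) x + \1_(left_slab t w) x)).
  by apply: L1_lin => //; exact: L1_indic.
by apply/funext => x; rewrite addrC.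
Qed.

Lemma Rintegral_spike t w T : measurable T -> T `<=` Omega ->
  \int[mu]_(x in T) spike t w x = (w * vol u v)^-1 *
    (capvol (left_slab t w) (T) - capvol (right_slab t w) (T)).
Proof.
move=> mT sT; rewrite RintegralZl//; last first.
  apply: (L1_integrable mOmega) => //.
  rewrite (_ : (fun x => _) = (fun x => (-1) * \1_(right_slab t w) x + \1_(left_slab t w) x)).
    by apply: L1_lin => //; exact: L1_indic.
  by apply/funext => x; rewrite addrC.
congr (_ * _); rewrite -!Rintegral_indic_box//.
under eq_Rintegral do rewrite addrC.
rewrite (Rintegral_lin mOmega)//; [|exact: L1_indic|exact: L1_indic].
by rewrite mulN1r addrC.
Qed.

Lemma Rintegral_spike_eq0 t w (a b : 'rV[R]_n.+1) : 0 < w ->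
  a ord0 ord0 < b ord0 ord0 ->
  ~~ (t - w < a ord0 ord0 < t + w) -> ~~ (t - w < b ord0 ord0 < t + w) ->
  box a b `<=` Omega -> \int[mu]_(x in box a b) spike t w x = 0.
Proof.
move=> w0 ab at_ bt sab; rewrite Rintegral_spike//; last exact: measurable_box.
rewrite !lebesgue_cap_box -mulrBl.
by rewrite (overlap_eq w0 ab)// subrr mul0r mulr0.
Qed.

Lemma sum_capvol_le (a b : 'rV[R]_n.+1) m (T : 'I_m -> set 'rV[R]_n.+1) :
  (forall j, cell Omega (T j)) -> trivIset setT T ->
  \sum_j capvol (box a b) (T j) <= vol a b.
Proof.
move=> cT tT; rewrite (eq_bigr (fun j => \int[mu]_(x in T j) \1_(box a b) x)); last first.
  by move=> j _; rewrite Rintegral_indic_box//; exact: measurable_cell (cT j).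
rewrite (le_trans (sum_Rintegral_le mOmega cT tT (L1_indic mOmega a b) _))//.
rewrite Rintegral_indic_box// /capvol -lee_fin.
have h : (mu (box a b `&` Omega) <= mu (box a b))%E.
  apply: le_measure; rewrite ?inE//.
  - by apply: measurableI => //; exact: measurable_box.
  - exact: measurable_box.
have hv : mu (box a b) = (vol a b)%:E by exact: lebesgue_rV_vol.
rewrite hv in h; rewrite fineK// ge0_fin_numE//.
by apply: le_lt_trans h _; exact: ltry.
Qed.

(** After normalisation each of the two slabs has mass one, which disjoint cells share; hence the
    2. *)
Lemma sum_norm_spike_le t w m (T : 'I_m -> set 'rV[R]_n.+1) : 0 < w -> 0 < vol u v ->
  (forall j, cell Omega (T j)) -> trivIset setT T ->
  \sum_j `|\int[mu]_(x in T j) spike t w x| <= 2.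
Proof.
move=> w0 v0 cT tT; have wv : 0 < w * vol u v by rewrite mulr_gt0.
apply: (@le_trans _ _ ((w * vol u v)^-1 * (\sum_j capvol (left_slab t w) (T j) +
    \sum_j capvol (right_slab t w) (T j)))).
  rewrite -big_split/= mulr_sumr; apply: ler_sum => j _.
  rewrite Rintegral_spike; [|exact: measurable_cell (cT j)|exact: cell_sub (cT j)].
  rewrite normrM gtr0_norm ?invr_gt0// ler_wpM2l ?invr_ge0 ?(ltW wv)//.
  apply: le_trans (ler_normB _ _) _.
  by rewrite (ger0_norm (capvol_ge0 _ _)) (ger0_norm (capvol_ge0 _ _)).
rewrite mulrC ler_pdivrMr//.
have hl : vol (rV_cons (t - w, u)) (rV_cons (t, v)) = w * vol u v.
  by rewrite vol_cons max_r; [congr (_ * _); lra|lra].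
have hr : vol (rV_cons (t, u)) (rV_cons (t + w, v)) = w * vol u v.
  by rewrite vol_cons max_r; [congr (_ * _); lra|lra].
have h1 := sum_capvol_le (rV_cons (t - w, u)) (rV_cons (t, v)) cT tT.
have h2 := sum_capvol_le (rV_cons (t, u)) (rV_cons (t + w, v)) cT tT.
rewrite hl in h1; rewrite hr in h2.
by rewrite mulr_natl mulr2n; exact: lerD h1 h2.
Qed.

(* A parallelepiped has a nonzero integral only against the at most two spikes
   whose slabs contain one of its endpoints. *)
Lemma JF_norm_spikes K (t : 'I_K -> R) w (b : 'I_K -> R) : 0 < w -> 0 < vol u v ->
  (forall i j, i != j -> 2 * w <= `|t i - t j|) ->
  JF_norm e Omega (fun x => \sum_i b i * spike (t i) w x) <= 4 * `|\sum_i b i *: e i|.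
Proof.
move=> w0 v0 tw; apply: JF_norm_le => m T pT tT.
have cT j : cell Omega (T j) by right.
have mT j : measurable (T j) by exact: measurable_cell (cT j).
have sT j : T j `<=` Omega by exact: cell_sub (cT j).
have ex j : exists p : 'rV[R]_n.+1 * 'rV[R]_n.+1,
    (forall i, p.1 ord0 i < p.2 ord0 i) /\ T j = box p.1 p.2.
  by have [_ [a [a' ?]]] := pT j; exists (a, a').
pose p j := sval (cid (ex j)).
have pP j : (forall i, (p j).1 ord0 i < (p j).2 ord0 i) /\ T j = box (p j).1 (p j).2.
  by rewrite /p; case: cid.
pose I j i := \int[mu]_(x in T j) spike (t i) w x.
pose inl j i := t i - w < (p j).1 ord0 ord0 < t i + w.
pose inr j i := t i - w < (p j).2 ord0 ord0 < t i + w.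
(* The integrals are split according to the endpoint of [T j] that falls in a slab. The spikes are
   separated, so a row has at most one nonzero entry; a column has l_1 norm at most 2, hence the
   factor 1/2. Undoing it for both matrices gives the constant 4. *)
pose WL j i := if inl j i then 2^-1 * I j i else 0.
pose WR j i := if ~~ inl j i && inr j i then 2^-1 * I j i else 0.
have IW j i : I j i = 2 * WL j i + 2 * WR j i.
  rewrite /WL /WR; case: ifPn => il /=; first lra.
  case: ifPn => ir; first lra.
  have [pj TE] := pP j.
  rewrite /I TE Rintegral_spike_eq0//; last by rewrite -TE.
  by rewrite mulr0 addr0.
have near_uniq (s : R) i j : t i - w < s < t i + w -> t j - w < s < t j + w -> i = j.
  move=> /andP[h1 h2] /andP[h3 h4]; apply/eqP/negPn/negP => /tw.
  rewrite leNgt ltr_norml => /negP; apply; apply/andP; split; lra.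
have I2 i : \sum_j `|I j i| <= 2 by exact: sum_norm_spike_le.
have half (Q : 'I_m -> bool) i : \sum_j `|if Q j then 2^-1 * I j i else 0| <= 1.
  apply: (@le_trans _ _ (2^-1 * \sum_j `|I j i|)); last by have := I2 i; lra.
  rewrite mulr_sumr; apply: ler_sum => j _; case: ifP => _.
    by rewrite normrM gtr0_norm// invr_gt0.
  by rewrite normr0 mulr_ge0// invr_ge0.
have bL : `|\sum_j (\sum_i b i * WL j i) *: e j| <= `|\sum_i b i *: e i|.
  apply: (substochastic_le esym) => [j i i'|i]; last exact: half.
  by rewrite /WL; case: ifPn => [il _|_ /eqP//]; case: ifPn => [il' _|_ /eqP//]; exact: near_uniq il il'.
have bR : `|\sum_j (\sum_i b i * WR j i) *: e j| <= `|\sum_i b i *: e i|.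
  apply: (substochastic_le esym) => [j i i'|i]; last exact: half.
  by rewrite /WR; case: ifPn => [/andP[_ il] _|_ /eqP//]; case: ifPn => [/andP[_ il'] _|_ /eqP//]; exact: near_uniq il il'.
rewrite (_ : \sum_(j < m) _ = 2 *: (\sum_j (\sum_i b i * WL j i) *: e j) +
   2 *: (\sum_j (\sum_i b i * WR j i) *: e j)).
  rewrite (le_trans (ler_normD _ _))// !normrZ ger0_norm//.
  by have := bL; have := bR; lra.
rewrite !scaler_sumr -big_split/=; apply: eq_bigr => j _.
rewrite !scalerA -scalerDl; congr (_ *: _).
rewrite (Rintegral_sum mOmega)//; last first.
  by move=> i _; apply: L1_Z => //; exact: L1_spike.
rewrite !mulr_sumr -big_split/=; apply: eq_bigr => i _.
rewrite RintegralZl//; last by apply: (L1_integrable mOmega) => //; exact: L1_spike.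
by rewrite -/(I j i) IW; lra.
Qed.

End spikes.

(** * The unit interval *)

Section interval.
Context {R : realType}.

Definition itv1 (a b : R) : set 'rV[R]_1 := box (const_mx a) (const_mx b).

Lemma itv1P a b (x : 'rV[R]_1) : itv1 a b x <-> a < x ord0 ord0 < b.
Proof.
split; first by move=> /(_ ord0); rewrite !mxE.
by move=> axb i; rewrite !mxE (ord1 i).
Qed.

Lemma itv1_empty a b : b <= a -> itv1 a b = set0.
Proof. by move=> ba; apply: (box_empty (i := ord0)); rewrite !mxE. Qed.

Lemma unit_intervalE : unit_interval = itv1 0 1.
Proof. by apply/seteqP; split => x /itv1P. Qed.

Lemma measurable_itv1 a b : measurable (itv1 a b).
Proof. exact: measurable_box. Qed.

Lemma measurable_unit_interval : measurable (@unit_interval R).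
Proof. by rewrite unit_intervalE; exact: measurable_itv1. Qed.

Lemma itv1_sub a b c d : c <= a -> b <= d -> itv1 a b `<=` itv1 c d.
Proof.
move=> ca bd x /itv1P/andP[ax xb]; apply/itv1P.
by rewrite (le_lt_trans ca)// (lt_le_trans xb).
Qed.

Lemma itv1_unit a b : 0 <= a -> b <= 1 -> itv1 a b `<=` unit_interval.
Proof. by move=> a0 b1; rewrite unit_intervalE; exact: itv1_sub. Qed.

Lemma cell_itv1 a b : 0 <= a -> b <= 1 -> cell unit_interval (itv1 a b).
Proof. by move=> a0 b1; apply: cell_box; exact: itv1_unit. Qed.

Lemma itv1I a b c d : itv1 a b `&` itv1 c d = itv1 (Num.max a c) (Num.min b d).
Proof. by rewrite /itv1 boxI; congr box; apply/rowP => i; rewrite !mxE. Qed.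

Lemma parallelepiped_itv1 T : parallelepipeds unit_interval T ->
  exists a b, [/\ 0 <= a, a < b, b <= 1 & T = itv1 a b].
Proof.
move=> [sT [p [q [pq TE]]]].
have E : box p q = itv1 (p ord0 ord0) (q ord0 ord0).
  by congr box; apply/rowP => i; rewrite !mxE ord1.
have TI : T = itv1 (Num.max (p ord0 ord0) 0) (Num.min (q ord0 ord0) 1).
  by rewrite -itv1I -E -unit_intervalE -TE; apply/esym/setIidl.
exists (Num.max (p ord0 ord0) 0), (Num.min (q ord0 ord0) 1); split => //.
- by rewrite le_max lexx orbT.
- rewrite ltNge; apply/negP => /itv1_empty; rewrite -TI TE.
  move/seteqP => [/(_ (\row_i ((p ord0 i + q ord0 i) / 2))) + _]; apply => i.
  by have := pq i; rewrite mxE => ?; rewrite !midf_lt.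
- by rewrite ge_min lexx orbT.
Qed.

Lemma lebesgue_itv1 a b : a <= b -> lebesgue_rV 1 (itv1 a b) = (b - a)%:E.
Proof.
move=> ab; rewrite /itv1 lebesgue_rV_vol /vol big_ord1 !mxE max_r//.
by rewrite subr_ge0.
Qed.

Lemma capvol_itv1 a b c d : c <= a -> a <= b -> b <= d ->
  capvol (itv1 c d) (itv1 a b) = b - a.
Proof.
by move=> ca ab bd; rewrite /capvol itv1I max_r// min_r// lebesgue_itv1.
Qed.

Context {X : normedModType R} (e : nat -> X).
Hypothesis esym : symmetric_basis e.

Local Notation U := (@unit_interval R).
Local Notation mu := (@lebesgue_rV R 1).
Local Notation JFn := (JF_norm e U).

Definition Fint (f : 'rV[R]_1 -> R) (a b : R) : R := \int[mu]_(x in itv1 a b) f x.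

Let mU := measurable_unit_interval.

Lemma sum_lengths_le (c d : R) m (a b : 'I_m -> R) : 0 <= c -> d <= 1 -> c <= d ->
  (forall j, c <= a j /\ a j <= b j /\ b j <= d) ->
  trivIset setT (fun j => itv1 (a j) (b j)) -> \sum_j (b j - a j) <= d - c.
Proof.
move=> c0 d1 cd ab tT.
rewrite (eq_bigr (fun j => capvol (itv1 c d) (itv1 (a j) (b j)))); last first.
  by move=> j _; have [? [? ?]] := ab j; rewrite capvol_itv1.
have -> : d - c = vol (const_mx c : 'rV[R]_1) (const_mx d).
  by rewrite /vol big_ord1 !mxE max_r// subr_ge0.
apply: (sum_capvol_le mU) => // j; have [? [? ?]] := ab j.
by apply: cell_itv1; [exact: le_trans c0 _|exact: le_trans d1].
Qed.

Lemma Fint_nil f a b : b <= a -> Fint f a b = 0.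
Proof. by move=> ba; rewrite /Fint itv1_empty// Rintegral_set0. Qed.

Lemma Fint_lin (c : R) f g a b : L1 U f -> L1 U g -> 0 <= a -> b <= 1 ->
  Fint (fun x => c * f x + g x) a b = c * Fint f a b + Fint g a b.
Proof.
move=> Lf Lg a0 b1; apply: (Rintegral_lin mU) => //; first exact: measurable_itv1.
exact: itv1_unit.
Qed.

Lemma lebesgue_rV1_point (b : R) : mu (@rV_coord R 1 ord0 @^-1` [set b]) = 0%E.
Proof.
have mP : measurable (@rV_coord R 1 ord0 @^-1` [set b]).
  by rewrite -[X in measurable X]setTI; exact: measurable_rV_coord.
apply/eqP; rewrite eq_le measure_ge0 andbT.
apply/lee_addgt0Pr => eps eps0; rewrite add0e.
apply: (@le_trans _ _ (mu (itv1 (b - eps / 2) (b + eps / 2)))).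
  apply: le_measure; rewrite ?inE//; first exact: measurable_itv1.
  move=> x /= xb; apply/itv1P; rewrite -/(rV_coord ord0 x) xb; apply/andP; split; lra.
by rewrite lebesgue_itv1 ?lee_fin; lra.
Qed.

Lemma Fint_add f a b c : L1 U f -> 0 <= a -> a <= b -> b <= c -> c <= 1 ->
  Fint f a c = Fint f a b + Fint f b c.
Proof.
move=> Lf a0; rewrite le_eqVlt => /predU1P[-> bc c1|ab].
  by rewrite [X in _ = X + _]Fint_nil// add0r.
rewrite le_eqVlt => /predU1P[-> c1|bc c1].
  by rewrite [X in _ = _ + X]Fint_nil// addr0.
have mP : measurable (@rV_coord R 1 ord0 @^-1` [set b]).
  by rewrite -[X in measurable X]setTI; exact: measurable_rV_coord.
rewrite /Fint -Rintegral_setU; [|exact: measurable_itv1|exact: measurable_itv1| |].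
- rewrite /Rintegral (negligible_integral mP)//; last 3 first.
  + exact: measurable_itv1.
  + apply: (L1_integrable mU) => //; first exact: measurable_itv1.
    exact: itv1_unit.
  + exact: lebesgue_rV1_point.
  congr (fine (integral _ _ _)); apply/seteqP; split => x /=.
    move=> [/itv1P/andP[ax xc] /eqP xb].
    by move: xb; rewrite /rV_coord neq_lt => /orP[xb|bx]; [left|right]; apply/itv1P/andP.
  rewrite /rV_coord => -[/itv1P/andP[ax xb]|/itv1P/andP[bx xc]]; split.
  + by apply/itv1P; rewrite ax (lt_trans xb).
  + by move=> xE; rewrite xE ltxx in xb.
  + by apply/itv1P; rewrite xc andbT (lt_trans ab).
  + by move=> xE; rewrite xE ltxx in bx.
- apply: (L1_integrable mU) => //; first by apply: measurableU; exact: measurable_itv1.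
  by move=> x [/itv1_unit|/itv1_unit]; apply => //; lra.
- apply/disj_setPS => x [/itv1P/andP[_ xb] /itv1P/andP[bx _]].
  by have := lt_trans xb bx; rewrite ltxx.
Qed.

Lemma L1_cst (c : R) : L1 U (fun=> c).
Proof.
have H := L1_Z mU c (L1_indic mU (const_mx 0) (const_mx 1)).
rewrite /Defs.L1/=; apply: (@eq_integrable _ _ _ mu U mU (EFin \o (fun x => c * \1_(box (const_mx 0) (const_mx 1)) x))) => //.
move=> x; rewrite inE => Ux /=; rewrite indicE mem_set ?mulr1//.
by rewrite -/(itv1 0 1) -unit_intervalE.
Qed.

(** The excess of |f| over the level n tends to 0 in L^1 by dominated convergence; a far enough
    level gives [h] and [B]. *)
Lemma L1_truncation f (eps : R) : L1 U f -> 0 < eps ->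
  exists h (B : R), [/\ L1 U h, 0 <= B, forall x, 0 <= h x,
    forall x, `|f x| <= h x + B & \int[mu]_(x in U) h x <= eps].
Proof.
move=> Lf eps0.
pose h n := (fun x => -1 * n%:R + `|f x|)^\+.
have Lh n : L1 U (h n).
  apply: (integrable_funrpos mU); apply: (L1_lin mU (-1) (L1_cst _)).
  exact: L1_normr.
have h0 n x : 0 <= h n x by rewrite /h /funrpos le_max lexx orbT.
have hf n x : h n x <= `|f x|.
  by rewrite /h /funrpos ge_max normr_ge0 andbT mulN1r addrC lerBlDr lerDl ler0n.
have Bound n x : `|f x| <= h n x + n%:R.
  by rewrite -lerBlDr /h /funrpos le_max mulN1r addrC lexx.
have cv : (\int[mu]_(x in U) (EFin \o h n) x)%E @[n --> \oo] --> (\int[mu]_(x in U) 0%:E)%E.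
  apply: (dominated_cvg mU (g := EFin \o (fun x => `|f x|))) => //.
  - by move=> n; have /integrableP[] := Lh n.
  - move=> x Ux; apply: cvg_near_cst; near=> n; congr EFin.
    rewrite /h /funrpos max_r// mulN1r addrC subr_le0.
    by near: n; exact: nbhs_infty_ger.
  - exact: L1_normr.
  - by move=> n x Ux /=; rewrite lee_fin ger0_norm.
rewrite integral0 in cv.
have /fine_cvgP[_ cv'] := cv.
have /cvgrPdist_le/(_ _ eps0)[N _ HN] := cv'.
exists (h N), N%:R; split => //.
have := HN N (leqnn N); rewrite /= sub0r normrN.
by move=> /(le_trans (ler_norm _)).
Unshelve. all: by end_near. Qed.

Lemma grid_cell (N : nat) (a : R) : 0 <= a <= 1 ->
  exists g : 'I_N.+1, g%:R <= a * N.+1%:R <= g.+1%:R.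
Proof.
move=> /andP[a0]; rewrite le_eqVlt => /predU1P[->|a1].
  by exists ord_max; rewrite mul1r lexx andbT /= ler_nat.
have aN : 0 <= a * N.+1%:R by rewrite mulr_ge0.
have gN : (Num.truncn (a * N.+1%:R) < N.+1)%N.
  by rewrite truncn_lt_nat// -[ltRHS]mul1r ltr_pM2r.
exists (Ordinal gN); rewrite /= truncn_le aN /=.
exact/ltW/truncnS_gt.
Qed.

Hypothesis rX : reflexive_space X.

(** Split |f| <= h + B with [h] small in L^1. The part from [h] is small even in the l_1 sum. The
    part from [B] is governed by lengths: grouped over a grid of N + 1 cells it costs at most 2 B /
    (N + 1) times |e_0 + ... + e_N|, which is small by [reflexive_average]. *)
Lemma short_intervals (f : 'rV[R]_1 -> R) (eps : R) : L1 U f -> 0 < eps ->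
  exists2 delta, 0 < delta & forall m (a b : 'I_m -> R),
    (forall j, 0 <= a j /\ a j <= b j /\ b j <= 1) ->
    (forall j, b j - a j <= delta) ->
    trivIset setT (fun j => itv1 (a j) (b j)) ->
    `|\sum_j Fint f (a j) (b j) *: e j| <= eps.
Proof.
move=> Lf eps0; have e00 := symmetric_e_neq0 esym.
have eps1 : 0 < eps / 2 / `|e 0%N| by rewrite !divr_gt0.
have [h [B [Lh B0 h0 fhB hint]]] := L1_truncation Lf eps1.
have eta0 : 0 < eps / 2 / (2 * B + 1) by rewrite !divr_gt0// ltr_pwDr// mulr_ge0.
have [[//|N] _ lamN] := reflexive_average esym rX eta0.
exists N.+1%:R^-1; first by rewrite invr_gt0.
move=> m a b ab bad tT.
have abT j : cell U (itv1 (a j) (b j)) by have [? [? ?]] := ab j; exact: cell_itv1.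
pose p j := Fint h (a j) (b j); pose q j := B * (b j - a j).
have p0 j : 0 <= p j by apply: Rintegral_ge0 => x _.
have q0 j : 0 <= q j by have [? [? ?]] := ab j; rewrite mulr_ge0// subr_ge0.
have Lfn : L1 U (fun x => `|f x|) by exact: L1_normr.
have Fpq j : `|Fint f (a j) (b j)| <= p j + q j.
  have mT : measurable (itv1 (a j) (b j)) by exact: measurable_itv1.
  have sT := cell_sub (abT j).
  rewrite (le_trans (le_normr_Rintegral _ _))//.
    exact: (L1_integrable mU).
  rewrite (@le_trans _ _ (\int[mu]_(x in itv1 (a j) (b j)) (1 * h x + B)))//.
    apply: le_Rintegral => //; first exact: (L1_integrable mU).
      by apply: (L1_integrable mU) => //; apply: (L1_lin mU) => //; exact: L1_cst.
    by move=> x _; rewrite mul1r.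
  rewrite (Rintegral_lin mU)//; last exact: L1_cst.
  rewrite mul1r lerD2l Rintegral_cst// le_eqVlt; apply/orP; left; apply/eqP.
  rewrite /q; congr (_ * _); apply: (congr1 fine (lebesgue_itv1 _)).
  by have [? [? ?]] := ab j.
apply: (@le_trans _ _ `|\sum_j (p j + q j) *: e j|).
  apply: (symmetric_mono esym) => j; rewrite (le_trans (Fpq j))//.
  by rewrite ler_norm.
have -> : \sum_j (p j + q j) *: e j = \sum_j p j *: e j + \sum_j q j *: e j.
  by rewrite -big_split/=; apply: eq_bigr => j _; rewrite scalerDl.
rewrite (le_trans (ler_normD _ _))// [leRHS]splitr lerD//.
  rewrite (le_trans (symmetric_le_sum esym _))// -ler_pdivlMr//.
  apply: le_trans hint; rewrite (eq_bigr p); last by move=> j _; rewrite ger0_norm.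
  exact: (sum_Rintegral_le mU).
have gex j : exists g : 'I_N.+1, g%:R <= a j * N.+1%:R <= g.+1%:R.
  by have [? [? ?]] := ab j; apply: grid_cell; apply/andP; split => //; lra.
pose g j := sval (cid (gex j)).
have gP j : (g j)%:R <= a j * N.+1%:R <= (g j).+1%:R by rewrite /g; case: cid.
(* Each interval is charged to the grid cell of its left end. A cell receives total length at most 2
   / (N + 1), so this factor makes the columns sum to at most one. *)
pose W (j : 'I_m) (i : 'I_N.+1) := if i == g j then N.+1%:R / 2 * (b j - a j) else 0.
have N0 : 0 < N.+1%:R :> R by [].
have qW : \sum_j q j *: e j = \sum_j (\sum_i (2 * B / N.+1%:R) * W j i) *: e j.
  apply: eq_bigr => j _; congr (_ *: _); rewrite (bigD1 (g j))//= big1 ?addr0.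
    rewrite /W eqxx /q; move: N0; set K := N.+1%:R => N0.
    rewrite mulrA [2 * B / K * _]mulrC !mulrA; congr (_ * _).
    by rewrite divfK ?pnatr_eq0// mulrAC divff ?gt_eqF// mul1r.
  by move=> i /negPf ig; rewrite /W ig mulr0.
rewrite qW; apply: (le_trans (@substochastic_le _ _ _ esym _ _ W (fun=> 2 * B / N.+1%:R) _ _)).
- move=> j i i'; rewrite /W; case: (i =P g j) => [-> _|_ /eqP//].
  by case: (i' =P g j) => [->//|_ /eqP//].
- move=> i.
  (* The intervals that start in cell [i] are at most one grid step long, so they end within two
     steps of [lo]. The others are collapsed to the point [lo], so that [sum_lengths_le] applies to
     the whole family. *)
  pose lo := i%:R / N.+1%:R : R; pose hi := Num.min 1 (i.+2%:R / N.+1%:R : R).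
  pose a' j := if i == g j then a j else lo; pose b' j := if i == g j then b j else lo.
  have lo0 : 0 <= lo by rewrite divr_ge0.
  have lohi : lo <= hi.
    rewrite le_min ler_pdivrMr// mul1r ler_nat ltnW//=.
    by rewrite ler_pM2r ?invr_gt0// ler_nat -addn2 leq_addr.
  have Hs : \sum_j (b' j - a' j) <= hi - lo.
    apply: sum_lengths_le => //.
  + by rewrite ge_min lexx.
  + move=> j; rewrite /a' /b'; case: eqP => [ig|_]; last by rewrite !lexx lohi.
    have [aj0 [ajb bj1]] := ab j; have := gP j; rewrite -ig => /andP[g1 g2].
    split; first by rewrite ler_pdivrMr.
    split => //; rewrite le_min bj1 /= ler_pdivlMr//.
    have := bad j; rewrite -(ler_pM2r N0) mulVf ?gt_eqF// mulrBl.
    rewrite -[i.+2%:R]natr1; lra.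
  + move=> j k _ _; rewrite /a' /b'; case: eqP => [_|_]; case: eqP => [_|_].
    * by apply: tT.
    * by rewrite [itv1 lo lo]itv1_empty// setI0 => -[].
    * by rewrite [itv1 lo lo]itv1_empty// set0I => -[].
    * by rewrite [itv1 lo lo]itv1_empty// set0I => -[].
  rewrite (eq_bigr (fun j => N.+1%:R / 2 * (b' j - a' j))).
    rewrite -mulr_sumr (@le_trans _ _ (N.+1%:R / 2 * (hi - lo)))//.
      by rewrite ler_wpM2l// divr_ge0.
    rewrite (@le_trans _ _ (N.+1%:R / 2 * (i.+2%:R / N.+1%:R - lo)))//.
      by rewrite ler_wpM2l ?divr_ge0// lerD2r ge_min lexx orbT.
    have i2 : i.+2%:R - i%:R = 2 :> R by rewrite -addn2 natrD addrAC subrr add0r.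
    by rewrite /lo -mulrBl i2 mulrA divfK ?pnatr_eq0// divff ?gt_eqF.
  move=> j _; rewrite /W /a' /b'; case: eqP => _.
    rewrite ger0_norm// mulr_ge0 ?divr_ge0//.
    by have [? [? ?]] := ab j; rewrite subr_ge0.
  by rewrite subrr mulr0 normr0.
- rewrite -scaler_sumr normrZ ger0_norm ?divr_ge0 ?mulr_ge0//.
  have : 2 * B / N.+1%:R * `|\sum_(i < N.+1) e i| <=
      2 * B / N.+1%:R * (eps / 2 / (2 * B + 1) * N.+1%:R).
    by rewrite ler_wpM2l// divr_ge0// mulr_ge0.
  move=> /le_trans; apply.
  rewrite [eps / 2 / _ * _]mulrC mulrA divfK ?gt_eqF//.
  have K0 : 0 < 2 * B + 1 by rewrite ltr_pwDr// mulr_ge0.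
  rewrite mulrA ler_pdivrMr// mulrC ler_wpM2l//; first by rewrite divr_ge0// ltW.
  by rewrite lerDl.
Qed.

End interval.

(** * Ptak's combinatorial lemma *)

Section ptak.
Context {R : realType} {K : Type}.
Variable A : K -> nat -> bool.

Definition convex_weight (N : nat) (M : nat) (lam : nat -> R) :=
  [/\ forall i, 0 <= lam i, forall i, (i < N)%N || (M <= i)%N -> lam i = 0 &
      \sum_(i < M) lam i = 1].

Definition hit_mass (k : K) (M : nat) (lam : nat -> R) := \sum_(i < M | A k i) lam i.

(** The negation of a smallness statement: no convex combination of indices from [N] on has hit mass
    below [eps] at all points of [G]. *)
Definition substantial (G : set K) (N : nat) (eps : R) :=
  forall M lam, convex_weight N M lam -> exists2 k, G k & eps <= hit_mass k M lam.

Definition meets (k : K) (N N' : nat) := exists n, (N <= n < N')%N && A k n.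

Lemma convex_weight_widen N M M' lam : (M <= M')%N -> convex_weight N M lam ->
  convex_weight N M' lam.
Proof.
move=> MM' [l0 lz l1]; split => //.
  by move=> i /orP[iN|iM]; apply: lz; [rewrite iN|rewrite (leq_trans MM' iM) orbT].
rewrite -l1 (big_ord_widen M' (fun i => lam i) MM') [in RHS]big_mkcond/=.
by apply: eq_bigr => i _; case: ltnP => // Mi; apply: lz; rewrite Mi orbT.
Qed.

Lemma hit_mass_widen N M M' lam k : (M <= M')%N -> convex_weight N M lam ->
  hit_mass k M' lam = hit_mass k M lam.
Proof.
move=> MM' [_ lz _]; rewrite /hit_mass.
rewrite (big_ord_widen_cond M' (A k) (fun i => lam i) MM') [LHS]big_mkcond [RHS]big_mkcond/=.
apply: eq_bigr => i _; case: (A k i) => //=.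
by case: ltnP => // Mi; apply: lz; rewrite Mi orbT.
Qed.

Lemma hit_mass_le1 N M lam k : convex_weight N M lam -> hit_mass k M lam <= 1.
Proof.
move=> [l0 _ <-]; rewrite /hit_mass [leRHS](bigID (fun i : 'I_M => A k i))/=.
by rewrite lerDl sumr_ge0.
Qed.

Lemma hit_mass_eq0 N M lam k : convex_weight N M lam -> ~ meets k N M -> hit_mass k M lam = 0.
Proof.
move=> [_ lz _] nk; rewrite /hit_mass big1// => i Aki.
have [iN|Ni] := ltnP i N; first by apply: lz; rewrite iN.
by exfalso; apply: nk; exists i; rewrite Ni ltn_ord.
Qed.

(** If every N' failed, there would be convex weights on successive blocks, each with hit mass below
    eps' at all [k] of [G] that have met their set before. Along these weights a given [k] has mass
    0 until it first meets its set, at most 1 in that block and less than eps' afterwards; a long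
    average contradicts [GN]. *)
Lemma substantial_step (G : set K) N (eps eps' : R) : 0 <= eps' -> eps' < eps ->
  substantial G N eps ->
  exists2 N', (N < N')%N & substantial (G `&` [set k | meets k N N']) N' eps'.
Proof.
move=> eps'0 ee GN; apply: contrapT => /forall2NP nN'.
have ex N' : exists q : nat * (nat -> R), (N < N')%N ->
    convex_weight N' q.1 q.2 /\
    forall k, G k -> meets k N N' -> hit_mass k q.1 q.2 < eps'.
  have [NN'|] := ltnP N N'; last by exists (0%N, fun=> 0).
  have [//|] := nN' N'.
  move=> /existsNP[M /existsNP[lam /not_implyP[lamP /forall2NP H]]].
  exists (M, lam) => _; split => // k Gk mk.
  by have [[]//|/negP] := H k; rewrite -ltNge.
pose q N' := sval (cid (ex N')).
have qP N' : (N < N')%N -> convex_weight N' (q N').1 (q N').2 /\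
    forall k, G k -> meets k N N' -> hit_mass k (q N').1 (q N').2 < eps'.
  by rewrite /q; case: cid.
pose P := fix P (k : nat) := if k is k'.+1 then (q (P k')).1 else N.+1.
have PN k : (N < P k)%N.
  elim: k => [//|k IH] /=; have [[l0 lz l1] _] := qP _ IH.
  rewrite ltnNge; apply/negP => MN; move: l1; rewrite big1 => [/eqP|i _].
    by rewrite eq_sym oner_eq0.
  by apply: lz; rewrite (leq_trans (ltn_ord i))// ltnW// (leq_ltn_trans MN).
have cw k := (qP _ (PN k)).1.
have PS k : (P k <= P k.+1)%N.
  have [l0 lz l1] := cw k; rewrite leqNgt; apply/negP => MN; move: l1; rewrite big1 => [/eqP|i _].
    by rewrite eq_sym oner_eq0.
  by apply: lz; rewrite (ltn_trans (ltn_ord i)).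
have Pmono k l : (k <= l)%N -> (P k <= P l)%N.
  by move=> /subnK <-; elim: (l - k)%N => // i IH; rewrite (leq_trans IH)// PS.
pose lam k := (q (P k)).2.
have small m k : G k -> \sum_(j < m) hit_mass k (P j.+1) (lam j) <=
    if pselect (meets k N (P m)) then 1 + m%:R * eps' else 0.
  move=> Gk; elim: m => [|m IH].
    by rewrite big_ord0; case: pselect => // _ /=; rewrite mul0r addr0.
  rewrite big_ord_recr/=; move: IH; case: pselect => [mk|nmk] /= IH.
    case: pselect => [_|[]] /=; last first.
      by have [i /andP[/andP[Ni iP] Ai]] := mk; exists i; rewrite Ni Ai (leq_trans iP)// PS.
    have := (qP _ (PN m)).2 k Gk mk; rewrite -natr1 mulrDl mul1r addrA => h.
    by apply: lerD => //; exact: ltW.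
  case: pselect => [_|nmk'] /=.
    rewrite -[leRHS]add0r lerD// (le_trans (hit_mass_le1 k (cw m)))//.
    by rewrite lerDl mulr_ge0.
  rewrite (hit_mass_eq0 (cw m)) ?addr0// => -[i /andP[/andP[Pi iP] Ai]].
  by apply: nmk'; exists i; rewrite Ai andbT iP andbT (leq_trans _ Pi)// ltnW.
(* With this many blocks, the one possibly large mass weighs less than eps - eps' in the average. *)
have [m mE] : exists m : nat, 1 < m.+1%:R * (eps - eps').
  have e0 : 0 < eps - eps' by rewrite subr_gt0.
  exists (Num.truncn (1 / (eps - eps'))); rewrite -ltr_pdivrMr//.
  exact: truncnS_gt.
have m0 : 0 < m.+1%:R :> R by [].
pose Lam i := m.+1%:R^-1 * \sum_(j < m.+1) lam j i.
have cw' (j : 'I_m.+1) : convex_weight (P j) (P m.+1) (lam j).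
  by apply: (convex_weight_widen _ (cw j)); exact: (Pmono j.+1 m.+1).
have LamP : convex_weight N (P m.+1) Lam.
  split.
  - move=> i; rewrite mulr_ge0 ?invr_ge0// sumr_ge0// => j _.
    by have [+ _ _] := cw j; apply.
  - move=> i iP; rewrite /Lam big1 ?mulr0// => j _; have [_ + _] := cw' j; apply.
    by move: iP => /orP[iN|->]; rewrite ?orbT// (ltn_trans iN).
  - rewrite -mulr_sumr exchange_big/= (eq_bigr (fun=> 1)); last first.
      by move=> j _; have [_ _] := cw' j.
    by rewrite sumr_const card_ord mulVf// gt_eqF.
have [k Gk] := GN _ _ LamP.
have -> : hit_mass k (P m.+1) Lam = m.+1%:R^-1 * \sum_(j < m.+1) hit_mass k (P j.+1) (lam j).
  rewrite {1}/hit_mass -mulr_sumr exchange_big/=; congr (_ * _); apply: eq_bigr => j _.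
  by rewrite -(@hit_mass_widen (P j) (P j.+1) (P m.+1) (lam j) k _ (cw j))//; exact: (Pmono j.+1 m.+1).
rewrite mulrC ler_pdivlMr// leNgt => /negP; apply.
apply: le_lt_trans (small _ _ Gk) _; case: pselect => _ /=; last first.
  by rewrite mulr_gt0// (le_lt_trans eps'0).
rewrite -ltrBrDr; apply: lt_le_trans mE _.
by rewrite mulrBr mulrC lexx.
Qed.

(** Iterates [substantial_step] along strictly decreasing positive thresholds. Substantiality tested
    on a point mass shows that each of the nested sets is nonempty, and a member of the m-th one
    meets the first m blocks. *)
Lemma ptak (eps : R) : 0 < eps -> substantial setT 0 eps ->
  exists N : nat -> nat, (forall i, (N i < N i.+1)%N) /\
    forall m, exists k, forall i, (i < m)%N -> meets k (N i) (N i.+1).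
Proof.
move=> eps0 S0; pose ee i := eps / i.+1%:R.
have ee0 i : 0 <= ee i by rewrite divr_ge0// ltW.
have eeS i : ee i.+1 < ee i by rewrite ltr_pM2l// ltf_pV2 ?posrE// ltr_nat.
pose Q i (s s' : set K * nat) := (s.2 < s'.2)%N /\
  s'.1 = s.1 `&` [set k | meets k s.2 s'.2] /\ substantial s'.1 s'.2 (ee i.+1).
pose st := fix st i := if i is i'.+1 then xget (st i') [set s' | Q i' (st i') s'] else (setT, 0%N).
have stP i : substantial (st i).1 (st i).2 (ee i) /\ Q i (st i) (st i.+1).
  have step j : substantial (st j).1 (st j).2 (ee j) -> Q j (st j) (st j.+1).
    move=> Sj; rewrite [st j.+1]/=.
    have [N' NN' SN'] := substantial_step (ee0 j.+1) (eeS j) Sj.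
    have : [set s' | Q j (st j) s'] ((st j).1 `&` [set k | meets k (st j).2 N'], N') by [].
    by move=> h; exact: (xgetPex (st j) (ex_intro _ _ h)).
  elim: i => [|i [_ Qi]].
    by split; [rewrite /= /ee divr1|apply: step; rewrite /= /ee divr1].
  by have [_ [_ Si]] := Qi; split => //; exact: step.
exists (fun i => (st i).2); split; first by move=> i; have [_ []] := stP i.
move=> m; have [Sm _] := stP m.
have dP : convex_weight (st m).2 (st m).2.+1 (fun i => (i == (st m).2)%:R).
  split.
  - by [].
  - by move=> i; case: eqP => // ->; rewrite !ltnn.
  - rewrite (bigD1 ord_max)//= eqxx big1 ?addr0// => i.
    by rewrite -val_eqE/= => /negPf ->.
have [k Gk _] := Sm _ _ dP; exists k => i im.
have : forall j, (j <= m)%N -> (st j).1 k.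
  move=> j jm; rewrite -(subKn jm); elim: (m - j)%N => [|l IH]; first by rewrite subn0.
  have [lm|ml] := ltnP l m; last first.
    by move: IH; rewrite (eqP (_ : (m - l == 0)%N)) ?subn_eq0// (eqP (_ : (m - l.+1 == 0)%N)) ?subn_eq0// (leq_trans ml).
  have [_ [_ [E _]]] := stP (m - l.+1)%N; move: IH; rewrite subnSK// in E.
  by rewrite E => -[].
move=> /(_ i.+1 im); have [_ [_ [-> _]]] := stP i.
by move=> [_].
Qed.

End ptak.

Lemma cvg_sumr {R : realType} {T : Type} {F : set_system T} {FF : Filter F} (M : nat)
    (u : 'I_M -> T -> R) (a : 'I_M -> R) :
  (forall i, u i x @[x --> F] --> a i) ->
  \sum_(i < M) u i x @[x --> F] --> \sum_(i < M) a i.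
Proof. by move=> ua; apply: cvg_big => //; exact: add_continuous. Qed.

(** An ultrafilter that contains a finite union contains one of its members. *)
Lemma ultra_pigeonhole (Q : nat -> nat -> Prop) (N N' : nat) :
  (\forall m \near nat_ultra, exists n, (N <= n < N')%N /\ Q m n) ->
  exists2 n, (N <= n < N')%N & \forall m \near nat_ultra, Q m n.
Proof.
elim: N' => [|N' IH] H.
  by have /filter_ex[m [n []]] := H; rewrite ltn0 andbF.
have [H'|H'] := @in_ultra_setVsetC _ _ [set m | exists n, (N <= n < N')%N /\ Q m n] nat_ultra_ultra.
  have [n /andP[Nn nN'] Qn] := IH H'.
  by exists n => //; rewrite Nn (ltn_trans nN').
exists N'; last first.
  apply: filterS (filterI H H') => m [[n [/andP[Nn]]]].
  rewrite ltnS leq_eqVlt => /predU1P[->//|nN'] Qm nH.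
  by exfalso; apply: nH; exists n; rewrite Nn nN'.
have HI : nat_ultra ([set m | exists n, (N <= n < N'.+1)%N /\ Q m n] `&`
  ~` [set m | exists n, (N <= n < N')%N /\ Q m n]) by apply: filterI.
have /filter_ex[m [[n [/andP[Nn]]]]] := HI.
rewrite ltnS leq_eqVlt => /predU1P[<-|nN'] Qm nH; first by rewrite Nn ltnSn.
by exfalso; apply: nH; exists n; rewrite Nn nN'.
Qed.

(** * Weakly null sequences *)

Section weakly_null.
Context {R : realType} {X : normedModType R} (e : nat -> X).
Hypothesis esym : symmetric_basis e.
Hypothesis rX : reflexive_space X.
Local Notation U := (@unit_interval R).
Local Notation mu := (@lebesgue_rV R 1).
Local Notation JFn := (JF_norm e U).
Let mU := @measurable_unit_interval R.

Lemma Fint_family_le f m (a b : 'I_m -> R) : L1 U f ->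
  (forall j, 0 <= a j /\ b j <= 1) ->
  trivIset setT (fun j => itv1 (a j) (b j)) ->
  `|\sum_j Fint f (a j) (b j) *: e j| <= JFn f.
Proof.
move=> Lf ab tT; apply: (JF_norm_ub esym mU Lf) => // j.
by have [? ?] := ab j; exact: cell_itv1.
Qed.

(* Families of intervals listed by decreasing length, hence with
   (b j - a j) * (j + 1) <= 1; padded with empty intervals. *)
Definition sorted_family (m : nat) (a b : nat -> R) :=
  [/\ forall j, 0 <= a j /\ a j <= b j /\ b j <= 1,
      forall j, (b j - a j) * j.+1%:R <= 1,
      forall j, (m <= j)%N -> b j = a j &
      forall i j, i != j -> itv1 (a i) (b i) `&` itv1 (a j) (b j) = set0].

(** Symmetry permits the renumbering. The j + 1 longest intervals are disjoint in (0, 1), so the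
    shortest of them has length at most 1 / (j + 1). *)
Lemma sorted_family_exists m (T : 'I_m -> set 'rV[R]_1) :
  (forall j, parallelepipeds U (T j)) -> trivIset setT T ->
  exists a b, sorted_family m a b /\ forall f,
    `|\sum_(j < m) (\int[mu]_(x in T j) f x) *: e j| =
    `|\sum_(j < m) Fint f (a j) (b j) *: e j|.
Proof.
move=> pT tT.
have ex j : exists p : R * R, [/\ 0 <= p.1, p.1 < p.2, p.2 <= 1 & T j = itv1 p.1 p.2].
  by have [a [b ?]] := parallelepiped_itv1 (pT j); exists (a, b).
pose p j := sval (cid (ex j)).
have pP j : [/\ 0 <= (p j).1, (p j).1 < (p j).2, (p j).2 <= 1 & T j = itv1 (p j).1 (p j).2].
  by rewrite /p; case: cid.
pose len j := (p j).2 - (p j).1.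
pose s := sort (fun i j => len j <= len i) (enum 'I_m).
have ss : size s = m by rewrite size_sort size_enum_ord.
have us : uniq s by rewrite sort_uniq enum_uniq.
have srt : sorted (fun i j => len j <= len i) s.
  by apply: sort_sorted => i j; exact: le_total.
pose sg (i : 'I_m) := nth i s i.
have sgI : injective sg.
  move=> i j; rewrite /sg (set_nth_default j) ?ss// => /eqP.
  by rewrite nth_uniq ?ss// => /eqP/ord_inj.
have len_mono (i j : 'I_m) : (i <= j)%N -> len (sg j) <= len (sg i).
  rewrite leq_eqVlt => /predU1P[/ord_inj->//|ij]; rewrite /sg (set_nth_default i)// ?ss//.
  have := sorted_ltn_nth _ i srt i j; rewrite !inE ss => -> //.
  by move=> x y z /= h1 h2; exact: le_trans h2 h1.
pose a j := oapp (fun i : 'I_m => (p (sg i)).1) 0 (insub j).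
pose b j := oapp (fun i : 'I_m => (p (sg i)).2) 0 (insub j).
have aE (i : 'I_m) : a i = (p (sg i)).1 by rewrite /a valK.
have bE (i : 'I_m) : b i = (p (sg i)).2 by rewrite /b valK.
have out j : (m <= j)%N -> a j = 0 /\ b j = 0.
  by move=> mj; rewrite /a /b insubF// ltnNge mj.
have ab j : 0 <= a j /\ a j <= b j /\ b j <= 1.
  have [jm|/out[-> ->]] := ltnP j m; last by rewrite lexx ler01.
  have [h1 h2 h3 _] := pP (sg (Ordinal jm)).
  by rewrite (aE (Ordinal jm)) (bE (Ordinal jm)) h1 h3 (ltW h2).
have disj i j : i != j -> itv1 (a i) (b i) `&` itv1 (a j) (b j) = set0.
  move=> ij; have [im|/out[-> ->]] := ltnP i m; last by rewrite (itv1_empty (lexx 0)) set0I.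
  have [jm|/out[-> ->]] := ltnP j m; last by rewrite (itv1_empty (lexx 0)) setI0.
  rewrite (aE (Ordinal im)) (bE (Ordinal im)) (aE (Ordinal jm)) (bE (Ordinal jm)).
  have [_ _ _ <-] := pP (sg (Ordinal im)); have [_ _ _ <-] := pP (sg (Ordinal jm)).
  apply/eqP/negPn/negP => /set0P/(tT _ _ I I)/sgI/eqP.
  by rewrite -val_eqE/= (negPf ij).
exists a, b; split; first split => //.
- move=> j; have [jm|/out[-> ->]] := ltnP j m; last by rewrite subrr mul0r.
  have tT' : trivIset setT (fun i : 'I_j.+1 => itv1 (a i) (b i)).
    move=> i k _ _ [x xik]; apply/eqP/negPn/negP; rewrite -val_eqE/= => /disj.
    by move/seteqP => [/(_ x) + _]; apply.
  have := @sum_lengths_le R 0 1 j.+1 (fun i => a i) (fun i => b i) (lexx _) (lexx _) ler01.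
  move=> /(_ (fun i => ab i) tT'); rewrite subr0; apply: le_trans.
  rewrite mulr_natr -[j.+1 in leLHS]card_ord -sumr_const; apply: ler_sum => i _.
  have im : (i < m)%N by rewrite (leq_trans (ltn_ord i)).
  rewrite (aE (Ordinal im)) (bE (Ordinal im)) (aE (Ordinal jm)) (bE (Ordinal jm)).
  by apply: len_mono => /=; rewrite -ltnS.
- by move=> j /out[-> ->].
- move=> f; rewrite (reindex_inj sgI)/=.
  rewrite (@symmetric_inj _ _ _ esym _ (fun i => \int[mu]_(x in T (sg i)) f x) _ (fun i => nat_of_ord (sg i)))//.
    congr `|_|; apply: eq_bigr => i _; rewrite aE bE /Fint.
    by have [_ _ _ <-] := pP (sg i).
  by move=> i j /ord_inj/sgI.
Qed.

Lemma sorted_family_trivIset m a b J M : sorted_family m a b ->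
  trivIset setT (fun j : 'I_M => itv1 (a (J + j)%N) (b (J + j)%N)).
Proof.
move=> [_ _ _ disj] i j _ _ [x xij]; apply/eqP/negPn/negP => ij.
have := disj (J + i)%N (J + j)%N; rewrite eqn_add2l => /(_ ij).
by move/seteqP => [/(_ x) + _]; apply.
Qed.

Lemma sum_shift_norm (c : nat -> R) J M :
  `|\sum_(j < M) c (J + j)%N *: e (J + j)%N| = `|\sum_(j < M) c (J + j)%N *: e j|.
Proof.
apply: (@symmetric_inj _ _ _ esym _ (fun j => c (J + j)%N) _ (fun j => (J + j)%N)) => //.
by move=> i j /addnI/ord_inj.
Qed.

(** Continuity of the primitive is [short_intervals] for a single interval. *)
Lemma Fint_continuous f (a : nat -> R) (al : R) (u : nat -> R) : L1 U f ->
  (forall n, 0 <= a n /\ a n <= 1) -> 0 <= al -> al <= 1 ->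
  a n @[n --> nat_ultra] --> al ->
  Fint f 0 (a n) @[n --> nat_ultra] --> Fint f 0 al.
Proof.
move=> Lf a01 al0 al1 aal; apply/cvgrPdist_le => eps eps0.
have e0 := symmetric_e_neq0 esym.
have [|delta d0 short] := short_intervals esym rX Lf (eps := eps * `|e 0%N|).
  by rewrite mulr_gt0.
have one x y : 0 <= x -> x <= y -> y <= 1 -> y - x <= delta -> `|Fint f x y| <= eps.
  move=> x0 xy y1 yx; have := short 1%N (fun=> x) (fun=> y) (fun=> conj x0 (conj xy y1)) (fun=> yx).
  rewrite big_ord1 normrZ ler_pM2r//; apply.
  by move=> i j; rewrite !ord1.
have /cvgrPdist_le/(_ _ d0) := aal; apply: filterS => n.
have [an0 an1] := a01 n.
have [aln|nal] := leP al (a n) => h.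
  rewrite (Fint_add Lf (lexx 0) al0 aln an1) opprD addrA subrr add0r normrN.
  apply: one => //; move: h; rewrite ler_norml => /andP[]; lra.
rewrite (Fint_add Lf (lexx 0) an0 (ltW nal) al1) addrAC subrr add0r.
apply: one => //; first exact: ltW.
by move: h; rewrite ler_norml => /andP[]; lra.
Qed.

Context (J : completeNormedModType R) (iota : ('rV[R]_1 -> R) -> J).
Hypothesis JP : is_JF e U iota.

(* The functionals x*(sum_j (int_{I_j} _) e_j) form a
   weak*-compact norming set, on which a pointwise null sequence tends to 0;
   Ptak's lemma then replaces dominated convergence. *)
Lemma pointwise_null_weakly_null (f : nat -> 'rV[R]_1 -> R) (B : R) (L : dual J) (c : R) :
  (forall n, L1 U (f n)) -> (forall n, JFn (f n) <= B) ->
  (forall a b, 0 <= a -> a <= b -> b <= 1 -> Fint (f n) a b @[n --> \oo] --> (0 : R)) ->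
  0 < c -> ~ (forall n, c <= L (iota (f n))).
Proof.
move=> Lf fB f0 c0 Lc.
have B0 : 0 < B.
  rewrite ltNge; apply/negP => B0; have := Lc 0%N.
  have := dual_iota_le JP L (Lf 0%N); have := le_trans (fB 0%N) B0 => h1 h2 h3.
  have h4 : `|L| * JFn (f 0%N) <= 0 by rewrite mulr_ge0_le0.
  have := ler_norm (L (iota (f 0%N))); lra.
have L0 : 0 < `|L|.
  rewrite normr_gt0; apply/eqP => L0; have := Lc 0%N.
  have := dual_iota_le JP L (Lf 0%N); rewrite {2}L0 normr0 mul0r => h2 h3.
  have := ler_norm (L (iota (f 0%N))); lra.
(* Every convex combination of the [f n] has JF norm at least c / |L| = 2 c1; the half leaves room
   to choose an actual family of intervals. *)
pose c1 := c / `|L| / 2; have c10 : 0 < c1 by rewrite !divr_gt0.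
pose K := {k : dual X * (nat * ((nat -> R) * (nat -> R))) |
  `|k.1| <= 1 /\ sorted_family k.2.1 k.2.2.1 k.2.2.2}.
pose va (k : K) (g : 'rV[R]_1 -> R) : R := (sval k).1
  (\sum_(j < (sval k).2.1) Fint g ((sval k).2.2.1 j) ((sval k).2.2.2 j) *: e j).
have va_le k g : L1 U g -> `|va k g| <= JFn g.
  case: k => [[x [m [a b]]] /= [x1 sf]] Lg; rewrite /va/=.
  rewrite (le_trans (dual_le _ _))//.
  apply: (@le_trans _ _ `|\sum_(j < m) Fint g (a j) (b j) *: e j|); first by rewrite ler_piMl.
  apply: Fint_family_le => //; first by move=> j; have [/(_ j)[? [? ?]] _ _ _] := sf.
  exact: (sorted_family_trivIset (J := 0) sf).
pose delta := c1 / 2; have delta0 : 0 < delta by rewrite divr_gt0.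
pose A (k : K) (n : nat) := delta <= va k (f n).
(* A test exceeding c1 at the convex combination gets at most delta = c1 / 2 from the indices
   outside [A] and at most [B] times the hit mass from the others. *)
have sub : substantial A setT 0 (delta / B).
  move=> M lam [l0 lz l1].
  pose g := fun x => \sum_(i < M) lam i * f i x.
  have Lg : L1 U g by apply: (L1_sum mU) => i _; exact: L1_Z.
  have gc : c <= L (iota g).
    rewrite /g (iota_sum mU JP _ (fun i : 'I_M => lam i) (fun i _ => Lf i)).
    rewrite (linear_sum L)/= -[c]mul1r -l1 mulr_suml; apply: ler_sum => i _.
    by rewrite [leRHS](dualZ L) ler_wpM2l.
  have Jg : 2 * c1 <= JFn g.
    rewrite /c1 mulrC divfK ?pnatr_eq0// ler_pdivrMr// mulrC.
    by rewrite (le_trans gc)// (le_trans (ler_norm _))// dual_iota_le.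
  have [m [T [pT tT Tg]]] : exists m (T : 'I_m -> set 'rV[R]_1),
     [/\ forall j, parallelepipeds U (T j), trivIset setT T &
      c1 < `|\sum_(j < m) (\int[mu]_(x in T j) g x) *: e j|].
    apply: contrapT => nT; have : JFn g <= c1; last by lra.
    apply: JF_norm_le => m T pT tT; rewrite leNgt; apply/negP => h.
    by apply: nT; exists m, T.
  have [a [b [sf E]]] := sorted_family_exists pT tT.
  have [x [x1 xE]] := norming_functional (\sum_(j < m) Fint g (a j) (b j) *: e j).
  pose k : K := exist _ (x, (m, (a, b))) (conj x1 sf).
  exists k => //.
  have vag : va k g = \sum_(i < M) lam i * va k (f i).
    rewrite /va/= !linear_sum/=.
    under [RHS]eq_bigr => i _ do rewrite linear_sum mulr_sumr.
    rewrite exchange_big/=; apply: eq_bigr => j _.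
    have [/(_ j)[aj [abj bj]] _ _ _] := sf.
    rewrite {1}/Fint (Rintegral_sum mU)//; last 3 first.
    - by move=> i _; exact: L1_Z.
    - exact: measurable_itv1.
    - exact: itv1_unit.
    rewrite (dualZ x) mulr_suml; apply: eq_bigr => i _.
    rewrite RintegralZl//; last 2 first.
    - exact: measurable_itv1.
    - by apply: (L1_integrable mU) => //; [exact: measurable_itv1|exact: itv1_unit].
    by rewrite [x (_ *: _)](dualZ x) mulrA.
  have : c1 < va k g by rewrite /va/= xE -E.
  rewrite vag (bigID (fun i : 'I_M => A k i))/= => h.
  have h1 : \sum_(i < M | A k i) lam i * va k (f i) <= B * hit_mass A k M lam.
    rewrite /hit_mass mulr_sumr; apply: ler_sum => i _; rewrite mulrC ler_wpM2r//.
    by rewrite (le_trans (ler_norm _))// (le_trans (va_le _ _ _)).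
  have h2 : \sum_(i < M | ~~ A k i) lam i * va k (f i) <= delta.
    apply: (@le_trans _ _ (\sum_(i < M | ~~ A k i) lam i * delta)).
      apply: ler_sum => i; rewrite -ltNge => /ltW ?; exact: ler_wpM2l.
    rewrite -mulr_suml ler_piMl ?(ltW delta0)// -l1 [leRHS](bigID (fun i : 'I_M => A k i))/=.
    by rewrite lerDr sumr_ge0.
  rewrite ler_pdivrMr// mulrC; move: h h1 h2; rewrite /delta; lra.
have [|N [Ninc Nk]] := ptak _ sub; first by rewrite divr_gt0.
pose k m := sval (cid (Nk m)).
have kP m i : (i < m)%N -> meets A (k m) (N i) (N i.+1).
  by rewrite /k; case: cid => /= k0; apply.
pose xs m := (sval (k m)).1; pose mm m := (sval (k m)).2.1.
pose a m := (sval (k m)).2.2.1; pose b m := (sval (k m)).2.2.2.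
have xs1 m : `|xs m| <= 1 by rewrite /xs; case: (k m) => ? [].
have sf m : sorted_family (mm m) (a m) (b m).
  by rewrite /mm /a /b; case: (k m) => ? [].
have a01 m j : 0 <= a m j /\ a m j <= 1.
  by have [/(_ j)[? [? ?]] _ _ _] := sf m; split => //; lra.
have b01 m j : 0 <= b m j /\ b m j <= 1.
  by have [/(_ j)[? [? ?]] _ _ _] := sf m; split => //; lra.
have bound01 (u : nat -> R) : (forall m, 0 <= u m /\ u m <= 1) -> forall m, `|u m| <= 1.
  by move=> h m; rewrite ger0_norm; have [] := h m.
(* The test [k m] meets the first m blocks. The ultralimits of the endpoints and of the functionals
   on X form a limit test. *)
pose al j := ulim (fun m => a m j); pose be j := ulim (fun m => b m j).
have acv j : a m j @[m --> nat_ultra] --> al j.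
  by apply: (@ulim_cvg _ _ 1); apply: bound01.
have bcv j : b m j @[m --> nat_ultra] --> be j.
  by apply: (@ulim_cvg _ _ 1); apply: bound01.
have lim01 (u : nat -> R) : (forall m, 0 <= u m /\ u m <= 1) -> 0 <= ulim u /\ ulim u <= 1.
  move=> h; have h1 := bound01 u h; split.
    by apply: (ulim_ge h1); apply: nearW => m; have [] := h m.
  by apply: (ulim_le h1); apply: nearW => m; have [] := h m.
have al01 j : 0 <= al j /\ al j <= 1 by apply: lim01.
have be01 j : 0 <= be j /\ be j <= 1 by apply: lim01.
have albe j : al j <= be j.
  rewrite -subr_ge0 /al /be; have E := @ulim_lin R (-1) (fun m => a m j) (fun m => b m j) 1 1.
  rewrite addrC -mulN1r -E; [|by apply: bound01|by apply: bound01].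
  apply: (@ulim_ge _ _ 2).
    move=> m; rewrite mulN1r; have [? ?] := a01 m j; have [? ?] := b01 m j.
    by rewrite ler_norml; apply/andP; split; lra.
  apply: nearW => m; have [/(_ j)[? [? ?]] _ _ _] := sf m.
  by rewrite mulN1r addrC subr_ge0.
have xsB m y : `|xs m y| <= `|y| by rewrite (le_trans (dual_le _ _))// ler_piMl.
have [|||xinf [xinfE xinf1]] := @dual_of R X (fun y => ulim (fun m => xs m y)) 1.
- move=> t y z; rewrite -(ulim_lin t (xsB^~ y) (xsB^~ z)); congr ulim.
  by apply/funext => m; exact: (linearP (xs m)).
- by move=> y; rewrite mul1r; apply: ulim_norm.
- by [].
have xcv y : xs m y @[m --> nat_ultra] --> xinf y.
  by rewrite xinfE; apply: (@ulim_cvg _ _ `|y|).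
have Fcv g j : L1 U g -> Fint g (a m j) (b m j) @[m --> nat_ultra] --> Fint g (al j) (be j).
  move=> Lg.
  have E x y : 0 <= x -> x <= y -> y <= 1 -> Fint g x y = Fint g 0 y - Fint g 0 x.
    by move=> x0 xy y1; rewrite (Fint_add Lg (lexx 0) x0 xy y1) addrC addKr.
  rewrite E ?(albe j)//; [|by have [] := al01 j|by have [] := be01 j].
  rewrite (_ : (fun m => _) = fun m => Fint g 0 (b m j) - Fint g 0 (a m j)); last first.
    by apply/funext => m; have [/(_ j)[? [? ?]] _ _ _] := sf m; rewrite E.
  have [? ?] := al01 j; have [? ?] := be01 j.
  by apply: cvgB; apply: Fint_continuous.
have sumcv g (y : nat -> dual X) (yinf : dual X) J0 M : L1 U g ->
    (forall z, y m z @[m --> nat_ultra] --> yinf z) ->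
    y m (\sum_(j < M) Fint g (a m (J0 + j)%N) (b m (J0 + j)%N) *: e (J0 + j)%N) @[m --> nat_ultra] -->
    yinf (\sum_(j < M) Fint g (al (J0 + j)%N) (be (J0 + j)%N) *: e (J0 + j)%N).
  move=> Lg ycv; rewrite linear_sum/=.
  rewrite (_ : (fun m => _) = fun m => \sum_(j < M) Fint g (a m (J0 + j)%N) (b m (J0 + j)%N) * y m (e (J0 + j)%N)); last first.
    by apply/funext => m; rewrite linear_sum/=; apply: eq_bigr => j _; exact: dualZ.
  apply: cvg_sumr => j; rewrite [X in _ --> X](dualZ yinf).
  by apply: cvgM; [exact: Fcv|exact: ycv].
have limB n J0 M : `|\sum_(j < M) Fint (f n) (al (J0 + j)%N) (be (J0 + j)%N) *: e (J0 + j)%N| <= B.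
  have [y [y1 <-]] := norming_functional (\sum_(j < M) Fint (f n) (al (J0 + j)%N) (be (J0 + j)%N) *: e (J0 + j)%N).
  have ycst z : y z @[m --> nat_ultra] --> y z by apply: cvg_cst.
  have cv := sumcv (f n) (fun=> y) y J0 M (Lf n) ycst.
  rewrite -(cvg_lim _ cv)//; apply: limr_le; first by apply: cvgP cv.
  apply: nearW => m; rewrite (le_trans (ler_norm _))// (le_trans (dual_le _ _))//.
  apply: (@le_trans _ _ (`|\sum_(j < M) Fint (f n) (a m (J0 + j)%N) (b m (J0 + j)%N) *: e (J0 + j)%N|)).
    by rewrite ler_piMl.
  rewrite (sum_shift_norm (fun j => Fint (f n) (a m j) (b m j))).
  apply: le_trans (fB n); apply: Fint_family_le => //.
    by move=> j; have [? ?] := a01 m (J0 + j)%N; have [? ?] := b01 m (J0 + j)%N.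
  exact: sorted_family_trivIset (sf m).
(* Beyond [J0] the limit functional is so small that the bound [B] on the limit sums leaves at most
   delta / 8, for every [n]. *)
have [|J0 xJ0] := reflexive_shrinking esym rX xinf (eps := delta / 8 / B).
  by rewrite !divr_gt0.
have head0 : xinf (\sum_(j < J0) Fint (f n) (al (0 + j)%N) (be (0 + j)%N) *: e (0 + j)%N) @[n --> \oo] --> (0 : R).
  rewrite (_ : (fun n => _) = fun n => \sum_(j < J0) Fint (f n) (al (0 + j)%N) (be (0 + j)%N) * xinf (e (0 + j)%N)); last first.
    by apply/funext => n; rewrite linear_sum/=; apply: eq_bigr => j _; exact: dualZ.
  rewrite [X in _ --> X](_ : 0 = \sum_(j < J0) (0 : R) * xinf (e (0 + j)%N)); last first.
    by rewrite big1// => j _; rewrite mul0r.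
  apply: cvg_sumr => j; apply: cvgM; last exact: cvg_cst.
  by have [? ?] := al01 (0 + j)%N; have [? ?] := be01 (0 + j)%N; apply: f0.
have d4 : 0 < delta / 4 by rewrite divr_gt0.
have /cvgrPdist_le/(_ _ d4)[i0 _ Hi0] := head0.
have Ngt i : (i <= N i)%N by elim: i => // i IH; rewrite (leq_ltn_trans IH).
(* In one block far enough out for [head0], a single [n] is hit by the tests [k m] for almost all m
   along the ultrafilter. *)
have [|n /andP[nN _] nU] := @ultra_pigeonhole (fun m n => A (k m) n) (N i0) (N i0.+1).
  apply: near_ultra; exists i0.+1 => // m /= im.
  by have [n /andP[nN An]] := kP m i0 im; exists n.
have headn := Hi0 n (leq_trans (Ngt i0) nN); rewrite /= sub0r normrN in headn.
have [eta eta0 short] := short_intervals esym rX (Lf n) d4.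
(* By the bound on sorted lengths, the intervals from index [J1] on have length at most eta, for all
   m at once. *)
pose J1 := (Num.truncn eta^-1 + J0)%N.
have tail m : `|\sum_(j < mm m) Fint (f n) (a m (J1 + j)%N) (b m (J1 + j)%N) *: e (J1 + j)%N| <= delta / 4.
  rewrite (sum_shift_norm (fun j => Fint (f n) (a m j) (b m j))); apply: short.
  - by move=> j; have [/(_ (J1 + j)%N) + _ _ _] := sf m.
  - move=> j; have [/(_ (J1 + j)%N)[? [? ?]] /(_ (J1 + j)%N) h _ _] := sf m.
    rewrite -ler_pdivlMr// in h; apply: le_trans h _; rewrite mul1r.
    rewrite -[leRHS]invrK lef_pV2 ?posrE ?invr_gt0//.
    apply: le_trans (ltW (truncnS_gt _)) _; rewrite ler_nat ltnS /J1 -addnA.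
    exact: leq_addr.
  - exact: sorted_family_trivIset (sf m).
have split_va m : va (k m) (f n) = xs m (\sum_(j < J1) Fint (f n) (a m (0 + j)%N) (b m (0 + j)%N) *: e (0 + j)%N) +
    xs m (\sum_(j < mm m) Fint (f n) (a m (J1 + j)%N) (b m (J1 + j)%N) *: e (J1 + j)%N).
  rewrite -linearD/= /va -/(xs m) -/(mm m) -/(a m) -/(b m); congr (xs m _).
  pose G (j : nat) := Fint (f n) (a m j) (b m j) *: e j.
  transitivity (\sum_(j < J1 + mm m) G j); last by rewrite big_split_ord.
  rewrite (big_ord_widen _ G (leq_addl J1 (mm m))) big_mkcond/=.
  apply: eq_bigr => j _; case: ltnP => // mj; rewrite /G.
  have [_ _ /(_ _ mj) -> _] := sf m.
  by rewrite Fint_nil// scale0r.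
have cvh := sumcv (f n) xs xinf 0%N J1 (Lf n) xcv.
(* In the limit the first J1 coordinates keep at least 3/4 of delta, while the first J0 give at most
   delta / 4 and the remaining ones at most delta / 8. *)
have low : delta - delta / 4 <= xinf (\sum_(j < J1) Fint (f n) (al (0 + j)%N) (be (0 + j)%N) *: e (0 + j)%N).
  rewrite -(cvg_lim _ cvh)//; apply: limr_ge; first by apply: cvgP cvh.
  apply: filterS nU => m; rewrite /A split_va => h.
  have := le_trans (ler_norm _) (le_trans (xsB m _) (tail m)); lra.
have J01 : (J0 <= J1)%N by rewrite leq_addl.
move: low; rewrite -(subnKC J01) big_split_ord/= linearD/= => low.
have mid : `|xinf (\sum_(j < J1 - J0) Fint (f n) (al (J0 + j)%N) (be (J0 + j)%N) *: e (J0 + j)%N)| <= delta / 8.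
  have := xJ0 J1 (fun j => Fint (f n) (al j) (be j)).
  have -> : \sum_(J0 <= j < J1) Fint (f n) (al j) (be j) *: e j =
      \sum_(j < J1 - J0) Fint (f n) (al (J0 + j)%N) (be (J0 + j)%N) *: e (J0 + j)%N.
    rewrite -{1}[J0]add0n big_addn big_mkord; apply: eq_bigr => j _.
    by rewrite addnC.
  move=> /le_trans; apply.
  rewrite (@le_trans _ _ (delta / 8 / B * B))//; last by rewrite divfK ?gt_eqF.
  by rewrite ler_wpM2l// ltW// !divr_gt0.
have h1 := le_trans (ler_norm _) mid; have h2 := le_trans (ler_norm _) headn.
move: low h1 h2 delta0; clear.
set p := xinf _; set q := xinf _; lra.
Qed.

End weakly_null.

Lemma positive_lower_bound {R : realType} (s : seq R) : all (fun x => 0 < x) s ->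
  exists2 w : R, 0 < w & forall x, x \in s -> w <= x.
Proof.
elim: s => [_|x s IH /= /andP[x0 /IH[w w0 ws]]]; first by exists 1.
exists (Num.min x w); first by rewrite lt_min x0.
move=> y; rewrite inE => /predU1P[->|/ws wy]; first by rewrite ge_min lexx.
by rewrite ge_min wy orbT.
Qed.

(** * Density of the primitive functionals *)

Section tents.
Context {R : realType}.
Local Notation U := (@unit_interval R).
Local Notation mu := (@lebesgue_rV R 1).
Let mU := @measurable_unit_interval R.

Definition tent (t w : R) : 'rV[R]_1 -> R := spike (0 : 'rV[R]_0) 0 t w.

Lemma vol_rV0 (u v : 'rV[R]_0) : vol u v = 1.
Proof. by rewrite /vol big_ord0. Qed.

Lemma L1_tent t w : L1 U (tent t w).
Proof. exact: L1_spike. Qed.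

Lemma rV_cons_itv1 (x y : R) (u v : 'rV[R]_0) : box (rV_cons (x, u)) (rV_cons (y, v)) = itv1 x y.
Proof. by congr box; apply/rowP => i; rewrite (ord1 i) rV_cons0 mxE. Qed.

Lemma Fint_tent t w s : 0 < w -> w <= t -> 0 <= s -> s <= 1 ->
  Fint (tent t w) 0 s =
  w^-1 * (Num.max 0 (Num.min t s - (t - w)) - Num.max 0 (Num.min (t + w) s - t)).
Proof.
move=> w0 wt s0 s1.
rewrite /Fint /tent (Rintegral_spike _ _ mU); [|exact: measurable_itv1|exact: itv1_unit].
rewrite vol_rV0 mulr1 /left_slab /right_slab !rV_cons_itv1.
have cE x y : 0 <= x -> capvol (itv1 x y) (itv1 0 s) = Num.max 0 (Num.min y s - x).
  move=> x0; rewrite /capvol itv1I (max_l x0).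
  have [h|h] := leP (Num.min y s) x.
    by rewrite (itv1_empty h) measure0 max_l// subr_le0.
  by rewrite lebesgue_itv1 ?(ltW h)// max_r// subr_ge0 ltW.
by rewrite !cE//; lra.
Qed.

Lemma Fint_tent_center t w : 0 < w -> w <= t -> t <= 1 -> Fint (tent t w) 0 t = 1.
Proof.
move=> w0 wt t1; rewrite Fint_tent//; last lra.
rewrite minxx (min_r (y := t)); last lra.
rewrite subrr maxxx subr0 opprB addrC subrK max_r ?(ltW w0)// mulVf// gt_eqF//.
Qed.

Lemma Fint_tent_far t w s : 0 < w -> w <= t -> 0 <= s -> s <= 1 -> w <= `|s - t| ->
  Fint (tent t w) 0 s = 0.
Proof.
move=> w0 wt s0 s1 h; rewrite Fint_tent//.
have [st|ts] : s <= t \/ t < s by case: (leP s t); auto.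
  rewrite distrC ger0_norm ?subr_ge0// in h.
  rewrite (min_r st) (min_r (y := s)); last lra.
  by rewrite !max_l; first rewrite subrr mulr0; lra.
rewrite gtr0_norm ?subr_gt0// in h.
rewrite (min_l (ltW ts)) (min_l (x := t + w)); last lra.
rewrite (_ : t - (t - w) = w); last lra.
by rewrite (_ : t + w - t = w) ?subrr ?mulr0//; lra.
Qed.

End tents.

Section gaps.
Context {R : realType} {X : normedModType R} (e : nat -> X).
Hypothesis esym : symmetric_basis e.
Hypothesis rX : reflexive_space X.
Local Notation U := (@unit_interval R).
Local Notation mu := (@lebesgue_rV R 1).
Local Notation JFn := (JF_norm e U).
Let mU := @measurable_unit_interval R.
Context (J : completeNormedModType R) (iota : ('rV[R]_1 -> R) -> J).
Hypothesis JP : is_JF e U iota.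
Variable L : dual J.

Lemma Fint_restrict (f : 'rV[R]_1 -> R) u v a b : Fint (f \_ (itv1 u v)) a b = Fint f (Num.max a u) (Num.min b v).
Proof. by rewrite /Fint -Rintegral_mkcondr itv1I. Qed.

Lemma L1_gap f u v : L1 U f -> L1 U (f \_ (itv1 u v)).
Proof. by move=> Lf; apply: L1_restrict => //; exact: measurable_itv1. Qed.

(** The integral over the interval vanishes because the property is applied to the gaps between
    zeros of a primitive. *)
Definition small_on (eps u v : R) := forall f, L1 U f -> Fint f u v = 0 ->
  JFn (f \_ (itv1 u v)) <= 1 -> `|L (iota (f \_ (itv1 u v)))| <= eps.

Lemma small_on_mono eps u v u' v' : u <= u' -> v' <= v -> small_on eps u v -> small_on eps u' v'.
Proof.
move=> uu' vv' suv f Lf f0 f1.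
have E : (f \_ (itv1 u' v')) \_ (itv1 u v) = f \_ (itv1 u' v').
  apply/funext => x; rewrite {1}/patch; case: ifPn => // /negP nx.
  rewrite /patch; case: ifPn => // /set_mem xu; exfalso; apply: nx; apply/mem_set.
  exact: (itv1_sub uu' vv').
rewrite -E; apply: suv; rewrite ?E//; first exact: L1_gap.
by rewrite Fint_restrict max_r// min_r.
Qed.

Lemma iota_Z a f : L1 U f -> iota (fun x => a * f x) = a *: iota f.
Proof.
move=> Lf; have := iota_lin JP a Lf (L1_0 _).
have -> : iota (fun=> 0) = 0.
  apply/eqP; rewrite -normr_le0 (iota_norm JP (L1_0 _)).
  apply: JF_norm_le => m T pT tT; rewrite big1 ?normr0// => j _.
  by rewrite Rintegral_cst ?mul0r ?scale0r//; exact: measurable_parallelepiped.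
by rewrite addr0 => <-; congr iota; apply/funext => x; rewrite addr0.
Qed.

(** Otherwise each interval carries a normalised function of integral zero at which [L] exceeds
    [eps]. A fixed (a, b) eventually misses or contains the shrinking interval, so the integrals
    over it become zero, against [pointwise_null_weakly_null]. *)
Lemma shrinking_small (u v : nat -> R) (eps : R) : 0 < eps ->
  (forall n, 0 <= u n /\ v n <= 1) ->
  (forall a b, \forall n \near \oo, Num.min b (v n) <= Num.max a (u n) \/ (a <= u n /\ v n <= b)) ->
  exists n, small_on eps (u n) (v n).
Proof.
move=> eps0 uv C; apply: contrapT => /forallNP nsm.
have ex n : exists f, [/\ L1 U f, Fint f (u n) (v n) = 0,
    JFn (f \_ (itv1 (u n) (v n))) <= 1 & eps < `|L (iota (f \_ (itv1 (u n) (v n))))|].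
  have /existsNP[f /not_implyP[Lf /not_implyP[f0 /not_implyP[f1 /negP]]]] := nsm n.
  by rewrite -ltNge => h; exists f.
pose f n := sval (cid (ex n)).
have fP n : [/\ L1 U (f n), Fint (f n) (u n) (v n) = 0,
    JFn (f n \_ (itv1 (u n) (v n))) <= 1 & eps < `|L (iota (f n \_ (itv1 (u n) (v n))))|].
  by rewrite /f; case: cid.
pose sg n : R := (-1) ^+ (L (iota (f n \_ (itv1 (u n) (v n)))) < 0)%R.
pose g n x := sg n * (f n \_ (itv1 (u n) (v n))) x.
have Lg0 n : L1 U (f n \_ (itv1 (u n) (v n))) by have [? _ _ _] := fP n; exact: L1_gap.
apply: (pointwise_null_weakly_null esym rX JP (f := g) (B := 1) (L := L) (c := eps)) => //.
- by move=> n; apply: L1_Z.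
- move=> n; have [_ _ h _] := fP n.
  by rewrite (le_trans (JF_norm_Z esym mU _ _))// normr_sign mul1r.
- move=> a b a0 ab b1; apply: cvg_near_cst; have := C a b; apply: filterS => n h.
  rewrite /Fint RintegralZl//; last 2 first.
  + exact: measurable_itv1.
  + by apply: (L1_integrable mU) => //; [exact: measurable_itv1|exact: itv1_unit].
  rewrite -/(Fint _ a b) Fint_restrict; case: h => [h|[h1 h2]].
    by rewrite Fint_nil// mulr0.
  by rewrite max_r// min_r//; have [_ -> _ _] := fP n; rewrite mulr0.
- move=> n; have [_ _ _ h] := fP n.
  rewrite /g iota_Z// (dualZ L) /sg -normrEsign; exact: ltW.
Qed.

Lemma harmonic_lt (eps : R) : 0 < eps -> \forall n \near \oo, n.+1%:R^-1 < eps.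
Proof.
move=> eps0; exists (Num.truncn eps^-1) => // n /= hn.
rewrite invf_plt ?posrE//; apply: lt_le_trans (truncnS_gt _) _.
by rewrite ler_nat ltnS.
Qed.

(** The intervals have [t] as an endpoint, not inside: thus a fixed interval eventually contains or
    misses them. *)
Lemma small_right eps t : 0 < eps -> 0 <= t -> t < 1 ->
  exists r, [/\ 0 < r, t + r <= 1 & small_on eps t (t + r)].
Proof.
move=> eps0 t0 t1; pose r n : R := (1 - t) * n.+1%:R^-1.
have r0 n : 0 < r n by rewrite mulr_gt0 ?invr_gt0// subr_gt0.
have rle n : r n <= 1 - t by rewrite ler_piMr ?subr_ge0 ?(ltW t1)// invf_le1// ler1n.
have rlt d : 0 < d -> \forall n \near \oo, r n < d.
  move=> d0; have : 0 < d / (1 - t) by rewrite divr_gt0// subr_gt0.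
  move=> /harmonic_lt; apply: filterS => n; rewrite ltr_pdivlMr ?subr_gt0//.
  by rewrite mulrC.
have [||n sn] := @shrinking_small (fun=> t) (fun n => t + r n) eps eps0.
- by move=> n; split => //; have := rle n; lra.
- move=> a b; have [at_|ta] : a <= t \/ t < a by case: (leP a t); auto.
    have [bt|tb] : b <= t \/ t < b by case: (leP b t); auto.
      by apply: nearW => n; left; rewrite ge_min !le_max bt orbT.
    have := rlt (b - t); rewrite subr_gt0 => /(_ tb); apply: filterS => n h; right; split => //; lra.
  have := rlt (a - t); rewrite subr_gt0 => /(_ ta); apply: filterS => n h; left.
  apply: (@le_trans _ _ (t + r n)); first by rewrite ge_min lexx orbT.
  by apply: (@le_trans _ _ a); [lra|rewrite le_max lexx].
- by exists (r n); split => //; have := rle n; lra.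
Qed.

Lemma small_left eps t : 0 < eps -> 0 < t -> t <= 1 ->
  exists r, [/\ 0 < r, 0 <= t - r & small_on eps (t - r) t].
Proof.
move=> eps0 t0 t1; pose r n : R := t * n.+1%:R^-1.
have r0 n : 0 < r n by rewrite mulr_gt0 ?invr_gt0.
have rle n : r n <= t by rewrite ler_piMr ?(ltW t0)// invf_le1// ler1n.
have rlt d : 0 < d -> \forall n \near \oo, r n < d.
  move=> d0; have : 0 < d / t by rewrite divr_gt0.
  move=> /harmonic_lt; apply: filterS => n; rewrite ltr_pdivlMr//.
  by rewrite mulrC.
have [||n sn] := @shrinking_small (fun n => t - r n) (fun=> t) eps eps0.
- by move=> n; split => //; have := rle n; lra.
- move=> a b; have [tb|bt] : t <= b \/ b < t by case: (leP t b); auto.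
    have [ta|at_] : t <= a \/ a < t by case: (leP t a); auto.
      by apply: nearW => n; left; rewrite ge_min !le_max ta !orbT.
    have := rlt (t - a); rewrite subr_gt0 => /(_ at_); apply: filterS => n h; right; split => //; lra.
  have := rlt (t - b); rewrite subr_gt0 => /(_ bt); apply: filterS => n h; left.
  apply: (@le_trans _ _ b); first by rewrite ge_min lexx.
  by apply: (@le_trans _ _ (t - r n)); [lra|rewrite le_max lexx orbT].
- by exists (r n); split => //; have := rle n; lra.
Qed.

Definition small_partition (eps s : R) (N : nat) (tau : nat -> R) :=
  [/\ tau 0%N = 0, tau N = s & forall i, (i < N)%N ->
    tau i < tau i.+1 /\ small_on eps (tau i) (tau i.+1)].

Lemma small_partition_extend eps s s' N tau : s < s' -> small_on eps s s' ->
  small_partition eps s N tau -> exists N' tau', small_partition eps s' N' tau'.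
Proof.
move=> ss' sm [t0 tN tS].
exists N.+1, (fun i => if (i <= N)%N then tau i else s'); split => //.
  by rewrite ltnn.
move=> i iN1; have [->|iN] := eqVneq i N; first by rewrite leqnn ltnn tN.
have {iN1}iN : (i < N)%N by rewrite ltn_neqAle iN -ltnS.
by rewrite iN (ltnW iN); exact: tS.
Qed.

(** Consider the supremum of the points that such partitions reach. It is itself reached, thanks to
    [small_left], and by [small_right] it cannot be below 1. *)
Lemma small_partition_exists eps : 0 < eps -> exists N tau, small_partition eps 1 N tau.
Proof.
move=> eps0.
pose S := [set s : R | 0 <= s <= 1 /\ exists N tau, small_partition eps s N tau].
have S0 : S 0 by split; [rewrite lexx ler01|exists 0%N, (fun=> 0); split].
have hS : has_sup S by split; [exists 0|exists 1 => s [/andP[]]].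
pose s := sup S.
have s0 : 0 <= s by apply: sup_upper_bound.
have s1 : s <= 1 by apply: ge_sup; [exists 0|move=> x [/andP[]]].
have Ss : S s.
  have [s00|sn0] := eqVneq s 0; first by rewrite s00.
  have sp : 0 < s by rewrite lt_neqAle eq_sym sn0.
  have [r [r0 sr sm]] := small_left eps0 sp s1.
  have [x Sx xs] := sup_adherent r0 hS.
  have [xE|xns] := eqVneq x s; first by rewrite -xE.
  have xlt : x < s by rewrite lt_neqAle xns sup_upper_bound.
  have [_ [N [tau part]]] := Sx.
  split; first by rewrite s0 s1.
  apply: (small_partition_extend xlt _ part); apply: small_on_mono sm => //.
  exact: ltW.
have [s1E|sn1] := eqVneq s 1; first by have [_] := Ss; rewrite s1E.
have slt : s < 1 by rewrite lt_neqAle sn1.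
have [r [r0 sr sm]] := small_right eps0 s0 slt.
have : S (s + r).
  split; first by rewrite sr andbT addr_ge0// ltW.
  have [_ [N [tau part]]] := Ss.
  by apply: (small_partition_extend _ sm part); rewrite ltrDl.
by move=> /(sup_upper_bound hS); rewrite -/s gerDl leNgt r0.
Qed.

End gaps.

Section surgery.
Context {R : realType} {X : normedModType R} (e : nat -> X).
Hypothesis esym : symmetric_basis e.
Local Notation U := (@unit_interval R).
Local Notation JFn := (JF_norm e U).
Let mU := @measurable_unit_interval R.

Variables (N : nat) (tau : nat -> R) (f : 'rV[R]_1 -> R).
Hypothesis tau0 : tau 0%N = 0.
Hypothesis tauN : tau N = 1.
Hypothesis tauS : forall i, (i < N)%N -> tau i < tau i.+1.
Hypothesis Lf : L1 U f.
Hypothesis Ftau : forall i, (i <= N)%N -> Fint f 0 (tau i) = 0.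

Lemma FintE a b : 0 <= a -> a <= b -> b <= 1 -> Fint f a b = Fint f 0 b - Fint f 0 a.
Proof. by move=> a0 ab b1; rewrite (Fint_add Lf (lexx 0) a0 ab b1) addrC addKr. Qed.

Lemma tau_mono i j : (i <= j)%N -> (j <= N)%N -> tau i <= tau j.
Proof.
move=> /subnK <-; elim: (j - i)%N => // k IH kN; rewrite addSn in kN *.
by rewrite (le_trans (IH (ltnW kN)))// ltW// tauS.
Qed.

Lemma tau_ge0 i : (i <= N)%N -> 0 <= tau i.
Proof. by move=> iN; rewrite -tau0; exact: tau_mono. Qed.

Lemma tau_le1 i : (i <= N)%N -> tau i <= 1.
Proof. by move=> iN; rewrite -tauN; exact: tau_mono. Qed.

Definition in_gap (i : nat) (x : R) := tau i < x < tau i.+1.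

Lemma tau_locate x : 0 <= x -> x <= 1 ->
  (exists2 j, (j <= N)%N & x = tau j) \/ (exists i : 'I_N, in_gap i x).
Proof.
move=> x0; rewrite -tauN => xN.
suff H n : (n <= N)%N -> x <= tau n ->
    (exists2 j, (j <= N)%N & x = tau j) \/ (exists i : 'I_N, in_gap i x) by exact: H (leqnn N) xN.
elim: n => [_|n IH nN].
  by rewrite tau0 => x0'; left; exists 0%N => //; rewrite tau0; apply/eqP; rewrite eq_le x0 x0'.
have [xn _|nx] := leP x (tau n); first exact: IH (ltnW nN) xn.
rewrite le_eqVlt => /predU1P[->|xlt]; first by left; exists n.+1.
by right; exists (Ordinal nN); rewrite /in_gap nx xlt.
Qed.

Lemma in_gap_uniq (i j : 'I_N) x : in_gap i x -> in_gap j x -> i = j.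
Proof.
move=> /andP[ix xi] /andP[jx xj]; apply: val_inj; apply/eqP; rewrite eqn_leq.
apply/andP; split; rewrite leqNgt; apply/negP => h.
  by have := lt_trans (le_lt_trans (tau_mono h (ltnW (ltn_ord i))) ix) xj; rewrite ltxx.
by have := lt_trans (le_lt_trans (tau_mono h (ltnW (ltn_ord j))) jx) xi; rewrite ltxx.
Qed.

Lemma in_gap_tau (i : 'I_N) j : (j <= N)%N -> ~~ in_gap i (tau j).
Proof.
move=> jN; apply/negP => /andP[h1 h2].
have [ji|ij] := leqP j i.
  by have := tau_mono ji (ltnW (ltn_ord i)); rewrite leNgt h1.
by have := tau_mono ij jN; rewrite leNgt h2.
Qed.

(** The primitive of [f] restricted to gap [i]; it is zero outside because the primitive of [f]
    vanishes at both ends of the gap. *)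
Definition gap_value (i : nat) (x : R) : R := if in_gap i x then Fint f 0 x else 0.

Lemma Fint_gap i a b : (i < N)%N -> 0 <= a -> a <= b -> b <= 1 ->
  Fint (f \_ (itv1 (tau i) (tau i.+1))) a b = gap_value i b - gap_value i a.
Proof.
move=> iN a0 ab b1; rewrite Fint_restrict.
have ti0 := tau_ge0 (ltnW iN); have ti1 := tau_le1 iN; have tiS := tauS iN.
have Fi := Ftau (ltnW iN); have FiS := Ftau iN.
rewrite /gap_value /in_gap; move: (tau i) (tau i.+1) ti0 ti1 tiS Fi FiS => u v u0 v1 uv Fu Fv.
have [bu|ub] := leP b u.
  rewrite Fint_nil; last by rewrite ge_min le_max bu !orbT.
  by rewrite /= (ltNge u a) (le_trans ab bu) subrr.
have [va|av] := leP v a.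
  rewrite Fint_nil; last by rewrite ge_min !le_max va orbT.
  by rewrite !andbF (ltNge b v) (le_trans va ab) /= subrr.
have E : Fint f (Num.max a u) (Num.min b v) = Fint f 0 (Num.min b v) - Fint f 0 (Num.max a u).
  apply: FintE; first by rewrite le_max a0.
    by rewrite le_min !ge_max ab (ltW ub) (ltW av) (ltW uv).
  by rewrite ge_min b1.
rewrite E andbT /=; congr (_ - _).
  by have [bv|vb] := leP v b; rewrite ?Fv.
by have [au|ua] := leP a u; rewrite ?Fu.
Qed.

Definition glued (P : pred 'I_N) : 'rV[R]_1 -> R :=
  fun x => \sum_(i < N | P i) (f \_ (itv1 (tau i) (tau i.+1))) x.

Definition glued_value (P : pred 'I_N) (x : R) : R := \sum_(i < N | P i) gap_value i x.

Lemma L1_glued P : L1 U (glued P).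
Proof. by apply: (L1_sum mU) => i _; exact: L1_gap. Qed.

Lemma Fint_glued P a b : 0 <= a -> a <= b -> b <= 1 ->
  Fint (glued P) a b = glued_value P b - glued_value P a.
Proof.
move=> a0 ab b1; rewrite {1}/Fint (Rintegral_sum mU)//; last 3 first.
- by move=> i _; exact: L1_gap.
- exact: measurable_itv1.
- exact: itv1_unit.
rewrite /glued_value -sumrB; apply: eq_bigr => i _.
exact: (Fint_gap (ltn_ord i) a0 ab b1).
Qed.

Lemma glued_value_in P (i : 'I_N) x : in_gap i x ->
  glued_value P x = if P i then Fint f 0 x else 0.
Proof.
move=> ix; have off j : j != i -> gap_value j x = 0.
  move=> ji; rewrite /gap_value; case: ifPn => // jx.
  by rewrite (in_gap_uniq ix jx) eqxx in ji.
rewrite /glued_value; case: ifPn => Pi.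
  rewrite (bigD1 i)//= big1 ?addr0; first by rewrite /gap_value ix.
  by move=> j /andP[_ /off].
by rewrite big1// => j Pj; apply: off; apply: contraNneq Pi => <-.
Qed.

Lemma glued_value_tau P j : (j <= N)%N -> glued_value P (tau j) = 0.
Proof.
move=> jN; rewrite /glued_value big1// => i _.
by rewrite /gap_value (negPf (in_gap_tau i jN)).
Qed.

Lemma glued_value_dichotomy P x : 0 <= x -> x <= 1 ->
  glued_value P x = Fint f 0 x \/ exists i : 'I_N, in_gap i x /\ ~~ P i.
Proof.
move=> x0 x1; have [[j jN ->]|[i ix]] := tau_locate x0 x1.
  by left; rewrite glued_value_tau// Ftau.
rewrite (glued_value_in _ ix); case: ifPn => Pi; first by left.
by right; exists i.
Qed.

Lemma glued_valueT x : 0 <= x -> x <= 1 -> glued_value xpredT x = Fint f 0 x.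
Proof. by move=> x0 x1; have [//|[i []]] := glued_value_dichotomy xpredT x0 x1. Qed.

(* Erasing f on some gaps only shortens the intervals of integration. *)
Lemma JF_norm_glued P : JFn (glued P) <= JFn f.
Proof.
apply: (JF_norm_dominated esym mU Lf) => T /parallelepiped_itv1[a [b [a0 ab b1 ->]]].
have b0 : 0 <= b by rewrite (le_trans a0)// ltW.
have a1 : a <= 1 by rewrite (le_trans _ b1)// ltW.
rewrite -/(Fint (glued P) a b) (Fint_glued P a0 (ltW ab) b1).
have zero : glued_value P b - glued_value P a = 0 -> exists T' : set 'rV[R]_1,
    [/\ cell U T', T' `<=` itv1 a b &
      glued_value P b - glued_value P a = \int[lebesgue_rV 1]_(x in T') f x].
  by move=> ->; exists set0; split => //; [left|rewrite Rintegral_set0].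
have sub a' b' : a <= a' -> a' <= b' -> b' <= b ->
    glued_value P b - glued_value P a = Fint f 0 b' - Fint f 0 a' ->
    exists T' : set 'rV[R]_1,
    [/\ cell U T', T' `<=` itv1 a b &
      glued_value P b - glued_value P a = \int[lebesgue_rV 1]_(x in T') f x].
  move=> aa' ab' bb' ->; exists (itv1 a' b'); split.
  - by apply: cell_itv1; [exact: le_trans a0 _|exact: le_trans b1].
  - exact: itv1_sub.
  - by apply: Logic.eq_sym; apply: FintE => //; [exact: le_trans a0 _|exact: le_trans b1].
(* An endpoint in an erased gap is moved to the end of that gap lying inside (a, b), where the
   primitive of [f] vanishes. When there is no room for this, or both endpoints are in erased gaps,
   the integral is 0. *)
have [aE|[i [ia nPi]]] := glued_value_dichotomy P a0 a1;
  have [bE|[j [jb nPj]]] := glued_value_dichotomy P b0 b1.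
- by apply: (sub a b); [exact: lexx|exact: ltW|exact: lexx|rewrite aE bE].
- have b00 : glued_value P b = 0 by rewrite (glued_value_in _ jb) (negPf nPj).
  have [aj|ja] := leP a (tau j).
    apply: (sub a (tau j)) => //; first by have /andP[/ltW] := jb.
    by rewrite aE b00 Ftau// ltnW.
  have ja' : in_gap j a by rewrite /in_gap ja /=; have /andP[_] := jb; exact: lt_trans.
  by apply: zero; rewrite b00 (glued_value_in _ ja') (negPf nPj) subrr.
- have a00 : glued_value P a = 0 by rewrite (glued_value_in _ ia) (negPf nPi).
  have [bi|ib] := leP (tau i.+1) b.
    apply: (sub (tau i.+1) b) => //; first by have /andP[_ /ltW] := ia.
    by rewrite bE a00 (Ftau (ltn_ord i)).
  have ib' : in_gap i b by rewrite /in_gap ib andbT; have /andP[h _] := ia; exact: lt_trans h ab.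
  by apply: zero; rewrite a00 (glued_value_in _ ib') (negPf nPi) subrr.
- by apply: zero; rewrite (glued_value_in _ ia) (glued_value_in _ jb) (negPf nPi) (negPf nPj) subrr.
Qed.

(** In each gap of [P] take the interval from the left end, where the primitive vanishes, to a point
    where it exceeds [eps]; these intervals are disjoint. *)
Lemma bad_gaps_card (P : pred 'I_N) (eps : R) : 0 < eps ->
  (forall i, P i -> exists2 x, in_gap i x & eps < `|Fint f 0 x|) ->
  eps * `|\sum_(k < #|P|) e k| <= JFn f.
Proof.
move=> eps0 bad.
have ex (k : 'I_#|P|) : exists x, in_gap (enum_val k : 'I_N) x /\ eps < `|Fint f 0 x|.
  have Pk : P (enum_val k) := enum_valP k.
  by have [x ? ?] := bad _ Pk; exists x.
pose y k := sval (cid (ex k)).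
have yP k : in_gap (enum_val k : 'I_N) (y k) /\ eps < `|Fint f 0 (y k)| by rewrite /y; case: cid.
pose a (k : 'I_#|P|) := tau (enum_val k : 'I_N).
have ag k x : itv1 (a k) (y k) x -> in_gap (enum_val k : 'I_N) (x ord0 ord0).
  move=> /itv1P/andP[ax xy]; rewrite /in_gap ax /=; have [/andP[_ h] _] := yP k.
  exact: lt_trans xy h.
have := @Fint_family_le R X e esym f _ a y Lf.
have H1 j : 0 <= a j /\ y j <= 1.
  have jN := ltn_ord (enum_val j : 'I_N).
  split; first by apply: tau_ge0; exact: ltnW.
  have [/andP[_ /ltW h] _] := yP j; apply: le_trans h _; exact: tau_le1.
have tT : trivIset setT (fun j => itv1 (a j) (y j)).
  move=> j k _ _ [x [/ag h1 /ag h2]]; apply: enum_val_inj; exact: in_gap_uniq h1 h2.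
move=> /(_ H1 tT); apply: le_trans.
rewrite -[eps]gtr0_norm// -normrZ scaler_sumr.
apply: (symmetric_mono esym (b := fun=> eps)) => k.
have jN := ltn_ord (enum_val k : 'I_N).
have [/andP[h1 h2] h] := yP k; rewrite gtr0_norm//.
rewrite FintE ?Ftau ?subr0 ?(ltW h)//; [exact: ltnW|apply: tau_ge0; exact: ltnW|exact: ltW|].
by have [_] := H1 k.
Qed.

End surgery.

Section approximation.
Context {R : realType} {X : normedModType R} (e : nat -> X).
Hypothesis sb : symmetric_basis e.
Hypothesis rX : reflexive_space X.
Local Notation U := (@unit_interval R).
Local Notation mu := (@lebesgue_rV R 1).
Local Notation JFn := (JF_norm e U).
Let mU := @measurable_unit_interval R.
Context (J : completeNormedModType R) (iota : ('rV[R]_1 -> R) -> J).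
Hypothesis JP : is_JF e U iota.
Variable L : dual J.

Lemma JF_norm_gap f u v : L1 U f -> JFn (f \_ (itv1 u v)) <= JFn f.
Proof.
move=> Lf; apply: (JF_norm_dominated sb mU Lf) => T pT.
exists (T `&` itv1 u v); split; first by apply: cellI; right.
  exact: subIsetl.
by rewrite -Rintegral_mkcondr.
Qed.

(* Otherwise functions vanishing on finer and finer partitions, erased on their
   few large gaps, would be uniformly null without being weakly null. *)
Lemma vanishing_small (rho : R) : 0 < rho ->
  exists N tau, [/\ tau 0%N = 0, tau N = 1,
    (forall i, (i < N)%N -> tau i < tau i.+1) &
    forall f, L1 U f -> (forall i, (i <= N)%N -> Fint f 0 (tau i) = 0) ->
      JFn f <= 1 -> L (iota f) <= rho].
Proof.
move=> rho0; apply: contrapT => nP.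
(* [M p] bounds the number of gaps where the primitive of a function of norm one exceeds 1 / (p +
   1), whatever the partition. Hence the tolerance [ep p] per gap can be fixed before the partition,
   and erasing those gaps costs at most rho / 2. *)
have exM (p : nat) : exists M : nat, p.+1%:R < `|\sum_(k < M) e k|.
  exact: reflexive_unbounded.
pose M p := sval (cid (exM p)).
have MP p : p.+1%:R < `|\sum_(k < M p) e k| by rewrite /M; case: cid.
pose ep p : R := rho / 2 / (M p).+1%:R.
have ep0 p : 0 < ep p by rewrite !divr_gt0.
have ex p : exists g, [/\ L1 U g, JFn g <= 1, rho / 2 <= L (iota g) &
    forall a b, 0 <= a -> a <= b -> b <= 1 -> `|Fint g a b| <= 2 * p.+1%:R^-1].
  have [N [tau [tau0 tauN tauS]]] := small_partition_exists sb rX JP L (ep0 p).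
  have tS i : (i < N)%N -> tau i < tau i.+1 by move=> /tauS[].
  have [f [Lf f0 f1 frho]] : exists f, [/\ L1 U f,
      forall i, (i <= N)%N -> Fint f 0 (tau i) = 0, JFn f <= 1 & rho < L (iota f)].
    apply: contrapT => nf; apply: nP; exists N, tau; split => // f Lf f0 f1.
    by rewrite leNgt; apply/negP => h; apply: nf; exists f.
  pose bad : pred 'I_N := fun i => `[< exists2 x, in_gap tau i x & p.+1%:R^-1 < `|Fint f 0 x| >].
  pose good : pred 'I_N := fun i => ~~ bad i.
  have p0 : 0 < p.+1%:R^-1 :> R by rewrite invr_gt0.
  have card : (#|bad| < M p)%N.
    rewrite ltnNge; apply/negP => h.
    have := @bad_gaps_card R X e sb N tau f tau0 tauN tS Lf f0 bad p.+1%:R^-1 p0.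
    move=> /(_ (fun i => @asboolW _)) h1; have := le_trans h1 f1.
    rewrite mulrC ler_pdivrMr// mul1r leNgt => /negP; apply.
    apply: lt_le_trans (MP p) _.
    rewrite (big_ord_widen _ (fun k => e k) h) big_mkcond/=.
    rewrite (eq_bigr (fun k : 'I_#|bad| => (if (k < M p)%N then 1 else 0 : R) *: e k)); last first.
      by move=> k _; case: ifP; rewrite ?scale1r ?scale0r.
    rewrite [leRHS](_ : _ = `|\sum_(k < #|bad|) (1 : R) *: e k|); last first.
      by congr `|_|; apply: eq_bigr => k _; rewrite scale1r.
    by apply: (symmetric_mono sb) => k; case: ifP; rewrite ?normr1 ?normr0.
  exists (glued tau f good); split.
  - exact: L1_glued.
  - by rewrite (le_trans (JF_norm_glued sb tau0 tauN tS Lf f0 good)).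
  - have fE : iota f = iota (glued tau f (@predT 'I_N)).
      apply: (iota_eq mU JP Lf); first exact: L1_glued.
      move=> T /parallelepiped_itv1[a [b [a0 ab b1 ->]]].
      have b0 : 0 <= b by rewrite (le_trans a0)// ltW.
      have a1 : a <= 1 by rewrite (le_trans _ b1)// ltW.
      rewrite -/(Fint f a b) -/(Fint (glued tau f (@predT 'I_N)) a b).
      rewrite (Fint_glued tau0 tauN tS Lf f0 _ a0 (ltW ab) b1).
      rewrite !(glued_valueT tau0 tauN tS f0)//.
      exact: (FintE Lf a0 (ltW ab) b1).
    have gE (P : pred 'I_N) : L (iota (glued tau f P)) =
        \sum_(i < N | P i) L (iota (f \_ (itv1 (tau i) (tau i.+1)))).
      have := iota_sum mU JP (index_enum 'I_N) (fun=> 1) (fun i _ => L1_gap (tau (i : 'I_N)) (tau i.+1) Lf) (P := P).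
      rewrite (_ : iota _ = iota (glued tau f P)); last first.
        by congr iota; apply/funext => x; apply: eq_bigr => i _; rewrite mul1r.
      move=> ->; rewrite (linear_sum L)/=; apply: eq_bigr => i _.
      by rewrite scale1r.
    move: frho; rewrite fE !gE (bigID good)/= => frho.
    have : \sum_(i < N | ~~ good i) L (iota (f \_ (itv1 (tau i) (tau i.+1)))) <= rho / 2; last by lra.
    apply: (@le_trans _ _ (\sum_(i < N | ~~ good i) ep p)).
      apply: ler_sum => i _; rewrite (le_trans (ler_norm _))//.
      have [_ sm] := tauS i (ltn_ord i); apply: sm => //.
        have := FintE Lf (tau_ge0 tau0 tS (ltnW (ltn_ord i))) (ltW (tS i (ltn_ord i))) (tau_le1 tauN tS (ltn_ord i)).
        by rewrite !f0 ?subrr// ltnW.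
      exact: le_trans (JF_norm_gap _ _ Lf) f1.
    rewrite sumr_const (_ : #|[pred i | ~~ good i]| = #|bad|); last first.
      by apply: eq_card => i; rewrite !inE /good negbK.
    have -> : ep p *+ #|bad| = rho / 2 * ((M p).+1%:R^-1 * #|bad|%:R) by rewrite -[ep p *+ _]mulr_natr mulrA.
    rewrite ler_piMr ?divr_ge0 ?(ltW rho0)//.
    by rewrite mulrC ler_pdivrMr// mul1r ler_nat ltnW// ltnW.
  - move=> a b a0 ab b1; rewrite (Fint_glued tau0 tauN tS Lf f0 good a0 ab b1).
    have small x : 0 <= x -> x <= 1 -> `|glued_value tau f good x| <= p.+1%:R^-1.
      move=> x0 x1; have [[j jN ->]|[i ix]] := tau_locate tau0 tauN x0 x1.
        by rewrite (glued_value_tau _ tS)// normr0 ltW.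
      rewrite (glued_value_in _ tS _ ix); case: ifPn => gi; last by rewrite normr0 ltW.
      rewrite leNgt; apply: contra gi => h; apply/asboolP; by exists x.
    rewrite (le_trans (ler_normB _ _))// mulr2n mulrDl mul1r lerD// small//.
      exact: le_trans ab.
    exact: le_trans b1.
pose g p := sval (cid (ex p)).
have gP p : [/\ L1 U (g p), JFn (g p) <= 1, rho / 2 <= L (iota (g p)) &
    forall a b, 0 <= a -> a <= b -> b <= 1 -> `|Fint (g p) a b| <= 2 * p.+1%:R^-1].
  by rewrite /g; case: cid.
apply: (pointwise_null_weakly_null sb rX JP (f := g) (B := 1) (L := L) (c := rho / 2)).
- by move=> p; have [] := gP p.
- by move=> p; have [] := gP p.
- move=> a b a0 ab b1; apply/cvgrPdist_le => eps eps0.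
  have : 0 < eps / 2 by rewrite divr_gt0.
  move=> /harmonic_lt; apply: filterS => p hp; rewrite sub0r normrN.
  have [_ _ _ /(_ a b a0 ab b1) h] := gP p; apply: le_trans h _.
    by rewrite mulrC -ler_pdivlMr// ltW.
- by rewrite divr_gt0.
- by move=> p; have [] := gP p.
Qed.

(* In dimension one, finite combinations of the functionals f |-> \int_0^t f
   are norm dense in the dual. *)
Lemma dual_JF1_dense (rho : R) : 0 < rho ->
  exists (N : nat) (tau c : nat -> R), [/\ forall i, 0 < tau i /\ tau i <= 1,
    (forall i j, (i < N)%N -> (j < N)%N -> i != j -> tau i != tau j) &
    forall f, L1 U f ->
      `|L (iota f) - \sum_(i < N) c i * Fint f 0 (tau i)| <= rho * JFn f].
Proof.
move=> rho0; have [N [tau [tau0 tauN tauS van]]] := vanishing_small rho0.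
have tmono i j : (i <= j)%N -> (j <= N)%N -> tau i <= tau j := @tau_mono R N tau tauS i j.
have van' f : L1 U f -> (forall i, (i <= N)%N -> Fint f 0 (tau i) = 0) ->
    `|L (iota f)| <= rho * JFn f.
  move=> Lf f0.
  have [f00|fn0] := eqVneq (JFn f) 0.
    by have := dual_iota_le JP L Lf; rewrite f00 !mulr0.
  have fp : 0 < JFn f by rewrite lt_neqAle eq_sym fn0 (JF_norm_ge0 sb mU).
  have Fa a t : 0 <= t -> t <= 1 -> Fint (fun x => a * f x) 0 t = a * Fint f 0 t.
    move=> t0 t1; rewrite /Fint RintegralZl//; first exact: measurable_itv1.
    by apply: (L1_integrable mU) => //; [exact: measurable_itv1|exact: itv1_unit].
  have sc a : `|a| <= (JFn f)^-1 -> a * L (iota f) <= rho.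
    move=> ha; rewrite -[a * _](dualZ L) -(iota_Z JP _ Lf); apply: van.
    - exact: L1_Z.
    - move=> i iN; rewrite Fa ?f0 ?mulr0//; first by apply: (tau_ge0 tau0 tauS).
      exact: (tau_le1 tauN tauS).
    - rewrite (le_trans (JF_norm_Z sb mU _ Lf))//.
      by rewrite (le_trans (ler_wpM2r (ltW fp) ha))// mulVf.
  rewrite ler_norml; apply/andP; split.
    rewrite lerNl; have := sc (- (JFn f)^-1); rewrite normrN gtr0_norm ?invr_gt0// => /(_ (lexx _)).
    by rewrite mulNr -mulrN mulrC ler_pdivrMr.
  have := sc (JFn f)^-1; rewrite gtr0_norm ?invr_gt0// => /(_ (lexx _)).
  by rewrite mulrC ler_pdivrMr.
(* On [V], the functions whose primitive vanishes at all nodes, [L] has norm at most rho. A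
   Hahn-Banach extension L' keeps this bound, and L - L' kills [V], so it depends only on the
   primitive at the nodes. *)
pose V := [set x : J | exists f, [/\ L1 U f, x = iota f &
  forall i, (i <= N)%N -> Fint f 0 (tau i) = 0]].
have t01 i : (i <= N)%N -> 0 <= tau i /\ tau i <= 1.
  by move=> iN; split; [exact: (tau_ge0 tau0 tauS)|exact: (tau_le1 tauN tauS)].
have [||||//|L' [L'E L'rho]] := @hahn_banach R J V L rho.
- exists (fun=> 0); split; first exact: L1_0.
    apply: Logic.eq_sym; apply/eqP; rewrite -normr_le0 (iota_norm JP (L1_0 _)).
    have := JF_norm_Z sb mU 0 (L1_0 U); rewrite normr0 !mul0r.
    by [].
  by move=> i iN; rewrite /Fint Rintegral_cst ?mul0r//; exact: measurable_itv1.
- move=> a _ _ [f [Lf -> f0]] [g [Lg -> g0]].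
  exists (fun x => a * f x + g x); split; first exact: L1_lin.
    by rewrite (iota_lin JP).
  move=> i iN; have [? ?] := t01 i iN.
  by rewrite Fint_lin// f0// g0// mulr0 addr0.
- by move=> a x y _ _; exact: (linearP L).
- by move=> _ [f [Lf -> f0]]; rewrite (iota_norm JP Lf); exact: van'.
- exact: ltW.
have [w w0 wP] : exists2 w : R, 0 < w & forall i j, (i <= N)%N -> (j <= N)%N -> (i < j)%N -> w <= tau j - tau i.
  have [|w w0 wP] := @positive_lower_bound R [seq tau (nat_of_ord i).+1 - tau (nat_of_ord i) | i <- enum 'I_N].
    by apply/allP => _ /mapP[i _ ->]; rewrite subr_gt0 tauS.
  exists w => // i j iN jN ij.
  have iN' : (i < N)%N by exact: leq_trans ij jN.
  have := wP (tau i.+1 - tau i); rewrite (map_f (fun i : 'I_N => tau i.+1 - tau i) (x := Ordinal iN')) ?mem_enum//.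
  move=> /(_ isT) h; apply: le_trans h _; rewrite lerD2r; exact: tmono.
pose h i := tent (tau i) w.
have hE i j : (0 < i <= N)%N -> (j <= N)%N -> Fint (h i) 0 (tau j) = (i == j)%:R.
  move=> /andP[i0 iN] jN; have [? ?] := t01 j jN; have [? ?] := t01 i iN.
  have wi : w <= tau i by have := wP 0%N i (leq0n _) iN i0; rewrite tau0 subr0.
  have [<-|ij] := eqVneq i j; first by rewrite Fint_tent_center.
  rewrite Fint_tent_far//; have [lij|lji|/eqP] := ltngtP i j; last by rewrite (negPf ij).
    by have := wP i j iN jN lij => k; rewrite (le_trans k)// ler_norm.
  by have := wP j i jN iN lji => k; rewrite distrC (le_trans k)// ler_norm.
(* The tents [h] are dual to the nodes and thus give the coefficients of L - L'. The node 0
   contributes nothing, hence the shift by one; the value 1 from index N on keeps all points in (0,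
   1]. *)
exists N, (fun i => if (i < N)%N then tau i.+1 else 1), (fun i => L (iota (h i.+1)) - L' (iota (h i.+1))).
split.
- move=> i; case: ifPn => [iN|_]; last by rewrite ltr01 lexx.
  split; last by have [] := t01 i.+1 iN.
  by apply: lt_le_trans w0 _; have := wP 0%N i.+1 (leq0n _) iN (ltn0Sn _); rewrite tau0 subr0.
- move=> i j iN jN; rewrite iN jN.
  have [lij _|lji _|->] := ltngtP i j; last by rewrite eqxx.
    by rewrite lt_eqF// -subr_gt0; apply: lt_le_trans w0 (wP _ _ _ _ _).
  by rewrite gt_eqF// -subr_gt0; apply: lt_le_trans w0 (wP _ _ _ _ _).
move=> f Lf.
pose g x := \sum_(i < N) Fint f 0 (tau i.+1) * h i.+1 x.
have Lh i : L1 U (h i) by exact: L1_tent.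
have Lg : L1 U g by apply: (L1_sum mU) => i _; exact: L1_Z.
have ig : iota g = \sum_(i < N) Fint f 0 (tau i.+1) *: iota (h i.+1).
  by apply: (iota_sum mU JP) => i _.
have Fg j : (j <= N)%N -> Fint g 0 (tau j) = Fint f 0 (tau j).
  move=> jN; have [p q] := t01 j jN; rewrite /g {1}/Fint (Rintegral_sum mU)//; last 3 first.
  - by move=> i _; exact: L1_Z.
  - exact: measurable_itv1.
  - exact: itv1_unit.
  rewrite (eq_bigr (fun i : 'I_N => Fint f 0 (tau i.+1) * (i.+1 == j)%:R)); last first.
    move=> i _; rewrite RintegralZl//; last 2 first.
    - exact: measurable_itv1.
    - by apply: (L1_integrable mU) => //; [exact: measurable_itv1|exact: itv1_unit].
    by rewrite -/(Fint _ _ _) hE//= ltn_ord.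
  case: j jN {p q} => [|j] jN.
    by rewrite tau0 Fint_nil// big1// => i _; rewrite mulr0.
  rewrite (bigD1 (Ordinal jN))//= eqxx mulr1 big1 ?addr0// => i.
  by rewrite -val_eqE/= eqSS => /negPf ->; rewrite mulr0.
have VE : V (-1 *: iota g + iota f).
  exists (fun x => -1 * g x + f x); split; first exact: L1_lin.
    by rewrite (iota_lin JP).
  move=> i iN; have [? ?] := t01 i iN.
  by rewrite Fint_lin// Fg// mulN1r addNr.
have := L'E _ VE; rewrite !linearP/= => E1.
have -> : L (iota f) - \sum_(i < N) (L (iota (h i.+1)) - L' (iota (h i.+1))) *
    Fint f 0 (if (i < N)%N then tau i.+1 else 1) = L' (iota f).
  have LgE (K : dual J) : K (iota g) = \sum_(i < N) K (iota (h i.+1)) * Fint f 0 (tau i.+1).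
    by rewrite ig (linear_sum K)/=; apply: eq_bigr => i _; rewrite [LHS](dualZ K) mulrC.
  have -> : \sum_(i < N) (L (iota (h i.+1)) - L' (iota (h i.+1))) *
      Fint f 0 (if (i < N)%N then tau i.+1 else 1) = L (iota g) - L' (iota g).
    rewrite !LgE -sumrB; apply: eq_bigr => i _; rewrite ltn_ord.
    by rewrite mulrBl.
  by move: E1; rewrite !scaleN1r; lra.
rewrite (le_trans (dual_iota_le JP L' Lf))// ler_wpM2r//.
exact: (JF_norm_ge0 sb mU).
Qed.

End approximation.

(** * Estimates for finite combinations of point evaluations of the primitive *)

Section dual_norm_on_L1.
Context {R : realType} {X : normedModType R} (e : nat -> X).
Context {d : nat} (Omega : set 'rV[R]_d).
Context (J : completeNormedModType R) (iota : ('rV[R]_d -> R) -> J).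
Hypothesis JP : is_JF e Omega iota.

Lemma dual_norm_L1 (L : dual J) (C : R) : 0 <= C ->
  (forall f, L1 Omega f -> `|L (iota f)| <= C * JF_norm e Omega f) -> `|L| <= C.
Proof.
move=> C0 LC; apply: dual_norm_le => x x1.
apply/ler_addgt0Pr => eps eps0.
have D0 : 0 < C + `|L| + 1 by rewrite ltr_wpDl// addr_ge0.
have r0 : 0 < eps / (C + `|L| + 1) by rewrite divr_gt0.
have [_ iP dn] := JP.
have [y [/= xf [f Lf fE]]] := dn (ball x (eps / (C + `|L| + 1))) (ex_intro _ x (ballxx x r0)) (ball_open x _).
rewrite -ball_normE/= -fE in xf.
rewrite -[x](subrK (iota f)) linearD/=.
rewrite (le_trans (ler_normD _ _))//.
have h1 := dual_le L (x - iota f); have h2 := LC f Lf; rewrite -(iP f Lf) in h2.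
have h3 : `|iota f| <= `|x| + `|x - iota f|.
  by rewrite -{1}[iota f](subKr x) ler_normB.
have h4 : `|x - iota f| * (C + `|L| + 1) <= eps by rewrite -ler_pdivlMr// ltW.
have h5 : C * `|iota f| <= C * (1 + `|x - iota f|).
  by rewrite ler_wpM2l// (le_trans h3)// lerD2r.
have h6 : 0 <= `|x - iota f| by [].
move: h1 h2 h4 h5 h6; move: `|L (x - iota f)| `|L (iota f)| `|x - iota f| `|L| `|iota f| => a b p l z.
rewrite !mulrDr !mulr1; lra.
Qed.

End dual_norm_on_L1.

Lemma separation {R : realType} (K : nat) (s : 'I_K -> R) : (forall i, 0 < s i) ->
  exists2 w, 0 < w & (forall i, w <= s i) /\
    (forall i j, s i != s j -> 2 * w <= `|s i - s j|).
Proof.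
move=> s0.
pose gaps := [seq s i | i <- enum 'I_K] ++
  [seq `|s ij.1 - s ij.2| / 2 | ij <- [seq (i, j) | i <- enum 'I_K, j <- enum 'I_K] & s ij.1 != s ij.2].
have [|w w0 wP] := @positive_lower_bound R gaps.
  rewrite all_cat; apply/andP; split; first by apply/allP => x /mapP[i _ ->].
  apply/allP => x /mapP[ij]; rewrite mem_filter => /andP[ijn _] ->.
  by rewrite divr_gt0// normr_gt0 subr_eq0.
exists w => //; split; first by move=> i; apply: wP; rewrite mem_cat map_f ?mem_enum.
move=> i j ij; rewrite mulrC -ler_pdivlMr//; apply: wP; rewrite mem_cat; apply/orP; right.
apply/mapP; exists (i, j) => //; rewrite mem_filter/= ij/=.
by apply/allpairsP; exists (i, j); rewrite !mem_enum.
Qed.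

Section point_evaluations.
Context {R : realType} {X : normedModType R} (e : nat -> X).
Hypothesis sb : symmetric_basis e.
Local Notation U := (@unit_interval R).
Local Notation JFn := (JF_norm e U).
Let mU := @measurable_unit_interval R.
Context (J : completeNormedModType R) (iota : ('rV[R]_1 -> R) -> J).
Hypothesis JP : is_JF e U iota.

Lemma primitive_functionals : exists delta : R -> dual J,
  forall s f, 0 <= s -> s <= 1 -> L1 U f -> delta s (iota f) = Fint f 0 s.
Proof.
suff H s : exists D : dual J, 0 <= s -> s <= 1 -> forall f, L1 U f -> D (iota f) = Fint f 0 s.
  exists (fun s => sval (cid (H s))) => s f s0 s1 Lf.
  by case: cid => D /= DP; apply: DP.
have [s01|ns] := pselect (0 <= s <= 1); last first.
  by exists 0 => s0 s1; exfalso; apply: ns; rewrite s0.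
have /andP[s0 s1] := s01.
have e0 := symmetric_e_neq0 sb.
have [|||D [DE _]] := @dual_extension R X e 1 U mU J iota JP (fun f => Fint f 0 s) `|e 0%N|^-1.
- by move=> a f g Lf Lg; exact: Fint_lin.
- move=> f Lf; rewrite mulrC ler_pdivlMr//.
  apply: (Rintegral_cell_le sb mU Lf); exact: cell_itv1.
- by rewrite invr_ge0.
by exists D.
Qed.

Variable delta : R -> dual J.
Hypothesis deltaE : forall s f, 0 <= s -> s <= 1 -> L1 U f -> delta s (iota f) = Fint f 0 s.

Lemma sum_dualE (I : Type) (r : seq I) (P : pred I) (c : I -> R) (D : I -> dual J) x :
  (\sum_(i <- r | P i) c i *: D i : dual J) x = \sum_(i <- r | P i) c i * D i x.
Proof.
elim/big_rec2 : _ => [//|i u v _ <-].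
by [].
Qed.

(* Tested against bumps at the points tau. *)
Lemma coefficients_le (N : nat) (tau c b : 'I_N -> R) :
  (forall i, 0 < tau i /\ tau i <= 1) -> injective tau ->
  `|\sum_i c i * b i| <= 4 * `|\sum_i c i *: delta (tau i)| * `|\sum_i b i *: e i|.
Proof.
move=> t01 tinj.
have [|w w0 [wt wtt']] := @separation R N tau; first by move=> i; have [] := t01 i.
have wtt i j : i != j -> 2 * w <= `|tau i - tau j| by move=> ij; apply: wtt'; rewrite (inj_eq tinj).
pose f x := \sum_i b i * tent (tau i) w x.
have Lf : L1 U f by apply: (L1_sum mU) => i _; apply: L1_Z => //; exact: L1_tent.
have Ff j : Fint f 0 (tau j) = b j.
  have [/ltW p q] := t01 j.
  rewrite /f {1}/Fint (Rintegral_sum mU)//; last 3 first.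
  - by move=> i _; apply: L1_Z => //; exact: L1_tent.
  - exact: measurable_itv1.
  - exact: itv1_unit.
  rewrite (eq_bigr (fun i => b i * (i == j)%:R)); last first.
    move=> i _; rewrite RintegralZl//; last 2 first.
    - exact: measurable_itv1.
    - by apply: (L1_integrable mU) => //; [exact: L1_tent|exact: measurable_itv1|exact: itv1_unit].
    rewrite -/(Fint _ _ _); congr (_ * _).
    have [<-|ij] := eqVneq i j; first by rewrite Fint_tent_center//; have [] := t01 i.
    by rewrite Fint_tent_far// (le_trans _ (wtt j i _)) ?ler_peMl ?ler1n ?(ltW w0)// eq_sym.
  by rewrite (bigD1 j)//= eqxx mulr1 big1 ?addr0// => i /negPf ->; rewrite mulr0.
have -> : \sum_i c i * b i = (\sum_i c i *: delta (tau i) : dual J) (iota f).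
  rewrite sum_dualE; apply: eq_bigr => i _; rewrite deltaE ?Ff//; have [] := t01 i => //.
  by move/ltW.
rewrite (le_trans (dual_iota_le JP _ Lf))// -mulrA mulrCA ler_wpM2l//.
apply: JF_norm_spikes => //.
by rewrite vol_rV0.
Qed.

Lemma increments_le (K : nat) (s : 'I_K -> R) (phi : dual J -> R) (C : R) : 0 <= C ->
  (forall a L M, phi (a *: L + M) = a * phi L + phi M) ->
  (forall L, `|phi L| <= C * `|L|) ->
  (forall q : rat, 0 < ratr q :> R -> ratr q <= 1 :> R -> phi (delta (ratr q)) = 0) ->
  (forall i, 0 < s i /\ s i <= 1) ->
  (forall i j, i != j -> s i = s j -> phi (delta (s i)) = 0) ->
  `|\sum_i phi (delta (s i)) *: e i| <= C.
Proof.
move=> C0 phil phiC phiq s01 sinj.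
have [|w w0 [ws wss]] := @separation R K s; first by move=> i; have [] := s01 i.
(* Where [phi] vanishes, q = s i gives an empty interval. Elsewhere q is rational and within w of s
   i, and since distinct points are 2 w apart the intervals stay disjoint. *)
have exq i : exists q, [/\ 0 <= q, q <= s i, phi (delta q) = 0 &
    (phi (delta (s i)) <> 0 /\ s i - w < q) \/ q = s i].
  have [s0 s1] := s01 i.
  have [p0|/eqP pn0] := eqVneq (phi (delta (s i))) 0.
    by exists (s i); split => //; [exact: ltW|right].
  have [|q] := @rat_in_itvoo R (s i - w) (s i); first by rewrite ltrBlDr ltrDl.
  rewrite in_itv/= => /andP[q1 q2]; have q0 : 0 < ratr q :> R.
    by apply: le_lt_trans q1; rewrite subr_ge0.
  exists (ratr q); split; [exact: ltW|exact: ltW| |by left].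
  by apply: phiq => //; rewrite (le_trans (ltW q2)).
pose q i := sval (cid (exq i)).
have qP i : [/\ 0 <= q i, q i <= s i, phi (delta (q i)) = 0 &
    (phi (delta (s i)) <> 0 /\ s i - w < q i) \/ q i = s i] by rewrite /q; case: cid.
have phi0 : phi 0 = 0.
  by have := phil 1 0 0; rewrite scale1r addr0 mul1r; lra.
have phisum (c : 'I_K -> R) (D : 'I_K -> dual J) : phi (\sum_i c i *: D i) = \sum_i c i * phi (D i).
  elim/big_rec2 : _ => [//|i u v _ <-]; exact: phil.
have tT : trivIset setT (fun j => itv1 (q j) (s j)).
  move=> i j _ _ [x [/itv1P/andP[qi si] /itv1P/andP[qj sj]]]; apply/eqP; apply: contraT => ij.
  have [_ _ _ [[ni ci]|h]] := qP i; last by rewrite h in qi; have := lt_trans qi si; rewrite ltxx.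
  have [_ _ _ [[nj cj]|h]] := qP j; last by rewrite h in qj; have := lt_trans qj sj; rewrite ltxx.
  have /wss : s i != s j by apply/eqP => E; exact: ni (sinj i j ij E).
  rewrite leNgt ltr_norml => /negP[]; apply/andP; split; lra.
have [g [g1 gE]] := norming_functional (\sum_i phi (delta (s i)) *: e i).
rewrite -gE (linear_sum g)/=.
have -> : \sum_(i < K) g (phi (delta (s i)) *: e i) =
    phi (\sum_(i < K) g (e i) *: (delta (s i) - delta (q i))).
  rewrite phisum; apply: eq_bigr => i _; rewrite [LHS](dualZ g) mulrC; congr (_ * _).
  have [_ _ q0 _] := qP i.
  by rewrite addrC -scaleN1r phil q0 mulr0 add0r.
rewrite (le_trans (ler_norm _))// (le_trans (phiC _))// ler_piMr//.
apply: (dual_norm_L1 JP) => // f Lf; rewrite mul1r sum_dualE.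
have -> : \sum_(i < K) g (e i) * (delta (s i) - delta (q i) : dual J) (iota f) =
    g (\sum_i Fint f (q i) (s i) *: e i).
  rewrite (linear_sum g)/=; apply: eq_bigr => i _; rewrite [RHS](dualZ g) mulrC; congr (_ * _).
  have [q0 qs _ _] := qP i; have [si0 si1] := s01 i.
  transitivity (delta (s i) (iota f) - delta (q i) (iota f)); first by [].
  rewrite !deltaE//; [|exact: le_trans si1|exact: ltW].
  by rewrite -(FintE Lf).
rewrite (le_trans (dual_le _ _))// (le_trans (ler_piMl _ g1))//.
apply: (Fint_family_le sb Lf) => // j; have [? _ _ _] := qP j; by have [] := s01 j.
Qed.

End point_evaluations.

(* Iterated limits of a bounded family [xs m (x k)] agree in a reflexive space. *)
Lemma reflexive_double_limit {R : realType} (X : normedModType R)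
    (x : nat -> X) (xs : nat -> dual X) (A B : R) : reflexive_space X -> 0 <= B ->
  (forall k, `|x k| <= A) -> (forall m, `|xs m| <= B) ->
  ~ (forall k m, `|(k < m)%N%:R - xs m (x k)| <= 1 / 4).
Proof.
move=> rX B0 xA xsB sep.
have xsb y m : `|xs m y| <= B * `|y|.
  by rewrite (le_trans (dual_le _ _))// ler_wpM2r.
have [y yE] := reflexive_ulim rX xA.
have [|||g [gE gB]] := @dual_of R X (fun z => ulim (fun m => xs m z)) B.
- move=> a z z'; rewrite -(ulim_lin a (xsb z) (xsb z')); congr ulim.
  by apply/funext => m; exact: (linearP (xs m)).
- by move=> z; exact: ulim_norm (xsb z).
- exact: B0.
have A0 : 0 <= A by exact: le_trans (xA 0%N).
have gb k : `|g (x k)| <= B * A by rewrite gE (le_trans (ulim_norm (xsb _)))// ler_wpM2l.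
have h1 : 3 / 4 <= g y.
  rewrite yE; apply: (ulim_ge gb); apply: nearW => k; rewrite gE.
  apply: (ulim_ge (xsb (x k))); apply: near_ultra; exists k.+1 => // m /= km.
  by have := sep k m; rewrite km ler_norml => /andP[_] /=; lra.
have h2 : g y <= 1 / 4.
  rewrite gE; apply: (ulim_le (xsb y)); apply: nearW => m; rewrite yE.
  have xsA k : `|xs m (x k)| <= B * A by rewrite (le_trans (xsb _ _))// ler_wpM2l.
  apply: (ulim_le xsA); apply: near_ultra; exists m => // k /= mk.
  by have := sep k m; rewrite (ltnNge k m) mk/= mulr0n sub0r normrN; apply: le_trans; exact: ler_norm.
lra.
Qed.

Lemma coordinate_family_le {R : realType} (X : normedModType R) (e : nat -> X)
    (sb : symmetric_basis e) (E : nat -> dual X)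
    (EP : forall (N : nat) (x : X), `|\sum_(i < N) E i x *: e i| <= `|x|)
    (N : nat) (c : 'I_N -> nat) (x : X) : injective c ->
  `|\sum_i E (c i) x *: e i| <= `|x|.
Proof.
move=> cinj.
rewrite -(symmetric_inj sb (b := fun i => E (c i) x) cinj (fun=> erefl)).
pose M := (\max_i c i).+1.
have cM i : (c i < M)%N by rewrite ltnS; exact: leq_bigmax.
pose h i : 'I_M := Ordinal (cM i).
have hinj : injective h by move=> i j /(congr1 val); exact: cinj.
apply: le_trans (EP M x).
have -> : \sum_i E (c i) x *: e (c i) =
    \sum_(j in h @: [set: 'I_N]%SET) E j x *: e j.
  rewrite big_imset; last by move=> i j _ _; exact: hinj.
  by apply: eq_bigl => i; rewrite inE.
apply: (symmetric_sub sb (c := fun j : 'I_M => nat_of_ord j)) => //.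
by move=> i j _ _; exact: val_inj.
Qed.

Section one_dimensional_dual.
Context {R : realType} {X : normedModType R} (e : nat -> X).
Hypothesis sb : symmetric_basis e.
Hypothesis rX : reflexive_space X.
Local Notation U := (@unit_interval R).
Context (J : completeNormedModType R) (iota : ('rV[R]_1 -> R) -> J).
Hypothesis JP : is_JF e U iota.
Variable delta : R -> dual J.
Hypothesis deltaE : forall s f, 0 <= s -> s <= 1 -> L1 U f -> delta s (iota f) = Fint f 0 s.

Lemma dual_JF1_approx (L : dual J) (rho : R) : 0 < rho ->
  exists (N : nat) (tau c : 'I_N -> R), [/\ forall i, 0 < tau i /\ tau i <= 1,
    injective tau & `|L - \sum_i c i *: delta (tau i)| <= rho].
Proof.
move=> rho0; have [N [tau [c [t01 tinj LE]]]] := dual_JF1_dense sb rX JP L rho0.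
exists N, (fun i => tau i), (fun i => c i); split => //.
  move=> i j tij; apply/val_inj/eqP; apply: contraT => ij.
  by have := tinj i j (ltn_ord i) (ltn_ord j) ij; rewrite tij eqxx.
apply: (dual_norm_L1 JP) => [|f Lf]; first exact: ltW.
apply: le_trans (LE f Lf).
rewrite (_ : (L - _ : dual J) (iota f) = L (iota f) - (\sum_(i < N) c i *: delta (tau i) : dual J) (iota f))//.
rewrite sum_dualE (eq_bigr (fun i : 'I_N => c i * Fint f 0 (tau i)))// => i _.
by have [/ltW ? ?] := t01 i; rewrite deltaE.
Qed.

Lemma no_triangular_functionals (phi : nat -> dual J -> R) (L : nat -> dual J) (A B : R) :
  0 < A -> 0 <= B ->
  (forall k a F G, phi k (a *: F + G) = a * phi k F + phi k G) ->
  (forall k F, `|phi k F| <= A * `|F|) ->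
  (forall k (q : rat), 0 < ratr q :> R -> ratr q <= 1 :> R -> phi k (delta (ratr q)) = 0) ->
  (forall m, `|L m| <= B) ->
  (forall k m, phi k (L m) = (k < m)%N%:R) -> False.
Proof.
move=> A0 B0 phil phiA phiq LB phiL.
(* Chosen so that A rho = 1 / 4, the tolerance in [reflexive_double_limit]. *)
pose rho : R := (4 * A)^-1; have rho0 : 0 < rho by rewrite invr_gt0 mulr_gt0.
pose N m := projT1 (cid (dual_JF1_approx (L m) rho0)).
have ap m : exists tau : 'I_(N m) -> R, exists c : 'I_(N m) -> R, [/\ forall i, 0 < tau i /\ tau i <= 1,
    injective tau & `|L m - \sum_i c i *: delta (tau i)| <= rho].
  by rewrite /N; case: cid => n [tau [c H]]; exists tau, c.
pose tau m := sval (cid (ap m)).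
have ap' m : exists c : 'I_(N m) -> R, [/\ forall i, 0 < tau m i /\ tau m i <= 1,
    injective (tau m) & `|L m - \sum_i c i *: delta (tau m i)| <= rho].
  by rewrite /tau; case: cid.
pose c m := sval (cid (ap' m)).
have cP m : [/\ forall i, 0 < tau m i /\ tau m i <= 1,
    injective (tau m) & `|L m - \sum_i c m i *: delta (tau m i)| <= rho].
  by rewrite /c; case: cid.
(* The nodes of all the approximations form a countable set. Each receives one coordinate of X, the
   same for every [m], so that vectors indexed by [k] pair with functionals indexed by [m]. *)
pose P := \bigcup_m range (tau m).
have Pc : countable P.
  by apply: bigcup_countable => // m _; apply: finite_set_countable; exact: finite_image.
have /countable_injP[code codeP] := Pc.
have Ptau m i : P (tau m i) by exists m => //; exists i.
have codeI m : injective (fun i => code (tau m i)).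
  move=> i j h; have [_ tinj _] := cP m; apply: tinj.
  by apply: codeP h; apply/mem_set.
(* A coordinate that codes no node gets the point 1, which is rational, so every [phi k] vanishes
   there. *)
pose pt j := if pselect (exists s, P s /\ code s = j) is left h then sval (cid h) else ratr 1 : R.
have ptE s : P s -> pt (code s) = s.
  move=> Ps; rewrite /pt; case: pselect => [h|[]]; last by exists s.
  by case: cid => s' /= [Ps' h']; apply: codeP => //; apply/mem_set.
have pt_code j : code (pt j) = j \/ pt j = ratr 1.
  by rewrite /pt; case: pselect => [h|_]; [left; case: cid => s []|right].
have phi1 k : phi k (delta (ratr 1)) = 0 by apply: phiq; rewrite rmorph1 ?lexx ?ltr01.
have pt01 j : 0 < pt j /\ pt j <= 1.
  rewrite /pt; case: pselect => [h|_]; last by rewrite rmorph1 lexx ltr01.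
  by case: cid => _ /= [[m _ [i _ <-]] _]; have [] := cP m.
have [E [Ee E0 Ec EP]] := coordinate_functionals sb.
(* [increments_le] bounds these partial sums by [A]; their weak ultralimit is an element of X with
   the prescribed coordinates. *)
pose u k n : X := \sum_(j < n) phi k (delta (pt j)) *: e j.
have uA k n : `|u k n| <= A.
  apply: (increments_le sb JP deltaE (s := fun j : 'I_n => pt j)) => //; [exact: ltW|exact: phiq|].
  move=> i j ij ptij; have [ci|->//] := pt_code i.
  have [cj|cj] := pt_code j; last by rewrite ptij cj.
  by rewrite -val_eqE/= -ci ptij cj eqxx in ij.
have xe k : exists x : X, `|x| <= A /\ forall f : dual X, f x = ulim (fun n => f (u k n)).
  have [x xE] := reflexive_ulim rX (uA k); exists x; split => //.
  have [g [g1 <-]] := norming_functional x.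
  have gu n : `|g (u k n)| <= A.
    by rewrite (le_trans (dual_le _ _))// (le_trans (ler_piMl _ g1)).
  by rewrite xE (le_trans (ler_norm _))// ulim_norm.
pose x k := sval (cid (xe k)).
have xP k : `|x k| <= A /\ forall f : dual X, f (x k) = ulim (fun n => f (u k n)) by rewrite /x; case: cid.
have Ex k j : E j (x k) = phi k (delta (pt j)).
  have [_ ->] := xP k; apply: ulimE; apply: cvg_near_cst; apply: near_ultra; exists j.+1 => // n /= jn.
  rewrite (linear_sum (E j))/= (bigD1 (Ordinal jn))//= big1 => [|i].
    by rewrite addr0 [LHS](dualZ (E j)) Ee eqxx mulr1.
  by rewrite -val_eqE/= => ij; rewrite [LHS](dualZ (E j)) Ee (negPf ij) mulr0.
(* The approximant of [L m] has norm at most B + rho, and the 4 is that of [coefficients_le]. *)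
pose D := 4 * (B + rho).
have D0 : 0 <= D by rewrite mulr_ge0// addr_ge0// ltW.
have xse m : exists f : dual X, (forall y, f y = \sum_(i < N m) c m i * E (code (tau m i)) y) /\ `|f| <= D.
  apply: dual_of => //.
    move=> a y z; rewrite mulr_sumr -big_split/=; apply: eq_bigr => i _.
    by rewrite linearP/= mulrDr mulrCA.
  move=> y; have [t01 tinj Lc] := cP m.
  rewrite (le_trans (coefficients_le sb JP deltaE (c m) _ t01 tinj))//.
  apply: ler_pM => //; last exact: coordinate_family_le.
  rewrite ler_wpM2l// -[X in `|X|](subKr (L m)) (le_trans (ler_normB _ _))// lerD//.
pose xs m := sval (cid (xse m)).
have xsP m : (forall y, xs m y = \sum_(i < N m) c m i * E (code (tau m i)) y) /\ `|xs m| <= D.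
  by rewrite /xs; case: cid.
apply: (reflexive_double_limit rX D0 (x := x) (xs := xs) (A := A)) => [k|m|k m].
- by have [] := xP k.
- by have [] := xsP m.
have [-> _] := xsP m; have [_ _ Lc] := cP m.
have phi0 : phi k 0 = 0.
  by have := phil k 1 0 0; rewrite scale1r addr0 mul1r; lra.
have -> : (k < m)%N%:R - \sum_(i < N m) c m i * E (code (tau m i)) (x k) =
    phi k (L m - \sum_i c m i *: delta (tau m i)).
  have phiB F G : phi k (F - G) = phi k F - phi k G.
    by rewrite addrC -scaleN1r phil mulN1r addrC.
  rewrite phiB phiL; congr (_ - _).
  transitivity (\sum_(i < N m) c m i * phi k (delta (tau m i))).
    by apply: eq_bigr => i _; rewrite Ex ptE.
  elim/big_rec2 : _ => [//|i y v _ ->]; by rewrite phil.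
rewrite (le_trans (phiA _ _))// (le_trans (ler_wpM2l (ltW A0) Lc))//.
by rewrite /rho invfM mulrCA mulfV ?gt_eqF// mulr1 mul1r.
Qed.

End one_dimensional_dual.

(** * Jump functionals *)

Section spike_functionals.
Context {R : realType} {X : normedModType R} (e : nat -> X).
Hypothesis sb : symmetric_basis e.
Context {n : nat} (Omega : set 'rV[R]_n.+1).
Hypothesis mO : measurable Omega.
Local Notation mu := (@lebesgue_rV R n.+1).
Context (J : completeNormedModType R) (iota : ('rV[R]_n.+1 -> R) -> J).
Hypothesis JP : is_JF e Omega iota.

Section fixed_spikes.
Variables u v : 'rV[R]_n.
Hypothesis uv : 0 < vol u v.

Lemma spikes_dual_le (M : dual J) (K : nat) (t b : 'I_K -> R) (w : R) : 0 < w ->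
  (forall i j, i != j -> 2 * w <= `|t i - t j|) ->
  `|\sum_i b i * M (iota (spike u v (t i) w))| <= 4 * `|M| * `|\sum_i b i *: e i|.
Proof.
move=> w0 tw.
have -> : \sum_i b i * M (iota (spike u v (t i) w)) =
    M (iota (fun x => \sum_i b i * spike u v (t i) w x)).
  rewrite (iota_sum mO JP (index_enum 'I_K) b (f := fun i => spike u v (t i) w)); last first.
    by move=> i _; exact: L1_spike.
  by rewrite (linear_sum M)/=; apply: eq_bigr => i _; rewrite [RHS](dualZ M).
rewrite (le_trans (dual_iota_le JP M _))//.
  by apply: (L1_sum mO) => i _; apply: L1_Z => //; exact: L1_spike.
by rewrite mulrAC -mulrA mulrC mulrA ler_wpM2r// JF_norm_spikes.
Qed.

Lemma spike_dual_le (M : dual J) t m :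
  `|M (iota (spike u v t m.+1%:R^-1))| <= 4 * `|e 0%N| * `|M|.
Proof.
have := @spikes_dual_le M 1 (fun=> t) (fun=> 1) m.+1%:R^-1.
rewrite !big_ord1 mul1r scale1r mulrAC; apply; first by rewrite invr_gt0.
by move=> i j; rewrite !ord1 eqxx.
Qed.

Definition jump (t : R) (M : dual J) : R :=
  ulim (fun m => M (iota (spike u v t m.+1%:R^-1))).

Lemma jump_lin t a (M M' : dual J) : jump t (a *: M + M') = a * jump t M + jump t M'.
Proof. by rewrite -(ulim_lin a (spike_dual_le M t) (spike_dual_le M' t)). Qed.

Lemma jump_le t M : `|jump t M| <= 4 * `|e 0%N| * `|M|.
Proof. exact: ulim_norm (spike_dual_le M t). Qed.

Hypothesis rX : reflexive_space X.

(** Take N points where the jump exceeds [eps], and one scale at which their spikes are separated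
    and still see this. Combining the spikes with signs gives N eps <= 4 |M| |e_0 + ... + e_(N-1)|,
    whose right side is o(N). *)
Lemma jump_finite (M : dual J) (eps : R) : 0 < eps ->
  finite_set [set t | eps < `|jump t M|].
Proof.
move=> eps0; apply: contrapT => infA.
have D0 : 0 < 4 * `|M| + 1 by rewrite ltr_wpDl// mulr_ge0.
have eD0 : 0 < eps / (4 * `|M| + 1) by rewrite divr_gt0.
have [N N0 NE] := reflexive_average sb rX eD0.
have [B BA BN] := infinite_set_fset N infA.
pose s (i : 'I_N) := nth 0 (finmap.enum_fset B) i.
have iB (i : 'I_N) : (i < size (finmap.enum_fset B))%N by exact: leq_trans (ltn_ord i) BN.
have sA i : eps < `|jump (s i) M| by apply: BA; exact: mem_nth.
have sne i j : i != j -> s i != s j.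
  by move=> ij; rewrite nth_uniq// finmap.fset_uniq.
have sgap : \forall m \near nat_ultra, forall i j, i != j -> 2 * m.+1%:R^-1 <= `|s i - s j|.
  apply: filter_forall => i; apply: filter_forall => j.
  have [->|ij] := eqVneq i j; first exact: nearW.
  have : 0 < `|s i - s j| / 2 by rewrite divr_gt0// normr_gt0 subr_eq0 sne.
  move=> /harmonic_lt/near_ultra; apply: filterS => m hm _.
  by rewrite mulrC -ler_pdivlMr// ltW.
have slarge : \forall m \near nat_ultra, forall i, eps < `|M (iota (spike u v (s i) m.+1%:R^-1))|.
  apply: filter_forall => i.
  have /cvg_norm/cvgr_gt := ulim_cvg (spike_dual_le M (s i)).
  by apply; exact: sA.
have [m [gm lm]] := filter_ex (filterI sgap slarge).
have w0 : 0 < m.+1%:R^-1 :> R by rewrite invr_gt0.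
have := @spikes_dual_le M N s (fun i => Num.sg (M (iota (spike u v (s i) m.+1%:R^-1)))) _ w0 gm.
rewrite (eq_bigr (fun i => `|M (iota (spike u v (s i) m.+1%:R^-1))|)); last first.
  by move=> i _; rewrite normrEsg.
rewrite leNgt => /negP; apply; apply: (@lt_le_trans _ _ (N%:R * eps)).
  have h : `|\sum_i Num.sg (M (iota (spike u v (s i) m.+1%:R^-1))) *: e i| <= eps / (4 * `|M| + 1) * N%:R.
    apply: le_trans NE; rewrite -[leRHS](_ : `|\sum_(i < N) (1 : R) *: e i| = _); last first.
      by congr `|_|; apply: eq_bigr => i _; rewrite scale1r.
    apply: (symmetric_mono sb) => i; rewrite normr1 normr_sg; by case: (_ != 0).
  apply: le_lt_trans (ler_wpM2l _ h) _; first by rewrite mulr_ge0.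
  rewrite mulrA mulrC ltr_pM2l ?ltr0n// mulrCA mulrC.
  rewrite -[ltRHS]mul1r ltr_pM2r// ltr_pdivrMr// mul1r ltrDl//.
rewrite ger0_norm ?sumr_ge0//.
rewrite -[leLHS]mulrC -[N in N%:R]card_ord mulr_natr -sumr_const; apply: ler_sum => i _.
exact: ltW.
Qed.

Lemma jump_countable (M : dual J) : countable [set t | jump t M != 0].
Proof.
have -> : [set t | jump t M != 0] = \bigcup_p [set t | p.+1%:R^-1 < `|jump t M|].
  apply/seteqP; split => [t /= t0|t [p _ /= pt]].
    have /harmonic_lt[p _ pt] : 0 < `|jump t M| by rewrite normr_gt0.
    by exists p => //=; apply: pt => /=.
  by rewrite -normr_gt0; apply: lt_trans pt; rewrite invr_gt0.
apply: bigcup_countable => // p _; apply: finite_set_countable.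
by apply: jump_finite; rewrite invr_gt0.
Qed.

End fixed_spikes.

Lemma box_functional (a b : 'rV[R]_n.+1) : box a b `<=` Omega ->
  exists D : dual J, (forall f, L1 Omega f -> D (iota f) = \int[mu]_(x in box a b) f x) /\
    `|D| <= `|e 0%N|^-1.
Proof.
move=> abO; have e0 := symmetric_e_neq0 sb.
apply: (dual_extension mO JP (l := fun f => \int[mu]_(x in box a b) f x)).
- move=> c f g Lf Lg; apply: (Rintegral_lin mO) => //; exact: measurable_box.
- move=> f Lf; rewrite mulrC ler_pdivlMr//.
  by apply: (Rintegral_cell_le sb mO Lf); exact: cell_box.
- by rewrite invr_ge0.
Qed.

(** The hyperplane carries the upper face of the box in the first coordinate. Once the width is
    below the side of the box, the left slab lies in its range of x_0 and the right slab outside, so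
    the tested values no longer depend on m. *)
Lemma jump_box u v (a b : 'rV[R]_n.+1) (D : dual J) : 0 < vol u v ->
  box a b `<=` Omega -> a ord0 ord0 < b ord0 ord0 ->
  (forall f, L1 Omega f -> D (iota f) = \int[mu]_(x in box a b) f x) ->
  jump u v (b ord0 ord0) D = section_vol u v a b / vol u v.
Proof.
move=> uv abO ab DE; apply: ulimE; apply: cvg_near_cst.
have : 0 < b ord0 ord0 - a ord0 ord0 by rewrite subr_gt0.
move=> /harmonic_lt/near_ultra; apply: filterS => m hm.
have w0 : 0 < m.+1%:R^-1 :> R by rewrite invr_gt0.
rewrite DE; last exact: L1_spike.
rewrite (Rintegral_spike u v mO)//; last exact: measurable_box.
rewrite /left_slab /right_slab !lebesgue_cap_box.
move: (m.+1%:R^-1) w0 hm => w w0 hm.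
rewrite minxx (max_l (x := b ord0 ord0 - w)); last lra.
rewrite (max_r (y := _ - (_ - w))); last lra.
rewrite (max_l (y := Num.min _ _ - _)); last first.
  by rewrite subr_le0 ge_min !le_max lexx !orbT.
rewrite mul0r subr0 opprB addrC subrK.
by rewrite invfM mulrAC mulrA mulVf ?mul1r 1?mulrC// gt_eqF.
Qed.

End spike_functionals.

Lemma open_contains_box {R : realType} (n : nat) (Omega : set 'rV[R]_n) :
  open Omega -> Omega !=set0 ->
  exists lo hi : 'rV[R]_n, (forall i, lo ord0 i < hi ord0 i) /\ box lo hi `<=` Omega.
Proof.
move=> oO [c Oc]; have [r /= r0 rO] : nbhs_ball c Omega by apply/nbhs_ballP; exact: open_nbhs_nbhs.
exists (\row_i (c ord0 i - r)), (\row_i (c ord0 i + r)); split => [i|x xb].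
  by rewrite !mxE ltrBlDr -addrA ltrDl addr_gt0.
apply: rO; split => // i j; rewrite ord1 -ball_normE/=; have := xb j; rewrite !mxE.
by rewrite ltr_distlC.
Qed.

(** * Triangular jumps along one hyperplane *)

Section no_dual_surjection.
Context {R : realType} {X : normedModType R} (e : nat -> X).
Hypothesis sb : symmetric_basis e.
Hypothesis rX : reflexive_space X.
Context {n : nat} (Omega : set 'rV[R]_n.+2).
Hypothesis oO : open Omega.
Hypothesis O0 : Omega !=set0.
Context (JO : completeNormedModType R) (iota : ('rV[R]_n.+2 -> R) -> JO).
Hypothesis JOP : is_JF e Omega iota.
Context (J1 : completeNormedModType R) (iota1 : ('rV[R]_1 -> R) -> J1).
Hypothesis J1P : is_JF e unit_interval iota1.

(* The slabs (d k, d k.+1) of the second coordinate carry the jumps that separate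
   the integrals over {x_0 < t, x_1 < d m}, all of them along the same hyperplane
   {x_0 = t}. *)
Lemma no_dual_surjection (Q : dual J1 -> dual JO) (C : R) : 0 <= C ->
  (forall a L M, Q (a *: L + M) = a *: Q L + Q M) ->
  (forall L, `|Q L| <= C * `|L|) ->
  (forall M, exists L, Q L = M /\ `|L| <= C * `|M|) -> False.
Proof.
move=> C0 Ql QC Qs.
have mO : measurable Omega := open_measurable_rV oO.
have [lo [hi [lohi boxO]]] := open_contains_box oO O0.
have e0 := symmetric_e_neq0 sb.
pose y : 'I_n.+2 := lift ord0 ord0.
(* The levels increase from the midpoint towards the upper end; the shift by 2 keeps the first one
   above the lower end. *)
pose d k := hi ord0 y - (hi ord0 y - lo ord0 y) / k.+2%:R.
have g0 : 0 < hi ord0 y - lo ord0 y by rewrite subr_gt0.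
have dmono k m : (k <= m)%N -> d k <= d m.
  by move=> km; rewrite lerD2l lerN2 ler_pM2l// lef_pV2 ?posrE// ler_nat !ltnS.
have dS k : d k < d k.+1.
  by rewrite ltrD2l ltrN2 ltr_pM2l// ltf_pV2 ?posrE// ltr_nat.
have dhi k : d k < hi ord0 y by rewrite ltrBlDr ltrDl divr_gt0.
have dlo k : lo ord0 y < d k.
  by rewrite ltrBrDr -ltrBrDl ltr_pdivrMr// ltr_pMr// ltr1n.
have [u uE] : exists u : nat -> 'rV[R]_n.+1, forall k i,
    u k ord0 i = if i == ord0 then d k else lo ord0 (lift ord0 i).
  by exists (fun k => \row_i (if i == ord0 then d k else lo ord0 (lift ord0 i))) => k i; rewrite mxE.
have [v vE] : exists v : nat -> 'rV[R]_n.+1, forall k i,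
    v k ord0 i = if i == ord0 then d k.+1 else hi ord0 (lift ord0 i).
  by exists (fun k => \row_i (if i == ord0 then d k.+1 else hi ord0 (lift ord0 i))) => k i; rewrite mxE.
have uv k : 0 < vol (u k) (v k).
  by apply: prodr_gt0 => i _; rewrite uE vE lt_max subr_gt0; case: ifP; rewrite ?dS ?lohi orbT.
have [b b0 bS] : exists2 b : R -> nat -> 'rV[R]_n.+2, forall t m, b t m ord0 ord0 = t &
    forall t m i, b t m ord0 (lift ord0 i) = if i == ord0 then d m else hi ord0 (lift ord0 i).
  exists (fun t m => rV_cons (t, \row_i (if i == ord0 then d m else hi ord0 (lift ord0 i)))) => [t m|t m i].
    by rewrite rV_cons0.
  by rewrite rV_consS mxE.
have bO t m : t < hi ord0 ord0 -> box lo (b t m) `<=` Omega.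
  move=> th x xb; apply: boxO => i; have /andP[-> h] := xb i; apply: lt_le_trans h _.
  case: (unliftP ord0 i) => [j|] ->; last by rewrite b0 ltW.
  by rewrite bS; case: eqVneq => [->|_]; [exact: ltW|].
(* The slab between levels k and k + 1 lies below level m when k < m, and above it otherwise; the
   remaining coordinates do not cut it. *)
have secE t k m : section_vol (u k) (v k) lo (b t m) / vol (u k) (v k) = (k < m)%N%:R.
  have rE p (F : 'I_p -> R) j : (\row_i F i) ord0 j = F j by rewrite mxE.
  have [km|mk] := ltnP k m.
    rewrite (_ : section_vol _ _ _ _ = vol (u k) (v k)) ?divff ?gt_eqF//.
    rewrite /section_vol /vol; apply: eq_bigr => i _; rewrite !rE bS uE vE.
    case: eqVneq => [->|_]; last by rewrite maxxx minxx.
    by rewrite (min_l (dmono _ _ km)) (max_l (ltW (dlo k))).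
  rewrite (_ : section_vol _ _ _ _ = 0) ?mul0r//.
  rewrite /section_vol /vol (bigD1 ord0)//= !rE bS uE vE eqxx max_l ?mul0r//.
  by rewrite subr_le0 ge_min !le_max (dmono _ _ mk) orbT.
have [delta deltaE] := primitive_functionals sb J1P.
pose bad := \bigcup_k \bigcup_(q : rat) [set t | jump iota (u k) (v k) t (Q (delta (ratr q))) != 0].
have cbad : countable bad.
  apply: bigcup_countable => // k _; apply: bigcup_countable => // q _.
  exact: (jump_countable sb mO JOP (uv k) rX).
have [t [/andP[lt th] tbad]] : exists t, lo ord0 ord0 < t < hi ord0 ord0 /\ ~ bad t.
  apply: contrapT => nt.
  have : lebesgue_measure `]lo ord0 ord0, hi ord0 ord0[ = 0%E.
    apply: countable_lebesgue_measure0; apply: sub_countable cbad; apply: subset_card_le.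
    move=> t; rewrite /= in_itv/= => tI; apply: contrapT => tb; apply: nt; by exists t.
  rewrite lebesgue_measure_itv/= lte_fin lohi -EFinD => /eqP; rewrite eqe subr_eq0.
  by rewrite gt_eqF.
have DX m : exists D : dual JO, (forall f, L1 Omega f ->
    D (iota f) = \int[lebesgue_rV n.+2]_(x in box lo (b t m)) f x) /\ `|D| <= `|e 0%N|^-1.
  by apply: (box_functional sb mO JOP); exact: bO.
pose D m := sval (cid (DX m)).
have DP m : (forall f, L1 Omega f ->
    D m (iota f) = \int[lebesgue_rV n.+2]_(x in box lo (b t m)) f x) /\ `|D m| <= `|e 0%N|^-1.
  by rewrite /D; case: cid.
pose L m := sval (cid (Qs (D m))).
have LP m : Q (L m) = D m /\ `|L m| <= C * `|D m| by rewrite /L; case: cid.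
(* C + 1 in place of C makes the bound on the jumps positive even when C = 0. *)
apply: (no_triangular_functionals sb rX J1P deltaE
  (phi := fun k F => jump iota (u k) (v k) t (Q F)) (L := L)
  (A := 4 * `|e 0%N| * (C + 1)) (B := C * `|e 0%N|^-1)).
- by rewrite mulr_gt0 ?ltr_wpDl// mulr_gt0.
- by rewrite mulr_ge0 ?invr_ge0.
- by move=> k a F G; rewrite Ql (jump_lin sb mO JOP (uv k)).
- move=> k F; rewrite (le_trans (jump_le sb mO JOP (uv k) _ _))// -[leRHS]mulrA ler_wpM2l ?mulr_ge0//.
  by rewrite (le_trans (QC _))// ler_wpM2r// lerDl.
- move=> k q _ _; apply/eqP; apply: contrapT => /negP h; apply: tbad.
  by exists k => //; exists q.
- move=> m; have [_ h] := LP m; have [_ h'] := DP m.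
  by rewrite (le_trans h)// ler_wpM2l.
- move=> k m; have [-> _] := LP m; have [DE _] := DP m.
  have := jump_box mO (uv k) (bO t m th) _ DE; rewrite b0 => /(_ lt) ->.
  exact: secE.
Qed.

End no_dual_surjection.

(** * Quotients of the dual and embeddings of the predual *)

Lemma continuous_linear_bound {R : realType} (V W : normedModType R) (f : {linear V -> W}) :
  continuous f -> exists2 C : R, 0 <= C & forall x, `|f x| <= C * `|x|.
Proof.
move=> cf; have /linear_bounded_continuous/linear_boundedP := cf.
by move=> /pinfty_ex_gt0[C C0 fC]; exists C => //; exact: ltW.
Qed.

Theorem corollary3p7 (R : realType) (X : completeNormedModType R)
    (e : nat -> X) (X_reflexive : reflexive_space X)
    (e_symmetric : symmetric_basis e)
    (d0 : nat) (d0_gt1 : (1 < d0)%N) (Omega : set 'rV[R]_d0)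
    (Omega_open : open Omega) (Omega_bounded : bounded_set Omega)
    (Omega_neq0 : Omega !=set0)
    (JFOmega : completeNormedModType R) (iota : ('rV[R]_d0 -> R) -> JFOmega)
    (JFOmegaP : is_JF e Omega iota)
    (JF1 : completeNormedModType R) (iota1 : ('rV[R]_1 -> R) -> JF1)
    (JF1P : is_JF e unit_interval iota1) :
  ~ isomorphic_to_quotient (dual JFOmega) (dual JF1) /\
  ~ isomorphic_to_subspace JFOmega JF1.
Proof.
case: d0 d0_gt1 Omega Omega_open Omega_bounded Omega_neq0 iota JFOmegaP => [|[|n]]// _ Omega oO _ O0 iota JOP.
have key (Q : dual JF1 -> dual JFOmega) (A B : R) : 0 <= A -> 0 <= B ->
    (forall a L M, Q (a *: L + M) = a *: Q L + Q M) ->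
    (forall L, `|Q L| <= A * `|L|) ->
    (forall M, exists L, Q L = M /\ `|L| <= B * `|M|) -> False.
  move=> A0 B0 Ql QA QB.
  apply: (no_dual_surjection e_symmetric X_reflexive oO O0 JOP JF1P (Q := Q) (C := A + B)) => //.
  - exact: addr_ge0.
  - by move=> L; rewrite (le_trans (QA L))// ler_wpM2r// lerDl.
  - move=> M; have [L [QL LM]] := QB M; exists L; split => //.
    by rewrite (le_trans LM)// ler_wpM2r// lerDr.
split.
  move=> [N [f [g [/continuous_linear_bound[B B0 fB] /continuous_linear_bound[A A0 gA] fK gK]]]].
  pose p (L : dual JF1) : normed_quotient N := (\pi_(Quotient.quot (quotient_kernel N)) L)%qT.
  apply: (key (fun L => g (p L)) A (B + 1)) => //.
  - exact: addr_ge0.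
  - by move=> a L M; rewrite -linearP/= /p (quotient_piD N) -(quotient_scaleE N).
  - move=> L; rewrite (le_trans (gA _))// ler_wpM2l//; exact: (quotient_norm_le N).
  (* A representative of a class exceeds its quotient norm by some positive slack. The slack |M|
     gives the constant B + 1, and so M = 0 is treated apart. *)
  move=> M; have [->|M0] := eqVneq M 0.
    exists 0; split; last by rewrite !normr0 mulr0.
    by rewrite -(scale0r (0 : dual JF1)) /p -(quotient_scaleE N) scale0r linear0.
  have M1 : 0 < `|M| by rewrite normr_gt0.
  have [L pL LM] := quotient_norm_adherent (f M) M1.
  exists L; split; first by rewrite /p pL fK.
  by rewrite (le_trans (ltW LM))// mulrDl mul1r lerD2r; exact: fB.
move=> [N [f [g [/continuous_linear_bound[A A0 fA] /continuous_linear_bound[B B0 gB] fK gK]]]].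
have QX (L : dual JF1) : exists M : dual JFOmega, (forall x, M x = L (val (f x))) /\ `|M| <= A * `|L|.
  apply: dual_of; last by rewrite mulr_ge0.
    by move=> a x y; rewrite linearP/= linearP.
  move=> x; rewrite (le_trans (dual_le _ _))// mulrAC mulrC ler_wpM2r//; exact: fA.
pose Q L := sval (cid (QX L)).
have QP L : (forall x, Q L x = L (val (f x))) /\ `|Q L| <= A * `|L| by rewrite /Q; case: cid.
have QE L x : Q L x = L (val (f x)) by have [] := QP L.
have ext (V : normedModType R) (F G : dual V) : (forall x, F x = G x) -> F = G.
  by move=> FG; apply/val_inj/funext.
apply: (key Q A B) => //.
- move=> a L M; apply: ext => x.
  rewrite QE (_ : (a *: Q L + Q M : dual _) x = a * Q L x + Q M x)//.
  by rewrite !QE.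
- by move=> L; have [] := QP L.
(* A preimage of [M] under the transposed map is a Hahn-Banach extension of [M] composed with [g],
   which lives on [N]; [s] makes it a total function with the default 0 outside [N]. *)
move=> M; pose s (y : JF1) : normed_subspace N := insubd 0 y.
have sK y : y \in N -> val (s y) = y by move=> yN; rewrite /s insubdK.
have [||||//|L [LE LM]] := @hahn_banach R JF1 [set y | y \in N] (fun y => M (g (s y))) (B * `|M|).
- exact: rpred0.
- by move=> a x y /= xN yN; rewrite rpredD// rpredZ.
- move=> a x y /= xN yN; rewrite (_ : s (a *: x + y) = a *: s x + s y).
    by rewrite linearP/= linearP.
  by apply: val_inj; rewrite sK ?linearP/= ?sK// rpredD// rpredZ.
- move=> y /= yN; rewrite (le_trans (dual_le _ _))// mulrAC mulrC ler_wpM2r//.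
  by rewrite (le_trans (gB _))// -{2}(sK y yN).
- by rewrite mulr_ge0.
exists L; split => //; apply: ext => x; rewrite QE LE/=; last exact: (valP (f x)).
by rewrite /s valKd fK.
Qed.
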